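(* Let $K$ be an arbitrary uncountable, compact subspace of $\mathbb{R}^n$. Then there exists a subspace $X$ of $\mathbb{C}^{n+4}$ homeomorphic to $K$ such that $\widehat{X}\setminus X\neq\emptyset$ but $\widehat{X}$ contains no analytic discs.
   Context: For a compact set $X\subset\mathbb{C}^N$, the polynomial hull is $\widehat{X}=\{z\in\mathbb{C}^N: |p(z)|\le \max_{x\in X}|p(x)| \text{ for all polynomials } p\}$. An analytic disc in $\mathbb{C}^N$ is an injective holomorphic map $\sigma:D\to\mathbb{C}^N$, where $D$ is the open unit disc in $\mathbb{C}$; a set $S\subset\mathbb{C}^N$ contains no analytic discs if there is no analytic disc whose image is contained in $S$. *)

(* Defs.v *)
From Stdlib Require Import Reals.
Open Scope R_scope.

Fixpoint rsum (n : nat) (f : nat -> R) : R :=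
  match n with O => 0 | S k => rsum k f + f k end.

Definition Cx : Type := (R * R)%type.
Definition Cconst (a : R) : Cx := (a, 0).
Definition Cadd (z w : Cx) : Cx := (fst z + fst w, snd z + snd w).
Definition Csub (z w : Cx) : Cx := (fst z - fst w, snd z - snd w).
Definition Cmul (z w : Cx) : Cx :=
  (fst z * fst w - snd z * snd w, fst z * snd w + snd z * fst w).
Definition Cmod (z : Cx) : R := sqrt (fst z ^ 2 + snd z ^ 2).

(** Points of R^n and Cx^N are represented as sequences that vanish
    beyond index n (resp. N). *)
Definition in_Rn (n : nat) (x : nat -> R) : Prop := forall i, (n <= i)%nat -> x i = 0.
Definition in_Cn (N : nat) (z : nat -> Cx) : Prop := forall i, (N <= i)%nat -> z i = (0, 0).

Definition distR (n : nat) (x y : nat -> R) : R := sqrt (rsum n (fun i => (x i - y i) ^ 2)).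
Definition distC (N : nat) (z w : nat -> Cx) : R :=
  sqrt (rsum N (fun i => Cmod (Csub (z i) (w i)) ^ 2)).

Definition is_open {T : Type} (d : T -> T -> R) (U : T -> Prop) : Prop :=
  forall x, U x -> exists eps, 0 < eps /\ forall y, d x y < eps -> U y.

Definition is_compact_in {T : Type} (d : T -> T -> R) (K : T -> Prop) : Prop :=
  forall (I : Type) (U : I -> T -> Prop),
    (forall i, is_open d (U i)) ->
    (forall x, K x -> exists i, U i x) ->
    exists l : list I, forall x, K x -> exists i, List.In i l /\ U i x.

Definition uncountable {T : Type} (K : T -> Prop) : Prop :=
  ~ exists h : nat -> T, forall x, K x -> exists k, h k = x.

Definition continuous_on {T U : Type} (d1 : T -> T -> R) (d2 : U -> U -> R)
  (A : T -> Prop) (f : T -> U) : Prop :=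
  forall x, A x -> forall eps, 0 < eps ->
    exists delta, 0 < delta /\ forall y, A y -> d1 x y < delta -> d2 (f x) (f y) < eps.

Definition homeomorphic (N n : nat) (X : (nat -> Cx) -> Prop) (K : (nat -> R) -> Prop) : Prop :=
  exists (f : (nat -> R) -> (nat -> Cx)) (g : (nat -> Cx) -> (nat -> R)),
    (forall x, K x -> X (f x)) /\ (forall z, X z -> K (g z)) /\
    (forall x, K x -> g (f x) = x) /\ (forall z, X z -> f (g z) = z) /\
    continuous_on (distR n) (distC N) K f /\ continuous_on (distC N) (distR n) X g.

Inductive is_poly (N : nat) : ((nat -> Cx) -> Cx) -> Prop :=
| poly_const : forall c : Cx, is_poly N (fun _ => c)
| poly_coord : forall i, (i < N)%nat -> is_poly N (fun z => z i)
| poly_add : forall p q, is_poly N p -> is_poly N q -> is_poly N (fun z => Cadd (p z) (q z))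
| poly_mul : forall p q, is_poly N p -> is_poly N q -> is_poly N (fun z => Cmul (p z) (q z)).

(** Polynomial hull: z in Cx^N with |p(z)| <= max_X |p| (= sup_X |p|) for every polynomial p. *)
Definition poly_hull (N : nat) (X : (nat -> Cx) -> Prop) (z : nat -> Cx) : Prop :=
  in_Cn N z /\
  forall p, is_poly N p ->
    forall M : R, (forall x, X x -> Cmod (p x) <= M) -> Cmod (p z) <= M.

Definition in_disc (w : Cx) : Prop := Cmod w < 1.

Definition C_differentiable_at (f : Cx -> Cx) (w : Cx) : Prop :=
  exists l : Cx, forall eps, 0 < eps -> exists delta, 0 < delta /\
    forall h : Cx, Cmod h < delta ->
      Cmod (Csub (Csub (f (Cadd w h)) (f w)) (Cmul l h)) <= eps * Cmod h.

Definition analytic_disc (N : nat) (sigma : Cx -> (nat -> Cx)) : Prop :=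
  (forall w, in_disc w -> in_Cn N (sigma w)) /\
  (forall w1 w2, in_disc w1 -> in_disc w2 -> sigma w1 = sigma w2 -> w1 = w2) /\
  (forall i, (i < N)%nat -> forall w, in_disc w -> C_differentiable_at (fun u => sigma u i) w).

Definition contains_no_analytic_disc (N : nat) (S : (nat -> Cx) -> Prop) : Prop :=
  ~ exists sigma, analytic_disc N sigma /\ forall w, in_disc w -> S (sigma w).

(* Main.v *)
(* Three ingredients.

   (1) Let [f] be the Cauchy transform of the uniform measure on the self-similar set with digits
   [1, i, -1, -i] and ratio [1/3] (of dimension greater than one, so that [f] is continuous). The image
   [E0] of that set under [(f, z f)] is totally disconnected, since [z] is recovered from [(f, z f)] off the
   single point [f = 0], and by the maximum principle its hull contains the value [(0, 1)] at infinity,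
   which is not in [E0]. All this is done with the rational approximants [f_k].

   (2) Over [C^2], put [y_0 = w] and [y_(j+1) = (y_j^2 - (z_i - alpha_j)) / c_j] with [c_j] tending
   rapidly to [0] and the [alpha_j] dense. The points of [E0 x C] at which all the polynomials [y_j] are
   bounded by [100] form a totally disconnected compact set [E] in [C^3], the bounds persist on its hull, and
   averaging over the two roots lifts [(0, 1)] to the hull of [E]. An analytic disc on which all the [y_j]
   are bounded cannot have [z_i' <> 0] anywhere: for a suitable [j], [y_j^2] would wind once around a small
   circle. So [z] is constant, and then so is [w], because the fibres are totally disconnected.

   (3) [K] contains a copy of the Cantor set, hence one of [E]; let [phi : E -> K] be that embedding, [F] a
   continuous extension of its inverse and [t] the distance to [phi(E)]. Then [x |-> (F x, t x, t x * x)]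
   embeds [K], and since the last [n + 1] coordinates are real, the hull of the image splits into the hulls
   of the fibres, which are points and [E]. *)

Require Import Defs.
From Stdlib Require Import Reals ZArith Field Lra Lia Classical ClassicalEpsilon
  FunctionalExtensionality Cantor List.
From Coquelicot Require Import Complex.
Open Scope R_scope.

(** * Preliminaries *)

(** In (1), zooming onto a piece multiplies the Cauchy kernel by 3 while the piece carries a quarter
    of the mass; the resulting factor 3/4 is below one, and this is what makes the approximants
    converge on the Cantor set itself. Of the hull of [E0] only one extra point is known, so discs
    in it cannot be excluded directly. The way out in (2) is never to compute a hull: bounds on
    polynomials pass from a set to its hull, so it is enough that a set cut out by such bounds
    contains no disc. The bounds must be strong enough for this, yet leave some hull point alive,
    and make the fibres so thin that the set stays totally disconnected; the tower of double covers
    does all three. Total disconnectedness has to be passed from base and fibres to the total space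
    and then to bit sequences, so it is kept in a uniform form, by chains with small steps, instead
    of connected components. The maximum principle needs no complex integration: a second-order
    Taylor expansion with bounded cubic remainder replaces holomorphy. *)

Lemma Cx_field_theory :
  field_theory (RtoC 0 : Cx) (RtoC 1) Cplus Cmult Cminus Copp Cdiv Cinv (@eq Cx).
Proof. exact C_field_theory. Qed.

Add Field Cx_field : Cx_field_theory.

(* [Cx] and Coquelicot's [C] are convertible; [ring] needs the equality at the type of its left side. *)
Ltac align_eq := match goal with |- @eq _ ?a ?b => let T := type of a in change (@eq T a b) end.
Ltac cring := align_eq; ring.

Lemma CaddE z w : Cadd z w = (z + w)%C. Proof. reflexivity. Qed.
Lemma CmulE z w : Cmul z w = (z * w)%C. Proof. reflexivity. Qed.

Lemma abs_le_between x a : Rabs x <= a -> - a <= x <= a.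
Proof. intros H. pose proof (Rle_abs x). pose proof (Rle_abs (- x)). rewrite Rabs_Ropp in *. lra. Qed.

Lemma Cmod_sub_sym a b : Cmod (a - b) = Cmod (b - a).
Proof. rewrite <- Cmod_opp. f_equal. ring. Qed.

Lemma Cmod_sub_tri a b c : Cmod (a - c) <= Cmod (a - b) + Cmod (b - c).
Proof. replace (a - c)%C with ((a - b) + (b - c))%C by ring. apply Cmod_triangle. Qed.

Lemma Cmod_le_add a b : Cmod a <= Cmod b + Cmod (a - b).
Proof. replace a with (b + (a - b))%C at 1 by ring. apply Cmod_triangle. Qed.

Lemma Cmod_sub_le a b : Cmod (a - b) <= Cmod a + Cmod b.
Proof. unfold Cminus. rewrite <- (Cmod_opp b). apply Cmod_triangle. Qed.

Lemma fst_le_Cmod z : Rabs (fst z) <= Cmod z.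
Proof. eapply Rle_trans; [apply Rmax_l | apply Rmax_Cmod]. Qed.

Lemma snd_le_Cmod z : Rabs (snd z) <= Cmod z.
Proof. eapply Rle_trans; [apply Rmax_r | apply Rmax_Cmod]. Qed.

Lemma Cmod_le_abs z : Cmod z <= Rabs (fst z) + Rabs (snd z).
Proof.
  replace z with (RtoC (fst z) + Ci * RtoC (snd z))%C at 1.
  - eapply Rle_trans; [apply Cmod_triangle|]. rewrite Cmod_mult, Cmod_Ci, !Cmod_R. lra.
  - destruct z; unfold Ci, RtoC, Cplus, Cmult; simpl; f_equal; ring.
Qed.

Lemma Cmod_sub0 a b : Cmod (a - b) = 0 -> a = b.
Proof. intros H. apply Cmod_eq_0 in H. replace a with ((a - b) + b)%C by ring. rewrite H. ring. Qed.

Lemma C_sqrt_ex (l : C) : exists s : C, (s * s = l)%C.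
Proof.
  destruct l as [x y].
  set (m := Cmod (x, y)).
  assert (Hm : m * m = x * x + y * y).
  { unfold m, Cmod; simpl. rewrite sqrt_sqrt; [ring | nra]. }
  pose proof (Cmod_ge_0 (x, y)) as Hm0; fold m in Hm0.
  assert (Hx : Rabs x <= m) by apply (fst_le_Cmod (x, y)).
  apply abs_le_between in Hx.
  set (u := sqrt ((m + x) / 2)). set (v := sqrt ((m - x) / 2)).
  assert (Hu : u * u = (m + x) / 2) by (apply sqrt_sqrt; lra).
  assert (Hv : v * v = (m - x) / 2) by (apply sqrt_sqrt; lra).
  assert (Hu0 : 0 <= u) by apply sqrt_pos. assert (Hv0 : 0 <= v) by apply sqrt_pos.
  assert (Huv : (2 * u * v) * (2 * u * v) = y * y).
  { replace ((2 * u * v) * (2 * u * v)) with (4 * (u * u) * (v * v)) by ring.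
    rewrite Hu, Hv. nra. }
  assert (Huv0 : 0 <= 2 * u * v) by (apply Rmult_le_pos; [lra | auto]).
  destruct (Rle_dec 0 y).
  - exists (u, v). unfold Cmult; simpl. f_equal; nra.
  - exists (u, - v). unfold Cmult; simpl. f_equal; nra.
Qed.

Lemma rsum_nonneg n f : (forall i, (i < n)%nat -> 0 <= f i) -> 0 <= rsum n f.
Proof.
  induction n; simpl; intros H; [lra|].
  assert (0 <= rsum n f) by (apply IHn; intros; apply H; lia).
  specialize (H n ltac:(lia)). lra.
Qed.

Lemma rsum_le n f g : (forall i, (i < n)%nat -> f i <= g i) -> rsum n f <= rsum n g.
Proof.
  induction n; simpl; intros H; [lra|].
  assert (rsum n f <= rsum n g) by (apply IHn; intros; apply H; lia).
  specialize (H n ltac:(lia)). lra.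
Qed.

Lemma rsum_ext n f g : (forall i, (i < n)%nat -> f i = g i) -> rsum n f = rsum n g.
Proof.
  induction n; simpl; intros H; [reflexivity|].
  rewrite IHn; [rewrite H; [reflexivity | lia] | intros; apply H; lia].
Qed.

Lemma rsum_plus n f g : rsum n (fun i => f i + g i) = rsum n f + rsum n g.
Proof. induction n; simpl; [ring|]. rewrite IHn. ring. Qed.

Lemma rsum_const n c : rsum n (fun _ => c) = INR n * c.
Proof. induction n; [simpl; ring|]. rewrite S_INR. simpl. rewrite IHn. ring. Qed.

Lemma rsum_term n f i : (forall j, (j < n)%nat -> 0 <= f j) -> (i < n)%nat -> f i <= rsum n f.
Proof.
  induction n; simpl; intros H Hi; [lia|].
  assert (0 <= rsum n f) by (apply rsum_nonneg; intros; apply H; lia).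
  destruct (Nat.eq_dec i n) as [->|]; [lra|].
  assert (f i <= rsum n f) by (apply IHn; [intros; apply H|]; lia).
  specialize (H n ltac:(lia)). lra.
Qed.

Lemma sqrt_rsum_sq_le n f :
  (forall i, (i < n)%nat -> 0 <= f i) -> sqrt (rsum n (fun i => f i ^ 2)) <= rsum n f.
Proof.
  intros H. rewrite <- (sqrt_pow2 (rsum n f)) by (apply rsum_nonneg; auto).
  apply sqrt_le_1_alt.
  induction n; simpl; [lra|].
  assert (0 <= rsum n f) by (apply rsum_nonneg; intros; apply H; lia).
  assert (rsum n (fun i => f i ^ 2) <= rsum n f ^ 2) by (apply IHn; intros; apply H; lia).
  specialize (H n ltac:(lia)). simpl in *. nra.
Qed.

Lemma term_le_sqrt_rsum_sq n f i :
  (i < n)%nat -> 0 <= f i -> f i <= sqrt (rsum n (fun i => f i ^ 2)).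
Proof.
  intros Hi H. rewrite <- (sqrt_pow2 (f i)) at 1 by auto.
  apply sqrt_le_1_alt. apply (rsum_term n (fun i => f i ^ 2)); auto.
  intros; apply pow2_ge_0.
Qed.

Definition cv (u : nat -> C) (l : C) :=
  forall eps, 0 < eps -> exists J, forall j, (J <= j)%nat -> Cmod (u j - l) < eps.

Lemma cv_sub u l phi : (forall j, (j <= phi j)%nat) -> cv u l -> cv (fun j => u (phi j)) l.
Proof.
  intros H Hu eps He. destruct (Hu eps He) as [J HJ]. exists J. intros j Hj. apply HJ.
  specialize (H j). lia.
Qed.

Lemma inv_INR_lt eps : 0 < eps -> exists J, forall j, (J <= j)%nat -> / (INR j + 1) < eps.
Proof.
  intros He. destruct (archimed_cor1 eps He) as (J & HJ & HJ0). exists J. intros j Hj.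
  apply Rlt_trans with (/ INR J); auto.
  apply le_INR in Hj. apply lt_0_INR in HJ0. apply Rinv_lt_contravar; [apply Rmult_lt_0_compat|]; lra.
Qed.

Lemma inv_INR_pos j : 0 < / (INR j + 1).
Proof. apply Rinv_0_lt_compat. pose proof (pos_INR j); lra. Qed.

Lemma inv_INR_le j k : (j <= k)%nat -> / (INR k + 1) <= / (INR j + 1).
Proof. intros H. apply le_INR in H. pose proof (pos_INR j). apply Rinv_le_contravar; lra. Qed.

(* A subsequence is an index map with [j <= phi j]; monotonicity is never needed. *)
Lemma bounded_real_subseq (u : nat -> R) B : (forall k, Rabs (u k) <= B) ->
  exists l phi, (forall j, (j <= phi j)%nat) /\ forall j, Rabs (u (phi j) - l) < / (INR j + 1).
Proof.
  intros H.
  destruct (Bolzano_Weierstrass u (fun c => - B <= c <= B)) as [l Hl].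
  { apply compact_P3. }
  { intros k. specialize (H k). apply abs_le_between in H. lra. }
  assert (forall j, exists p, (j <= p)%nat /\ Rabs (u p - l) < / (INR j + 1)) as Hp.
  { intros j.
    destruct (Hl (fun x => Rabs (x - l) < / (INR j + 1)) j) as (p & Hp & Hv).
    - exists (mkposreal _ (inv_INR_pos j)). intros x Hx. exact Hx.
    - exists p; auto. }
  destruct (choice _ Hp) as [phi Hphi]. exists l, phi. split; intros j; apply Hphi.
Qed.

Lemma bounded_complex_subseq (u : nat -> C) B : (forall k, Cmod (u k) <= B) ->
  exists l phi, (forall j, (j <= phi j)%nat) /\ cv (fun j => u (phi j)) l.
Proof.
  intros H.
  destruct (bounded_real_subseq (fun k => fst (u k)) B) as (x & f & Hf & Hx).
  { intros k. eapply Rle_trans; [apply fst_le_Cmod | apply H]. }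
  destruct (bounded_real_subseq (fun k => snd (u (f k))) B) as (y & g & Hg & Hy).
  { intros k. eapply Rle_trans; [apply snd_le_Cmod | apply H]. }
  exists (x, y), (fun j => f (g j)). split.
  { intros j. specialize (Hg j). specialize (Hf (g j)). lia. }
  intros eps He. destruct (inv_INR_lt (eps / 2)) as [J HJ]; [lra|].
  exists J. intros j Hj. eapply Rle_lt_trans; [apply Cmod_le_abs|].
  specialize (HJ j Hj). pose proof (Hx (g j)) as H1. pose proof (Hy j) as H2.
  pose proof (inv_INR_le _ _ (Hg j)). simpl in *. unfold Rminus in *. lra.
Qed.

Lemma cv_Cmod_le u l z B : cv u l -> (forall J, exists j, (J <= j)%nat /\ Cmod (u j - z) <= B) ->
  Cmod (l - z) <= B.
Proof.
  intros Hu H. apply Rnot_lt_le. intros Hlt.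
  destruct (Hu ((Cmod (l - z) - B) / 2)) as [J HJ]; [lra|].
  destruct (H J) as (j & Hj & Hb). specialize (HJ j Hj).
  pose proof (Cmod_sub_tri l (u j) z). rewrite (Cmod_sub_sym l (u j)) in H0. lra.
Qed.

Lemma geometric_cv (u : nat -> C) A q : 0 < q < 1 ->
  (forall k, Cmod (u (S k) - u k) <= A * q ^ k) ->
  exists l, forall k, Cmod (u k - l) <= A * q ^ k / (1 - q).
Proof.
  intros Hq H.
  assert (HA : 0 <= A).
  { specialize (H O). pose proof (Cmod_ge_0 (u 1%nat - u 0%nat)). simpl in H. lra. }
  assert (Hd : forall k m, Cmod (u (k + m)%nat - u k) <= A * q ^ k / (1 - q)).
  (* The exact partial sum of the geometric series is carried along; the bare bound
     [A * q ^ k / (1 - q)] does not close under induction on [m]. *)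
  { assert (forall k m, Cmod (u (k + m)%nat - u k) <= A * q ^ k / (1 - q) * (1 - q ^ m)).
    { intros k m. induction m.
      - rewrite Nat.add_0_r. replace (u k - u k)%C with (RtoC 0) by ring. rewrite Cmod_0. simpl. lra.
      - rewrite Nat.add_succ_r.
        pose proof (Cmod_sub_tri (u (S (k + m))) (u (k + m)%nat) (u k)).
        specialize (H (k + m)%nat). rewrite pow_add in H.
        replace (A * q ^ k / (1 - q) * (1 - q ^ S m)) with
          (A * (q ^ k * q ^ m) + A * q ^ k / (1 - q) * (1 - q ^ m)) by (simpl; field; lra).
        lra. }
    intros k m. specialize (H0 k m).
    assert (0 <= A * q ^ k / (1 - q)).
    { apply Rmult_le_pos; [apply Rmult_le_pos; auto; apply pow_le; lra|].
      left; apply Rinv_0_lt_compat; lra. }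
    assert (0 <= q ^ m) by (apply pow_le; lra). nra. }
  (* Completeness comes from compactness: a subsequence converges, and the uniform tail bound passes
     to its limit. *)
  destruct (bounded_complex_subseq u (Cmod (u O) + A / (1 - q))) as (l & phi & Hphi & Hl).
  { intros k. specialize (Hd O k). simpl in Hd. pose proof (Cmod_le_add (u k) (u O)).
    rewrite Rmult_1_r in Hd. lra. }
  exists l. intros k. rewrite Cmod_sub_sym. apply cv_Cmod_le with (1 := Hl).
  intros J. exists (J + k)%nat. split; [lia|].
  specialize (Hphi (J + k)%nat). replace (phi (J + k)%nat) with (k + (phi (J + k)%nat - k))%nat by lia.
  apply Hd.
Qed.

Lemma poly_ext N p q : (forall v, p v = q v :> C) -> is_poly N p -> is_poly N q.
Proof. intros H. replace q with p; auto. apply functional_extensionality; auto. Qed.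

Lemma poly_plus N p q : is_poly N p -> is_poly N q -> is_poly N (fun v => p v + q v)%C.
Proof. exact (poly_add N p q). Qed.

Lemma poly_times N p q : is_poly N p -> is_poly N q -> is_poly N (fun v => p v * q v)%C.
Proof. exact (poly_mul N p q). Qed.

Lemma poly_cst N (c : C) : is_poly N (fun _ => c).
Proof. exact (poly_const N c). Qed.

Lemma poly_minus N p q : is_poly N p -> is_poly N q -> is_poly N (fun v => p v - q v)%C.
Proof.
  intros Hp Hq. apply (poly_ext N (fun v => p v + (-(1))%C * q v)%C); [intros; ring|].
  apply poly_plus; auto. apply poly_times; auto. apply poly_cst.
Qed.

Lemma poly_pow N p k : is_poly N p -> is_poly N (fun v => (p v) ^ k)%C.
Proof. intros Hp. induction k; simpl; [apply poly_cst | apply poly_times; auto]. Qed.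

(** Sup bound and Lipschitz bound are proved together, with one constant, because the Lipschitz
    estimate of a product uses the sup bounds of the factors. *)
Lemma poly_bounded_lipschitz N p : is_poly N p -> forall B, exists L, 0 <= L /\
  forall z w, (forall i, (i < N)%nat -> Cmod (z i) <= B) -> (forall i, (i < N)%nat -> Cmod (w i) <= B) ->
    Cmod (p z) <= L /\ Cmod (p z - p w) <= L * rsum N (fun i => Cmod (z i - w i)).
Proof.
  assert (Hs : forall z w : nat -> C, 0 <= rsum N (fun i => Cmod (z i - w i)))
    by (intros; apply rsum_nonneg; intros; apply Cmod_ge_0).
  induction 1 as [c | i Hi | p q Hp IHp Hq IHq | p q Hp IHp Hq IHq]; intros B.
  - exists (Cmod c). pose proof (Cmod_ge_0 c). split; auto. intros z w _ _. split; [lra|].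
    replace (c - c)%C with (RtoC 0) by ring. rewrite Cmod_0. apply Rmult_le_pos; auto.
  - exists (Rmax B 1). assert (1 <= Rmax B 1) by apply Rmax_r. split; [lra|].
    intros z w Hz Hw. split; [eapply Rle_trans; [apply Hz; auto | apply Rmax_l]|].
    specialize (Hs z w).
    assert (Cmod (z i - w i) <= rsum N (fun i => Cmod (z i - w i))).
    { apply (rsum_term N (fun i => Cmod (z i - w i))); auto. intros; apply Cmod_ge_0. }
    nra.
  - destruct (IHp B) as (L1 & HL1 & H1). destruct (IHq B) as (L2 & HL2 & H2).
    exists (L1 + L2). split; [lra|]. intros z w Hz Hw.
    destruct (H1 z w Hz Hw) as [A1 B1]. destruct (H2 z w Hz Hw) as [A2 B2].
    split; [change (Cmod (p z + q z) <= L1 + L2) |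
      change (Cmod ((p z + q z) - (p w + q w)) <= (L1 + L2) * rsum N (fun i => Cmod (z i - w i)))].
    + eapply Rle_trans; [apply Cmod_triangle | lra].
    + replace (p z + q z - (p w + q w))%C with ((p z - p w) + (q z - q w))%C by ring.
      eapply Rle_trans; [apply Cmod_triangle |]. rewrite Rmult_plus_distr_r. apply Rplus_le_compat; [exact B1 | exact B2].
  - destruct (IHp B) as (L1 & HL1 & H1). destruct (IHq B) as (L2 & HL2 & H2).
    exists (2 * (L1 * L2)). split; [nra|]. intros z w Hz Hw.
    destruct (H1 z w Hz Hw) as [A1 B1]. destruct (H2 z w Hz Hw) as [A2 B2].
    destruct (H1 w w Hw Hw) as [A3 _].
    specialize (Hs z w). set (s := rsum N _) in *.
    pose proof (Cmod_ge_0 (p z)). pose proof (Cmod_ge_0 (q z)). pose proof (Cmod_ge_0 (p w)).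
    pose proof (Cmod_ge_0 (p z - p w)). pose proof (Cmod_ge_0 (q z - q w)).
    assert (0 <= L1 * L2) by nra.
    split; [change (Cmod (p z * q z) <= 2 * (L1 * L2)) |
      change (Cmod (p z * q z - p w * q w) <= 2 * (L1 * L2) * s)].
    + rewrite Cmod_mult.
      assert (Cmod (p z) * Cmod (q z) <= L1 * L2) by (apply Rmult_le_compat; auto). lra.
    + replace (p z * q z - p w * q w)%C with ((p z - p w) * q z + p w * (q z - q w))%C by ring.
      eapply Rle_trans; [apply Cmod_triangle|]. rewrite !Cmod_mult.
      assert (Cmod (p z - p w) * Cmod (q z) <= (L1 * s) * L2) by (apply Rmult_le_compat; auto).
      assert (Cmod (p w) * Cmod (q z - q w) <= L1 * (L2 * s)) by (apply Rmult_le_compat; auto).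
      lra.
Qed.

Lemma rational_dense x eps : 0 < eps ->
  exists a b c : nat, Rabs ((INR a - INR b) / (INR c + 1) - x) < eps.
Proof.
  intros He. destruct (inv_INR_lt eps He) as [c Hc]. specialize (Hc c (le_n _)).
  set (y := x * (INR c + 1)). pose proof (pos_INR c).
  destruct (archimed y) as [H1 H2].
  assert (exists a b : nat, INR a - INR b = IZR (up y)) as (a & b & Hab).
  { destruct (Z_le_dec 0 (up y)).
    - exists (Z.to_nat (up y)), O. rewrite INR_IZR_INZ, Z2Nat.id; auto. simpl. lra.
    - exists O, (Z.to_nat (- up y)). rewrite (INR_IZR_INZ (Z.to_nat _)), Z2Nat.id by lia.
      rewrite opp_IZR. simpl. lra. }
  exists a, b, c. rewrite Hab.
  replace (IZR (up y) / (INR c + 1) - x) with ((IZR (up y) - y) * / (INR c + 1)) by (unfold y; field; lra).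
  rewrite Rabs_mult, (Rabs_pos_eq (/ _)) by (left; apply inv_INR_pos).
  pose proof (inv_INR_pos c).
  assert (Rabs (IZR (up y) - y) <= 1) by (apply Rabs_le; lra). nra.
Qed.

Lemma complex_dense_seq : exists q : nat -> C, forall z eps J, 0 < eps ->
  exists j, (J <= j)%nat /\ Cmod (q j - z) < eps.
Proof.
  set (rat := fun n => let (a, m) := of_nat n in let (b, c) := of_nat m in
                (INR a - INR b) / (INR c + 1)).
  assert (Hr : forall x eps, 0 < eps -> exists n, Rabs (rat n - x) < eps).
  { intros x eps He. destruct (rational_dense x eps He) as (a & b & c & H).
    exists (to_nat (a, to_nat (b, c))). unfold rat. rewrite !cancel_of_to. exact H. }
  (* The component [i] is padding that does not enter the value, so each value recurs at arbitrarily
     large indices; below it is set to [J]. *)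
  exists (fun n => let (i, m) := of_nat n in let (k, l) := of_nat m in (rat k, rat l)).
  intros z eps J He.
  destruct (Hr (fst z) (eps / 2)) as [k Hk]; [lra|]. destruct (Hr (snd z) (eps / 2)) as [l Hl]; [lra|].
  exists (to_nat (J, to_nat (k, l))). split.
  { pose proof (to_nat_non_decreasing J (to_nat (k, l))). lia. }
  rewrite !cancel_of_to. eapply Rle_lt_trans; [apply Cmod_le_abs|].
  simpl. unfold Rminus in *. lra.
Qed.

(** * Cauchy transforms of a planar Cantor set *)

Definition dir : Type := (bool * bool)%type.

Definition dirC (d : dir) : C :=
  match d with
  | (false, false) => RtoC 1 | (false, true) => Ci
  | (true, false) => (- RtoC 1)%C | (true, true) => (- Ci)%C
  end.

Definition sum4 (g : dir -> C) : C :=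
  (g (false, false) + g (false, true) + g (true, false) + g (true, true))%C.

(** The Cauchy transform of the uniform probability measure on the [4 ^ k] centres
    [sum_{i<k} d_i / 3 ^ i], written by self-similarity: 3 comes from the zoom of the kernel and 1/4
    from the mass of a piece. *)
Fixpoint cauchy_sum (k : nat) (z : C) : C :=
  match k with
  | O => (/ z)%C
  | S k => (RtoC (3 / 4) * sum4 (fun d => cauchy_sum k (RtoC 3 * (z - dirC d))))%C
  end.

Definition code_tail (s : nat -> dir) : nat -> dir := fun i => s (S i).

(** The circle of radius [(1/3) ^ k] about the centre with digits [s 0, ..., s (k-1)]. The
    approximants have poles at the centres, so their limits are taken along these circles. *)
Fixpoint near (k : nat) (s : nat -> dir) (z : C) : Prop :=
  match k with
  | O => Cmod z = 1
  | S k => near k (code_tail s) (RtoC 3 * (z - dirC (s O)))%C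
  end.

Lemma le_Cmod (z : C) r : 0 <= r -> r * r <= fst z ^ 2 + snd z ^ 2 -> r <= Cmod z.
Proof.
  intros Hr H. unfold Cmod. rewrite <- (sqrt_square r) by auto. apply sqrt_le_1_alt. auto.
Qed.

Lemma Cmod_dirC d : Cmod (dirC d) = 1.
Proof.
  destruct d as [[] []]; simpl; rewrite ?Cmod_opp, ?Cmod_1, ?Cmod_Ci; reflexivity.
Qed.

(** The constant is a rational just below the true minimum, the square root of 2. *)
Lemma dirC_separated d d' : d <> d' -> 7 / 5 <= Cmod (dirC d - dirC d').
Proof.
  intros H. apply le_Cmod; [lra|].
  destruct d as [[] []]; destruct d' as [[] []]; try congruence; simpl; lra.
Qed.

Lemma Cmod_3 z : Cmod (RtoC 3 * z) = 3 * Cmod z.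
Proof. rewrite Cmod_mult, Cmod_R, Rabs_pos_eq; lra. Qed.

Lemma sum4_minus g h : (sum4 g - sum4 h = sum4 (fun d => g d - h d))%C.
Proof. unfold sum4. ring. Qed.

Lemma Cmod_sum4 g : Cmod (sum4 g) <= Cmod (g (false, false)) + Cmod (g (false, true))
  + Cmod (g (true, false)) + Cmod (g (true, true)).
Proof.
  unfold sum4.
  pose proof (Cmod_triangle (g (false, false) + g (false, true) + g (true, false)) (g (true, true))).
  pose proof (Cmod_triangle (g (false, false) + g (false, true)) (g (true, false))).
  pose proof (Cmod_triangle (g (false, false)) (g (false, true))). lra.
Qed.

Lemma Cmod_sum4_le g B : (forall d, Cmod (g d) <= B) -> Cmod (sum4 g) <= 4 * B.
Proof.
  intros H. pose proof (Cmod_sum4 g).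
  pose proof (H (false, false)). pose proof (H (false, true)).
  pose proof (H (true, false)). pose proof (H (true, true)). lra.
Qed.

Lemma Cmod_sum4_le_split g d0 D F : Cmod (g d0) <= D -> (forall d, d <> d0 -> Cmod (g d) <= F) ->
  Cmod (sum4 g) <= D + 3 * F.
Proof.
  intros H0 H. pose proof (Cmod_sum4 g).
  destruct d0 as [[] []];
    try (pose proof (H (false, false) ltac:(discriminate)));
    try (pose proof (H (false, true) ltac:(discriminate)));
    try (pose proof (H (true, false) ltac:(discriminate)));
    try (pose proof (H (true, true) ltac:(discriminate))); lra.
Qed.

Lemma Cmul_sub_l (a b c : C) : (a * b - a * c = a * (b - c))%C.
Proof. ring. Qed.

Lemma Cmod_34 z : Cmod (RtoC (3 / 4) * z) = 3 / 4 * Cmod z.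
Proof. rewrite Cmod_mult, Cmod_R, Rabs_pos_eq; lra. Qed.

(** The radius 3/2 is the fixed point of [r = 1 + r / 3]: the disc of that radius holds all centres,
    and the excess beyond it at least triples at each zoom. *)
Lemma zoom_far u d : 3 * (Cmod u - 3 / 2) <= Cmod (RtoC 3 * (u - dirC d)) - 3 / 2.
Proof.
  rewrite Cmod_3. pose proof (Cmod_le_add u (dirC d)). rewrite Cmod_dirC in *. lra.
Qed.

Lemma Cmod_pos_neq z : 0 < Cmod z -> z <> RtoC 0.
Proof. intros H ->. rewrite Cmod_0 in H. lra. Qed.

(** An average of kernels with poles in the disc of radius 3/2. In the induction, four terms with
    the factor 3/4 are compensated by the tripled distance. *)
Lemma cauchy_sum_bound k : forall u, 3 / 2 < Cmod u -> Cmod (cauchy_sum k u) <= / (Cmod u - 3 / 2).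
Proof.
  induction k; intros u Hu; simpl.
  - rewrite Cmod_inv by (apply Cmod_pos_neq; lra). apply Rinv_le_contravar; lra.
  - rewrite Cmod_34.
    assert (Cmod (sum4 (fun d => cauchy_sum k (RtoC 3 * (u - dirC d)))) <= 4 * / (3 * (Cmod u - 3 / 2))).
    { apply Cmod_sum4_le. intros d. pose proof (zoom_far u d).
      eapply Rle_trans; [apply IHk; lra|]. apply Rinv_le_contravar; lra. }
    replace (/ (Cmod u - 3 / 2)) with (3 / 4 * (4 * / (3 * (Cmod u - 3 / 2)))) by (field; lra). lra.
Qed.

Lemma Rdiv_le_den a b c : 0 <= a -> 0 < c -> c <= b -> a / b <= a / c.
Proof. intros. apply Rmult_le_compat_l; auto. apply Rinv_le_contravar; auto. Qed.

Lemma cauchy_sum_lipschitz k : forall u v, 3 / 2 < Cmod u -> 3 / 2 < Cmod v ->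
  Cmod (cauchy_sum k u - cauchy_sum k v) <= Cmod (u - v) / ((Cmod u - 3 / 2) * (Cmod v - 3 / 2)).
Proof.
  induction k; intros u v Hu Hv; simpl.
  - assert (u <> RtoC 0) by (apply Cmod_pos_neq; lra). assert (v <> RtoC 0) by (apply Cmod_pos_neq; lra).
    replace (/ u - / v)%C with ((v - u) / (u * v))%C by (field; auto).
    rewrite Cmod_div by (apply Cmult_neq_0; auto). rewrite Cmod_mult, Cmod_sub_sym.
    apply Rdiv_le_den; [apply Cmod_ge_0 | nra | nra].
  - replace (RtoC (3 / 4) * sum4 (fun d => cauchy_sum k (RtoC 3 * (u - dirC d))) -
             RtoC (3 / 4) * sum4 (fun d => cauchy_sum k (RtoC 3 * (v - dirC d))))%C with
      (RtoC (3 / 4) * (sum4 (fun d => cauchy_sum k (RtoC 3 * (u - dirC d))) -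
             sum4 (fun d => cauchy_sum k (RtoC 3 * (v - dirC d)))))%C by ring.
    rewrite Cmod_34, sum4_minus.
    match goal with |- 3 / 4 * Cmod (sum4 ?g) <= _ =>
      assert (Cmod (sum4 g) <= 4 * (3 * Cmod (u - v) / ((3 * (Cmod u - 3 / 2)) * (3 * (Cmod v - 3 / 2)))))
    end.
    { apply Cmod_sum4_le. intros d. pose proof (zoom_far u d). pose proof (zoom_far v d).
      eapply Rle_trans; [apply IHk; lra|].
      replace (RtoC 3 * (u - dirC d) - RtoC 3 * (v - dirC d))%C with (RtoC 3 * (u - v))%C by ring.
      rewrite (Cmod_3 (u - v)). pose proof (Cmod_ge_0 (u - v)). apply Rdiv_le_den; [lra | nra |].
      apply Rmult_le_compat; lra. }
    replace (Cmod (u - v) / ((Cmod u - 3 / 2) * (Cmod v - 3 / 2))) with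
      (3 / 4 * (4 * (3 * Cmod (u - v) / ((3 * (Cmod u - 3 / 2)) * (3 * (Cmod v - 3 / 2)))))) by (field; lra).
    lra.
Qed.

(** Each centre is replaced by the average of four at distance [(1/3) ^ k] from it, and a difference
    of two kernels has a product of two distances below. A zoom divides the bound by 9 and
    [3/4 * 4 = 3] multiplies it, whence the ratio 1/3. *)
Lemma cauchy_sum_succ k : forall u, 3 / 2 < Cmod u ->
  Cmod (cauchy_sum (S k) u - cauchy_sum k u) <= (1 / 3) ^ k / (Cmod u - 3 / 2) ^ 2.
Proof.
  induction k; intros u Hu.
  - assert (u <> RtoC 0) by (apply Cmod_pos_neq; lra).
    assert (Hd : forall d, 1 / 2 <= Cmod (u - dirC d) /\ Cmod u - 3 / 2 <= Cmod (u - dirC d)).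
    { intros d. pose proof (Cmod_le_add u (dirC d)). rewrite Cmod_dirC in *. lra. }
    assert (Hn : forall d, (u - dirC d)%C <> RtoC 0).
    { intros d. apply Cmod_pos_neq. specialize (Hd d). lra. }
    replace (cauchy_sum 1 u - cauchy_sum 0 u)%C with
      (RtoC (1 / 4) * sum4 (fun d => / (u - dirC d) - / u))%C.
    (* [field] would treat [RtoC (3 / 4)] and [RtoC (1 / 4)] as atoms; with 4 written as
       [1 + 1 + 1 + 1] it can cancel the four copies of [/ u]. *)
    2: { simpl. unfold sum4.
         assert (H3 : RtoC 3 <> RtoC 0) by (intros E; apply RtoC_inj in E; lra).
         assert (H4 : (RtoC 1 + RtoC 1 + RtoC 1 + RtoC 1)%C <> RtoC 0)
           by (rewrite <- !RtoC_plus; intros E; apply RtoC_inj in E; lra).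
         replace (RtoC (3 / 4)) with (RtoC 3 / (RtoC 1 + RtoC 1 + RtoC 1 + RtoC 1))%C
           by (rewrite <- !RtoC_plus, <- RtoC_div by lra; f_equal; lra).
         replace (RtoC (1 / 4)) with (RtoC 1 / (RtoC 1 + RtoC 1 + RtoC 1 + RtoC 1))%C
           by (rewrite <- !RtoC_plus, <- RtoC_div by lra; f_equal; lra).
         generalize (Hn (false, false)) (Hn (false, true)) (Hn (true, false)) (Hn (true, true)).
         generalize (u - dirC (false, false))%C (u - dirC (false, true))%C
           (u - dirC (true, false))%C (u - dirC (true, true))%C.
         intros a b c e Ha Hb Hc He. field. repeat split; auto. }
    rewrite Cmod_mult, Cmod_R, Rabs_pos_eq by lra.
    assert (Cmod (sum4 (fun d => / (u - dirC d) - / u)%C) <= 4 * (1 / (Cmod u - 3 / 2) ^ 2)).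
    { apply Cmod_sum4_le. intros d. specialize (Hd d). specialize (Hn d).
      replace (/ (u - dirC d) - / u)%C with (dirC d / ((u - dirC d) * u))%C by (field; auto).
      rewrite Cmod_div by (apply Cmult_neq_0; auto). rewrite Cmod_mult, Cmod_dirC.
      apply Rdiv_le_den; [lra | nra | nra]. }
    rewrite pow_O. lra.
  - change (cauchy_sum (S (S k)) u) with
      (RtoC (3 / 4) * sum4 (fun d => cauchy_sum (S k) (RtoC 3 * (u - dirC d))))%C.
    change (cauchy_sum (S k) u) with
      (RtoC (3 / 4) * sum4 (fun d => cauchy_sum k (RtoC 3 * (u - dirC d))))%C.
    rewrite Cmul_sub_l, Cmod_34, sum4_minus.
    match goal with |- 3 / 4 * Cmod (sum4 ?g) <= _ =>
      assert (Cmod (sum4 g) <= 4 * ((1 / 3) ^ k / (3 * (Cmod u - 3 / 2)) ^ 2)) end.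
    { apply Cmod_sum4_le. intros d. pose proof (zoom_far u d).
      eapply Rle_trans; [apply IHk; lra|]. apply Rdiv_le_den; [apply pow_le; lra | nra | nra]. }
    replace ((1 / 3) ^ S k / (Cmod u - 3 / 2) ^ 2) with
      (3 / 4 * (4 * ((1 / 3) ^ k / (3 * (Cmod u - 3 / 2)) ^ 2))) by (simpl; field; lra).
    lra.
Qed.

Lemma near_bounded k : forall s z, near k s z -> Cmod z <= 3 / 2.
Proof.
  induction k; intros s z H; simpl in H; [lra|].
  apply IHk in H. rewrite Cmod_3 in H. pose proof (Cmod_le_add z (dirC (s O))).
  rewrite Cmod_dirC in *. lra.
Qed.

Lemma near_succ k : forall s z w, near k s z -> near (S k) s w -> Cmod (w - z) <= 3 * (1 / 3) ^ k.
Proof.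
  induction k; intros s z w Hz Hw.
  - apply near_bounded in Hw. simpl in Hz. pose proof (Cmod_sub_le w z). simpl. lra.
  - change (near (S k) (code_tail s) (RtoC 3 * (w - dirC (s O)))%C) in Hw. simpl in Hz.
    specialize (IHk _ _ _ Hz Hw).
    replace (RtoC 3 * (w - dirC (s O)) - RtoC 3 * (z - dirC (s O)))%C with (RtoC 3 * (w - z))%C in IHk by ring.
    rewrite Cmod_3 in IHk. simpl. lra.
Qed.

(** Zoomed onto a wrong digit, the point has modulus at least [3 * 7/5 - 3/2 = 27/10], hence lies
    outside the disc of the poles with a margin above 1. *)
Lemma near_zoom_other k s z d : near (S k) s z -> d <> s O -> 1 <= Cmod (RtoC 3 * (z - dirC d)) - 3 / 2.
Proof.
  intros H Hd. simpl in H. apply near_bounded in H. rewrite Cmod_3 in *.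
  pose proof (dirC_separated d (s O) Hd). pose proof (Cmod_sub_tri (dirC d) z (dirC (s O))).
  rewrite (Cmod_sub_sym (dirC d) z) in *. lra.
Qed.

Lemma Rinv_le_1 a : 1 <= a -> / a <= 1.
Proof. intros H. rewrite <- Rinv_1. apply Rinv_le_contravar; lra. Qed.

Lemma Rdiv_le_1 a b : 0 <= a -> 1 <= b -> a / b <= a.
Proof. intros. replace a with (a / 1) at 2 by field. apply Rdiv_le_den; lra. Qed.

(** The error obeys [e_(k+1) <= 3/4 * (e_k + 12 * (1/3)^k)]: the piece with digit [s 0] reproduces
    the situation, and each of the three others, seen from outside its poles, costs 3 times
    [(1/3)^k] for the move and once for the change of level. The right-hand side is a supersolution
    with value 4 at [k = 0]; its negative term absorbs the forcing. *)
Lemma cauchy_sum_near k : forall s z w, near k s z -> near (S k) s w ->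
  Cmod (cauchy_sum (S k) w - cauchy_sum k z) <= 26 * (3 / 4) ^ k - 22 * (1 / 3) ^ k.
Proof.
  induction k; intros s z w Hz Hw.
  - assert (Cmod (cauchy_sum 0 z) <= 1).
    { simpl in *. rewrite Cmod_inv; [rewrite Hz; lra | apply Cmod_pos_neq; lra]. }
    assert (Cmod (cauchy_sum 1 w) <= 3).
    { change (cauchy_sum 1 w) with (RtoC (3 / 4) * sum4 (fun d => cauchy_sum 0 (RtoC 3 * (w - dirC d))))%C.
      rewrite Cmod_34.
      match goal with |- 3 / 4 * Cmod (sum4 ?g) <= _ => assert (Cmod (sum4 g) <= 1 + 3 * 1) end.
      { apply Cmod_sum4_le_split with (d0 := s O).
        - simpl in *. rewrite Cmod_inv; [rewrite Hw; lra | apply Cmod_pos_neq; lra].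
        - intros d Hd. pose proof (near_zoom_other _ _ _ _ Hw Hd).
          eapply Rle_trans; [apply cauchy_sum_bound; lra|]. apply Rinv_le_1; lra. }
      lra. }
    pose proof (Cmod_sub_le (cauchy_sum 1 w) (cauchy_sum 0 z)). rewrite !pow_O. lra.
  - pose proof (near_succ _ _ _ _ Hz Hw) as Hd.
    change (cauchy_sum (S (S k)) w) with
      (RtoC (3 / 4) * sum4 (fun d => cauchy_sum (S k) (RtoC 3 * (w - dirC d))))%C.
    change (cauchy_sum (S k) z) with
      (RtoC (3 / 4) * sum4 (fun d => cauchy_sum k (RtoC 3 * (z - dirC d))))%C.
    rewrite Cmul_sub_l, Cmod_34, sum4_minus.
    match goal with |- 3 / 4 * Cmod (sum4 ?g) <= _ =>
      assert (Cmod (sum4 g) <= (26 * (3 / 4) ^ k - 22 * (1 / 3) ^ k) + 3 * (4 * (1 / 3) ^ k)) end.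
    { apply Cmod_sum4_le_split with (d0 := s O).
      - apply IHk with (code_tail s); [exact Hz | exact Hw].
      - intros d Hds. pose proof (near_zoom_other _ _ _ _ Hz Hds) as H1.
        pose proof (near_zoom_other _ _ _ _ Hw Hds) as H2.
        set (u := (RtoC 3 * (z - dirC d))%C) in *. set (v := (RtoC 3 * (w - dirC d))%C) in *.
        assert (Huv : Cmod (v - u) <= 3 * (1 / 3) ^ k).
        { replace (v - u)%C with (RtoC 3 * (w - z))%C by (unfold u, v; ring).
          rewrite Cmod_3. simpl in Hd. lra. }
        pose proof (cauchy_sum_lipschitz (S k) v u ltac:(lra) ltac:(lra)) as H3.
        pose proof (cauchy_sum_succ k u ltac:(lra)) as H4.
        pose proof (Cmod_sub_tri (cauchy_sum (S k) v) (cauchy_sum (S k) u) (cauchy_sum k u)).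
        assert (Cmod (v - u) / ((Cmod v - 3 / 2) * (Cmod u - 3 / 2)) <= Cmod (v - u)).
        { apply Rdiv_le_1; [apply Cmod_ge_0 | nra]. }
        assert ((1 / 3) ^ k / (Cmod u - 3 / 2) ^ 2 <= (1 / 3) ^ k).
        { apply Rdiv_le_1; [apply pow_le; lra | nra]. }
        lra. }
    assert (0 <= (1 / 3) ^ k) by (apply pow_le; lra). rewrite <- !tech_pow_Rmult. lra.
Qed.

Fixpoint near_point (k : nat) (s : nat -> dir) : C :=
  match k with
  | O => RtoC 1
  | S k => (dirC (s O) + near_point k (code_tail s) / RtoC 3)%C
  end.

Lemma near_near_point k : forall s, near k s (near_point k s).
Proof.
  induction k; intros s; simpl; [apply Cmod_1|].
  replace (RtoC 3 * (dirC (s O) + near_point k (code_tail s) / RtoC 3 - dirC (s O)))%C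
    with (near_point k (code_tail s)); [apply IHk|].
  field.
Qed.

Definition agree {A : Type} (k : nat) (s t : nat -> A) := forall i, (i < k)%nat -> s i = t i.

Lemma near_agree k : forall s t z, agree k s t -> near k s z -> near k t z.
Proof.
  induction k; intros s t z H; simpl; auto.
  rewrite (H O) by lia. apply IHk. intros i Hi. apply (H (S i)). lia.
Qed.

Lemma code_limits : exists (X F : (nat -> dir) -> C),
  forall k s z, near k s z ->
    Cmod (z - X s) <= 9 / 2 * (1 / 3) ^ k /\ Cmod (cauchy_sum k z - F s) <= 104 * (3 / 4) ^ k.
Proof.
  assert (HX : forall s, exists x, forall k, Cmod (near_point k s - x) <= 3 * (1 / 3) ^ k / (1 - 1 / 3)).
  { intros s. apply geometric_cv; [lra|]. intros k. apply near_succ with s; apply near_near_point. }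
  assert (HF : forall s, exists x, forall k,
    Cmod (cauchy_sum k (near_point k s) - x) <= 26 * (3 / 4) ^ k / (1 - 3 / 4)).
  { intros s. apply geometric_cv with (u := fun k => cauchy_sum k (near_point k s)); [lra|]. intros k.
    eapply Rle_trans; [apply cauchy_sum_near with s; apply near_near_point|].
    assert (0 <= (1 / 3) ^ k) by (apply pow_le; lra). lra. }
  destruct (choice _ HX) as [X HX']. destruct (choice _ HF) as [F HF'].
  exists X, F. intros k s z Hz.
  assert (0 <= (1 / 3) ^ k) by (apply pow_le; lra).
  pose proof (near_near_point (S k) s) as Hn. split.
  - pose proof (near_succ _ _ _ _ Hz Hn). specialize (HX' s (S k)).
    pose proof (Cmod_sub_tri z (near_point (S k) s) (X s)).
    rewrite (Cmod_sub_sym z (near_point (S k) s)) in *.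
    rewrite <- tech_pow_Rmult in HX'. lra.
  - pose proof (cauchy_sum_near _ _ _ _ Hz Hn). specialize (HF' s (S k)).
    pose proof (Cmod_sub_tri (cauchy_sum k z) (cauchy_sum (S k) (near_point (S k) s)) (F s)).
    rewrite (Cmod_sub_sym (cauchy_sum k z) (cauchy_sum (S k) (near_point (S k) s))) in *.
    rewrite <- tech_pow_Rmult in HF'. lra.
Qed.

(** * A maximum principle *)

Definition bounded_near0 (rho : C -> C) :=
  exists B delta, 0 < delta /\ forall t, Cmod t < delta -> Cmod (rho t) <= B.

(** A substitute for holomorphy: it holds for [/ z], is stable under ring operations and zooms, and
    its cubic error is of lower order than the [s ^ 2] that decides the maximum principle. *)
Definition taylor2 (h : C -> C) (z : C) :=
  exists h1 h2 rho, bounded_near0 rho /\ exists delta, 0 < delta /\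
    forall t, Cmod t < delta -> (h (z + t) = h z + h1 * t + h2 * t * t + t * t * t * rho t)%C.

Lemma bounded_near0_const c : bounded_near0 (fun _ => c).
Proof. exists (Cmod c), 1. split; [lra|]. intros; lra. Qed.

Lemma bounded_near0_id : bounded_near0 (fun t => t).
Proof. exists 1, 1. split; [lra|]. intros; lra. Qed.

Lemma bounded_near0_plus r s :
  bounded_near0 r -> bounded_near0 s -> bounded_near0 (fun t => r t + s t)%C.
Proof.
  intros (B & d & Hd & H) (B' & d' & Hd' & H'). exists (B + B'), (Rmin d d').
  split; [apply Rmin_pos; auto|]. intros t Ht.
  specialize (H t (Rlt_le_trans _ _ _ Ht (Rmin_l _ _))).
  specialize (H' t (Rlt_le_trans _ _ _ Ht (Rmin_r _ _))).
  pose proof (Cmod_triangle (r t) (s t)). lra.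
Qed.

Lemma bounded_near0_mult r s :
  bounded_near0 r -> bounded_near0 s -> bounded_near0 (fun t => r t * s t)%C.
Proof.
  intros (B & d & Hd & H) (B' & d' & Hd' & H'). exists (B * B'), (Rmin d d').
  split; [apply Rmin_pos; auto|]. intros t Ht.
  specialize (H t (Rlt_le_trans _ _ _ Ht (Rmin_l _ _))).
  specialize (H' t (Rlt_le_trans _ _ _ Ht (Rmin_r _ _))).
  rewrite Cmod_mult. apply Rmult_le_compat; auto; apply Cmod_ge_0.
Qed.

Lemma taylor2_const c z : taylor2 (fun _ => c) z.
Proof.
  exists (RtoC 0), (RtoC 0), (fun _ => RtoC 0). split; [apply bounded_near0_const|].
  exists 1. split; [lra|]. intros; ring.
Qed.

Lemma taylor2_id z : taylor2 (fun w => w) z.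
Proof.
  exists (RtoC 1), (RtoC 0), (fun _ => RtoC 0). split; [apply bounded_near0_const|].
  exists 1. split; [lra|]. intros; ring.
Qed.

Lemma taylor2_plus g h z : taylor2 g z -> taylor2 h z -> taylor2 (fun w => g w + h w)%C z.
Proof.
  intros (g1 & g2 & r & Hr & d & Hd & H) (h1 & h2 & r' & Hr' & d' & Hd' & H').
  exists (g1 + h1)%C, (g2 + h2)%C, (fun t => r t + r' t)%C.
  split; [apply bounded_near0_plus; auto|].
  exists (Rmin d d'). split; [apply Rmin_pos; auto|]. intros t Ht.
  rewrite (H t (Rlt_le_trans _ _ _ Ht (Rmin_l _ _))), (H' t (Rlt_le_trans _ _ _ Ht (Rmin_r _ _))). ring.
Qed.

Lemma taylor2_mult g h z : taylor2 g z -> taylor2 h z -> taylor2 (fun w => g w * h w)%C z.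
Proof.
  intros (g1 & g2 & r & Hr & d & Hd & H) (h1 & h2 & r' & Hr' & d' & Hd' & H').
  exists (g z * h1 + g1 * h z)%C, (g z * h2 + g1 * h1 + g2 * h z)%C,
    (fun t => g z * r' t + h z * r t + (g1 * h2 + g2 * h1)
       + t * (g1 * r' t + h1 * r t + g2 * h2) + t * t * (g2 * r' t + h2 * r t) + t * t * t * (r t * r' t))%C.
  split.
  { repeat first [apply bounded_near0_plus | apply bounded_near0_mult | apply bounded_near0_const
                  | apply bounded_near0_id | assumption]. }
  exists (Rmin d d'). split; [apply Rmin_pos; auto|]. intros t Ht.
  rewrite (H t (Rlt_le_trans _ _ _ Ht (Rmin_l _ _))), (H' t (Rlt_le_trans _ _ _ Ht (Rmin_r _ _))). ring.
Qed.

Lemma taylor2_zoom g z d : taylor2 g (RtoC 3 * (z - d)) -> taylor2 (fun w => g (RtoC 3 * (w - d)))%C z.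
Proof.
  intros (g1 & g2 & r & (B & d1 & Hd1 & Hr) & d2 & Hd2 & H).
  exists (RtoC 3 * g1)%C, (RtoC 9 * g2)%C, (fun t => RtoC 27 * r (RtoC 3 * t))%C. split.
  - apply bounded_near0_mult; [apply bounded_near0_const|].
    exists B, (d1 / 3). split; [lra|]. intros t Ht. apply Hr. rewrite Cmod_3. lra.
  - exists (d2 / 3). split; [lra|]. intros t Ht.
    replace (RtoC 3 * (z + t - d))%C with (RtoC 3 * (z - d) + RtoC 3 * t)%C by ring.
    rewrite H by (rewrite Cmod_3; lra).
    replace (RtoC 9) with (RtoC 3 * RtoC 3)%C by (rewrite <- RtoC_mult; f_equal; lra).
    replace (RtoC 27) with (RtoC 3 * RtoC 3 * RtoC 3)%C by (rewrite <- !RtoC_mult; f_equal; lra).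
    ring.
Qed.

Lemma taylor2_inv z : z <> RtoC 0 -> taylor2 (fun w => / w)%C z.
Proof.
  intros Hz. pose proof (proj1 (Cmod_gt_0 z) Hz) as Hz'.
  assert (Hn : forall t, Cmod t < Cmod z / 2 -> (z + t)%C <> RtoC 0 /\ Cmod z / 2 <= Cmod (z + t)).
  { intros t Ht. pose proof (Cmod_le_add z (z + t)). replace (z - (z + t))%C with (- t)%C in H by ring.
    rewrite Cmod_opp in H. split; [apply Cmod_pos_neq|]; lra. }
  exists (- (/ (z * z)))%C, (/ (z * z * z))%C, (fun t => - (/ (z * z * z)) * / (z + t))%C. split.
  - apply bounded_near0_mult; [apply bounded_near0_const|].
    exists (/ (Cmod z / 2)), (Cmod z / 2). split; [lra|]. intros t Ht. destruct (Hn t Ht).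
    rewrite Cmod_inv by auto. apply Rinv_le_contravar; lra.
  - exists (Cmod z / 2). split; [lra|]. intros t Ht. destruct (Hn t Ht). field. auto.
Qed.

Lemma taylor2_continuous h z : taylor2 h z -> forall eps, 0 < eps ->
  exists delta, 0 < delta /\ forall w, Cmod (w - z) < delta -> Cmod (h w - h z) < eps.
Proof.
  intros (h1 & h2 & r & Hr & d & Hd & H) eps He.
  assert (bounded_near0 (fun t => h1 + h2 * t + t * t * r t)%C) as (B & d' & Hd' & HB).
  { repeat first [apply bounded_near0_plus | apply bounded_near0_mult | apply bounded_near0_const
                  | apply bounded_near0_id | assumption]. }
  set (B' := Rmax B 0 + 1). assert (HB' : 1 <= B') by (unfold B'; pose proof (Rmax_r B 0); lra).
  assert (HBB : B <= B') by (unfold B'; pose proof (Rmax_l B 0); lra).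
  exists (Rmin (Rmin d d') (eps / B')).
  assert (0 < eps / B') by (apply Rdiv_lt_0_compat; lra).
  split; [repeat apply Rmin_pos; auto|]. intros w Hw.
  pose proof (Rmin_l (Rmin d d') (eps / B')). pose proof (Rmin_r (Rmin d d') (eps / B')).
  pose proof (Rmin_l d d'). pose proof (Rmin_r d d').
  replace (h w - h z)%C with ((h1 + h2 * (w - z) + (w - z) * (w - z) * r (w - z)) * (w - z))%C.
  2: { pose proof (H (w - z)%C ltac:(lra)) as E. replace (z + (w - z))%C with w in E by ring.
       rewrite E. ring. }
  rewrite Cmod_mult. specialize (HB (w - z)%C ltac:(lra)).
  apply Rle_lt_trans with (B' * Cmod (w - z)).
  - apply Rmult_le_compat_r; [apply Cmod_ge_0 | lra].
  - replace eps with (B' * (eps / B')) by (field; lra). apply Rmult_lt_compat_l; lra.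
Qed.

(* The first- and second-order terms cancel over the four directions. *)
Lemma taylor2_four_point_mean h z : taylor2 h z -> exists B delta, 0 <= B /\ 0 < delta /\
  forall s, 0 < s < delta -> 4 * Cmod (h z) <=
    Cmod (h (z + RtoC s)%C) + Cmod (h (z - RtoC s)%C) + Cmod (h (z + Ci * RtoC s)%C) + Cmod (h (z - Ci * RtoC s)%C)
    + B * s ^ 3.
Proof.
  intros (h1 & h2 & r & (B & d1 & Hd1 & Hr) & d & Hd & H).
  assert (HB : 0 <= B).
  { specialize (Hr (RtoC 0)). rewrite Cmod_0 in Hr. pose proof (Cmod_ge_0 (r (RtoC 0))).
    specialize (Hr Hd1). lra. }
  exists (4 * B), (Rmin d d1). split; [lra|]. split; [apply Rmin_pos; auto|]. intros s Hs.
  pose proof (Rmin_l d d1). pose proof (Rmin_r d d1).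
  assert (Hm : Cmod (RtoC s) = s) by (rewrite Cmod_R, Rabs_pos_eq; lra).
  assert (Hi : Cmod (Ci * RtoC s) = s) by (rewrite Cmod_mult, Cmod_Ci, Hm; lra).
  assert (Ci2 : (Ci * Ci = - RtoC 1)%C).
  { unfold Ci, Cmult, Copp, RtoC; simpl; f_equal; ring. }
  pose proof (H (RtoC s) ltac:(lra)) as E1. pose proof (H (- RtoC s)%C ltac:(rewrite Cmod_opp; lra)) as E2.
  pose proof (H (Ci * RtoC s)%C ltac:(lra)) as E3.
  pose proof (H (- (Ci * RtoC s))%C ltac:(rewrite Cmod_opp; lra)) as E4.
  pose proof (Hr (RtoC s) ltac:(lra)) as B1. pose proof (Hr (- RtoC s)%C ltac:(rewrite Cmod_opp; lra)) as B2.
  pose proof (Hr (Ci * RtoC s)%C ltac:(lra)) as B3.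
  pose proof (Hr (- (Ci * RtoC s))%C ltac:(rewrite Cmod_opp; lra)) as B4.
  change (z + - RtoC s)%C with (z - RtoC s)%C in E2.
  change (z + - (Ci * RtoC s))%C with (z - Ci * RtoC s)%C in E4.
  set (S4 := (h (z + RtoC s) + h (z - RtoC s) + h (z + Ci * RtoC s) + h (z - Ci * RtoC s))%C).
  set (q1 := r (RtoC s)) in *. set (q2 := r (- RtoC s)%C) in *.
  set (q3 := r (Ci * RtoC s)%C) in *. set (q4 := r (- (Ci * RtoC s))%C) in *.
  set (Q := (q1 - q2 - Ci * q3 + Ci * q4)%C).
  assert (HQ : Cmod Q <= 4 * B).
  { unfold Q. pose proof (Cmod_triangle (q1 - q2 - Ci * q3) (Ci * q4)).
    pose proof (Cmod_sub_le (q1 - q2) (Ci * q3)). pose proof (Cmod_sub_le q1 q2).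
    rewrite !Cmod_mult, !Cmod_Ci in *. lra. }
  assert (E : (RtoC 4 * h z = S4 - RtoC s * RtoC s * RtoC s * Q)%C).
  { unfold S4, Q. rewrite E1, E2, E3, E4.
    replace (RtoC 4) with (RtoC 1 + RtoC 1 + RtoC 1 + RtoC 1)%C
      by (rewrite <- !RtoC_plus; f_equal; lra).
    ring [Ci2]. }
  assert (E' : 4 * Cmod (h z) = Cmod (S4 - RtoC s * RtoC s * RtoC s * Q)).
  { rewrite <- E, Cmod_mult, Cmod_R, Rabs_pos_eq; lra. }
  rewrite E'. pose proof (Cmod_sub_le S4 (RtoC s * RtoC s * RtoC s * Q)) as HS.
  rewrite !Cmod_mult, Hm in HS.
  assert (s * s * s * Cmod Q <= s * s * s * (4 * B)).
  { apply Rmult_le_compat_l; auto. repeat apply Rmult_le_pos; lra. }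
  assert (Cmod S4 <= Cmod (h (z + RtoC s)%C) + Cmod (h (z - RtoC s)%C) + Cmod (h (z + Ci * RtoC s)%C)
                     + Cmod (h (z - Ci * RtoC s)%C)).
  { unfold S4. pose proof (Cmod_triangle (h (z + RtoC s) + h (z - RtoC s) + h (z + Ci * RtoC s))%C
                             (h (z - Ci * RtoC s)%C)).
    pose proof (Cmod_triangle (h (z + RtoC s) + h (z - RtoC s))%C (h (z + Ci * RtoC s)%C)).
    pose proof (Cmod_triangle (h (z + RtoC s)%C) (h (z - RtoC s)%C)). lra. }
  replace (4 * B * s ^ 3) with (s * s * s * (4 * B)) by ring. lra.
Qed.

Definition seq_closed (W : C -> Prop) := forall u l, (forall k : nat, W (u k)) -> cv u l -> W l.

(** Compactness in sequential form; an unbounded [u] is refuted by the same limit point argument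
    that shows the supremum to be attained. *)
Lemma max_attained (W : C -> Prop) (u : C -> R) R0 :
  (exists z, W z) -> (forall z, W z -> Cmod z <= R0) -> seq_closed W ->
  (forall z, W z -> forall eps, 0 < eps -> exists delta, 0 < delta /\
     forall w, Cmod (w - z) < delta -> Rabs (u w - u z) < eps) ->
  exists z, W z /\ forall w, W w -> u w <= u z.
Proof.
  intros [z0 Hz0] Hb Hc Hu.
  assert (Hlim : forall v : nat -> C, (forall k, W (v k)) -> exists l, W l /\
            forall eps J, 0 < eps -> exists j, (J <= j)%nat /\ u (v j) < u l + eps).
  { intros v Hv. destruct (bounded_complex_subseq v R0) as (l & phi & Hphi & Hl).
    { intros; apply Hb; auto. }
    assert (W l) by (apply Hc with (fun j => v (phi j)); auto).
    exists l. split; auto. intros eps J He.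
    destruct (Hu l H eps He) as (d & Hd & Hd'). destruct (Hl d Hd) as [J' HJ'].
    exists (phi (J + J')%nat). split; [specialize (Hphi (J + J')%nat); lia|].
    specialize (Hd' _ (HJ' (J + J')%nat ltac:(lia))). apply Rabs_def2 in Hd'. lra. }
  destruct (classic (exists M, forall z, W z -> u z <= M)) as [[M HM]|HM].
  - destruct (completeness (fun y => exists z, W z /\ y = u z)) as [m [Hm1 Hm2]].
    { exists M. intros y (z & Hz & ->). auto. }
    { exists (u z0), z0. auto. }
    assert (forall k, exists z, W z /\ m - / (INR k + 1) < u z).
    { intros k. apply NNPP. intros Hn. pose proof (inv_INR_pos k).
      assert (m <= m - / (INR k + 1)); [|lra]. apply Hm2. intros y (z & Hz & ->).
      apply Rnot_lt_le. intros Hlt. apply Hn. exists z; auto. }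
    destruct (choice _ H) as [v Hv].
    destruct (Hlim v) as (l & Hl & Hl'); [intros; apply Hv|].
    exists l. split; auto. intros w Hw.
    assert (u w <= m) by (apply Hm1; exists w; auto).
    apply Rle_trans with m; auto. apply Rnot_lt_le. intros Hlt.
    destruct (inv_INR_lt ((m - u l) / 2)) as [J HJ]; [lra|].
    destruct (Hl' ((m - u l) / 2) J) as (j & Hj & Hj'); [lra|].
    specialize (HJ j Hj). pose proof (proj2 (Hv j)). lra.
  - exfalso.
    assert (forall k, exists z, W z /\ INR k < u z).
    { intros k. apply NNPP. intros Hn. apply HM. exists (INR k). intros z Hz.
      apply Rnot_lt_le. intros Hlt. apply Hn. exists z; auto. }
    destruct (choice _ H) as [v Hv].
    destruct (Hlim v) as (l & Hl & Hl'); [intros; apply Hv|].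
    destruct (INR_unbounded (u l + 1)) as [J HJ].
    destruct (Hl' 1 J) as (j & Hj & Hj'); [lra|].
    pose proof (proj2 (Hv j)). apply le_INR in Hj. lra.
Qed.

Lemma Cmod_sq z : Cmod z ^ 2 = fst z ^ 2 + snd z ^ 2.
Proof. apply Cmod2_alt. Qed.

Lemma Cmod_sq_continuous z eps : 0 < eps -> exists delta, 0 < delta /\
  forall w, Cmod (w - z) < delta -> Rabs (Cmod w ^ 2 - Cmod z ^ 2) < eps.
Proof.
  intros He. set (B := 2 * Cmod z + 1). pose proof (Cmod_ge_0 z).
  exists (Rmin 1 (eps / B)). assert (0 < eps / B) by (apply Rdiv_lt_0_compat; unfold B; lra).
  split; [apply Rmin_pos; lra|]. intros w Hw.
  pose proof (Rmin_l 1 (eps / B)). pose proof (Rmin_r 1 (eps / B)).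
  pose proof (Cmod_le_add w z). pose proof (Cmod_le_add z w). rewrite (Cmod_sub_sym z w) in *.
  pose proof (Cmod_ge_0 w).
  replace (Cmod w ^ 2 - Cmod z ^ 2) with ((Cmod w - Cmod z) * (Cmod w + Cmod z)) by ring.
  rewrite Rabs_mult, (Rabs_pos_eq (_ + _)) by lra.
  assert (Rabs (Cmod w - Cmod z) <= Cmod (w - z)) by (apply Rabs_le; lra).
  apply Rle_lt_trans with (Cmod (w - z) * B).
  - apply Rmult_le_compat; [apply Rabs_pos | lra | auto | unfold B; lra].
  - replace eps with (eps / B * B) by (field; unfold B; lra).
    apply Rmult_lt_compat_r; [unfold B|]; lra.
Qed.

(* Adding [e |z|^2] makes the four-point mean inequality strict, so no interior maximum can occur. *)
Lemma maximum_principle (W Bd : C -> Prop) (v : C -> C) m : 0 <= m -> seq_closed W ->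
  (forall z, W z -> taylor2 v z) ->
  (forall z, W z -> ~ Bd z -> exists delta, 0 < delta /\ forall w, Cmod (w - z) < delta -> W w) ->
  (forall z, W z -> Bd z -> Cmod (v z) <= m) ->
  (forall eps, 0 < eps -> exists r, forall z, W z -> r <= Cmod z -> Cmod (v z) <= eps) ->
  forall z, W z -> Cmod (v z) <= m.
Proof.
  intros Hm Hc HT Hint Hbd Hinf z1 Hz1. apply Rnot_lt_le. intros Hlt.
  (* The excess is split in three: up to radius [r] the term [e |z|^2] costs at most one [eta], and
     from [r0] on [v] costs at most one, so the maximum of [u] lies neither on the outer circle nor
     in [Bd]. *)
  set (eta := (Cmod (v z1) - m) / 3). assert (Heta : 0 < eta) by (unfold eta; lra).
  destruct (Hinf eta Heta) as [r0 Hr0].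
  set (r := Rmax (Rmax r0 (Cmod z1 + 1)) 1).
  assert (Hr1 : r0 <= r) by (unfold r; eapply Rle_trans; [apply Rmax_l | apply Rmax_l]).
  assert (Hr2 : Cmod z1 + 1 <= r)
    by (unfold r; eapply Rle_trans; [apply (Rmax_r r0) | apply Rmax_l]).
  assert (Hr3 : 1 <= r) by (unfold r; apply Rmax_r).
  set (e := eta / (r * r)). assert (He : 0 < e) by (apply Rdiv_lt_0_compat; nra).
  assert (Her : e * (r * r) = eta) by (unfold e; field; lra).
  set (u := fun z => Cmod (v z) + e * Cmod z ^ 2).
  destruct (max_attained (fun z => W z /\ Cmod z <= r) u r) as (z & [Hz Hzr] & Hmax).
  { exists z1. split; auto. lra. }
  { tauto. }
  { intros s l Hs Hl. split; [apply Hc with s; auto; apply Hs|].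
    replace l with (l - RtoC 0)%C by ring. apply cv_Cmod_le with (1 := Hl).
    intros J. exists J. split; auto. replace (s J - RtoC 0)%C with (s J) by ring. apply Hs. }
  { intros z [Hz _] eps Heps.
    destruct (taylor2_continuous v z (HT z Hz) (eps / 2)) as (d1 & Hd1 & H1); [lra|].
    destruct (Cmod_sq_continuous z (eps / 2 / e)) as (d2 & Hd2 & H2).
    { apply Rdiv_lt_0_compat; lra. }
    exists (Rmin d1 d2). split; [apply Rmin_pos; auto|]. intros w Hw.
    specialize (H1 w (Rlt_le_trans _ _ _ Hw (Rmin_l _ _))).
    specialize (H2 w (Rlt_le_trans _ _ _ Hw (Rmin_r _ _))).
    unfold u.
    replace (Cmod (v w) + e * Cmod w ^ 2 - (Cmod (v z) + e * Cmod z ^ 2)) with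
      ((Cmod (v w) - Cmod (v z)) + e * (Cmod w ^ 2 - Cmod z ^ 2)) by ring.
    eapply Rle_lt_trans; [apply Rabs_triang|]. rewrite Rabs_mult, (Rabs_pos_eq e) by lra.
    assert (e * Rabs (Cmod w ^ 2 - Cmod z ^ 2) < eps / 2).
    { replace (eps / 2) with (e * (eps / 2 / e)) by (field; lra). apply Rmult_lt_compat_l; auto. }
    assert (Rabs (Cmod (v w) - Cmod (v z)) <= Cmod (v w - v z)).
    { pose proof (Cmod_le_add (v w) (v z)). pose proof (Cmod_le_add (v z) (v w)).
      rewrite (Cmod_sub_sym (v z) (v w)) in *. apply Rabs_le. lra. }
    lra. }
  assert (Huz : m + 3 * eta <= u z).
  { apply Rle_trans with (u z1); [|apply Hmax; split; auto; lra].
    unfold u, eta. pose proof (pow2_ge_0 (Cmod z1)).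
    assert (0 <= e * Cmod z1 ^ 2) by (apply Rmult_le_pos; lra). lra. }
  pose proof (Cmod_ge_0 z) as Hz0.
  assert (Hez : e * Cmod z ^ 2 <= eta).
  { rewrite <- Her. apply Rmult_le_compat_l; [lra|]. simpl. rewrite Rmult_1_r.
    apply Rmult_le_compat; auto. }
  assert (Hlt' : Cmod z < r).
  { apply Rnot_le_lt. intros Hle. specialize (Hr0 z Hz ltac:(lra)). unfold u in Huz. lra. }
  assert (HB : ~ Bd z).
  { intros HB. specialize (Hbd z Hz HB). unfold u in Huz. lra. }
  destruct (Hint z Hz HB) as (d1 & Hd1 & H1).
  destruct (taylor2_four_point_mean v z (HT z Hz)) as (B & d2 & HB0 & Hd2 & H2).
  (* The four bounds keep the four points in [W], in the range of the Taylor estimate and inside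
     radius [r], and give [B * s <= e], so that the cubic error loses against [4 * e * s ^ 2]. *)
  set (s := Rmin (Rmin (d1 / 2) (d2 / 2)) (Rmin ((r - Cmod z) / 2) (e / (B + 1)))).
  assert (He' : 0 < e / (B + 1)) by (apply Rdiv_lt_0_compat; lra).
  assert (Hs0 : 0 < s) by (unfold s; repeat apply Rmin_pos; lra).
  assert (Hs1 : s <= d1 / 2) by (unfold s; eapply Rle_trans; [apply Rmin_l | apply Rmin_l]).
  assert (Hs2 : s <= d2 / 2) by (unfold s; eapply Rle_trans; [apply Rmin_l | apply Rmin_r]).
  assert (Hs3 : s <= (r - Cmod z) / 2) by (unfold s; eapply Rle_trans; [apply Rmin_r | apply Rmin_l]).
  assert (Hs4 : s <= e / (B + 1)) by (unfold s; eapply Rle_trans; [apply Rmin_r | apply Rmin_r]).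
  specialize (H2 s ltac:(lra)).
  assert (Hw : forall t, Cmod t = s -> u (z + t)%C <= u z).
  { intros t Ht. apply Hmax. split.
    - apply H1. replace (z + t - z)%C with t by ring. lra.
    - pose proof (Cmod_triangle z t). lra. }
  assert (Hm1 : Cmod (RtoC s) = s) by (rewrite Cmod_R, Rabs_pos_eq; lra).
  assert (Hm2 : Cmod (Ci * RtoC s) = s) by (rewrite Cmod_mult, Cmod_Ci, Hm1; lra).
  pose proof (Hw (RtoC s) Hm1) as W1.
  pose proof (Hw (- RtoC s)%C ltac:(rewrite Cmod_opp; auto)) as W2.
  pose proof (Hw (Ci * RtoC s)%C Hm2) as W3.
  pose proof (Hw (- (Ci * RtoC s))%C ltac:(rewrite Cmod_opp; auto)) as W4.
  change (z + - RtoC s)%C with (z - RtoC s)%C in W2.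
  change (z + - (Ci * RtoC s))%C with (z - Ci * RtoC s)%C in W4.
  unfold u in W1, W2, W3, W4.
  assert (Hsum : Cmod (z + RtoC s) ^ 2 + Cmod (z - RtoC s) ^ 2 + Cmod (z + Ci * RtoC s) ^ 2
                 + Cmod (z - Ci * RtoC s) ^ 2 = 4 * Cmod z ^ 2 + 4 * s ^ 2).
  { rewrite !Cmod_sq. unfold Ci, RtoC, Cplus, Cminus, Copp, Cmult; simpl. ring. }
  assert (Hfin : e * (4 * s ^ 2) <= B * s ^ 3).
  { assert (e * (Cmod (z + RtoC s) ^ 2 + Cmod (z - RtoC s) ^ 2 + Cmod (z + Ci * RtoC s) ^ 2
                 + Cmod (z - Ci * RtoC s) ^ 2) = e * (4 * Cmod z ^ 2) + e * (4 * s ^ 2))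
      by (rewrite Hsum; ring). lra. }
  assert (B * s <= e).
  { apply Rle_trans with ((B + 1) * (e / (B + 1))); [|right; field; lra].
    apply Rmult_le_compat; lra. }
  assert (B * s ^ 3 <= e * s ^ 2).
  { replace (B * s ^ 3) with (B * s * s ^ 2) by ring. apply Rmult_le_compat_r; [apply pow2_ge_0 | auto]. }
  assert (0 < e * s ^ 2) by (apply Rmult_lt_0_compat; [auto | apply pow_lt; auto]).
  lra.
Qed.

(** Points of C^3 seen in every C^N with [N >= 3]: the hull statements can then be made directly for
    the polynomials of the final ambient space. *)
Definition pt3 (a b w : C) : nat -> C :=
  fun i => match i with 0%nat => a | 1%nat => b | 2%nat => w | _ => RtoC 0 end.

Definition dist3 (a b w a' b' w' : C) : R := Cmod (a - a') + Cmod (b - b') + Cmod (w - w').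

Lemma rsum_pt3 N a b w a' b' w' : (3 <= N)%nat ->
  rsum N (fun i => Cmod (pt3 a b w i - pt3 a' b' w' i)) = dist3 a b w a' b' w'.
Proof.
  intros H. replace N with (N - 3 + 3)%nat by lia. generalize (N - 3)%nat as m. clear.
  induction m.
  - simpl. unfold dist3. ring.
  - change (S m + 3)%nat with (S (m + 3)). cbn [rsum]. rewrite IHm.
    replace (m + 3)%nat with (S (S (S m))) by lia. cbn [pt3].
    replace (RtoC 0 - RtoC 0)%C with (RtoC 0) by ring. rewrite Cmod_0. ring.
Qed.

Lemma poly_bounded_lipschitz3 N p B : (3 <= N)%nat -> is_poly N p -> 0 <= B -> exists L, 0 < L /\
  forall a b w a' b' w', Cmod a <= B -> Cmod b <= B -> Cmod w <= B ->
    Cmod a' <= B -> Cmod b' <= B -> Cmod w' <= B ->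
    Cmod (p (pt3 a b w)) <= L /\
    Cmod (p (pt3 a b w) - p (pt3 a' b' w')) <= L * dist3 a b w a' b' w'.
Proof.
  intros HN Hp HB. destruct (poly_bounded_lipschitz N p Hp B) as (L & HL & H).
  exists (L + 1). split; [lra|]. intros.
  assert (Hb : forall a b w, Cmod a <= B -> Cmod b <= B -> Cmod w <= B ->
            forall i, (i < N)%nat -> Cmod (pt3 a b w i) <= B).
  { intros x y z ? ? ? [|[|[|i]]] _; simpl; auto. rewrite Cmod_0. auto. }
  destruct (H (pt3 a b w) (pt3 a' b' w')) as [G1 G2]; [apply Hb; auto | apply Hb; auto |].
  rewrite rsum_pt3 in G2 by auto.
  assert (0 <= dist3 a b w a' b' w').
  { unfold dist3. pose proof (Cmod_ge_0 (a - a')). pose proof (Cmod_ge_0 (b - b')).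
    pose proof (Cmod_ge_0 (w - w')). lra. }
  split; lra.
Qed.

Lemma taylor2_poly N p (g : C -> nat -> C) z :
  is_poly N p -> (forall i, taylor2 (fun w => g w i) z) -> taylor2 (fun w => p (g w)) z.
Proof.
  intros Hp Hg. induction Hp.
  - apply taylor2_const.
  - apply Hg.
  - apply (taylor2_plus (fun w => p (g w)) (fun w => q (g w))); auto.
  - apply (taylor2_mult (fun w => p (g w)) (fun w => q (g w))); auto.
Qed.

Lemma taylor2_pow h z n : taylor2 h z -> taylor2 (fun w => h w ^ n)%C z.
Proof.
  intros H. induction n; simpl; [apply taylor2_const | apply taylor2_mult; auto].
Qed.

(** The complement of the open discs of radius [(1/3) ^ k] about the centres of level [k]: it avoids
    the poles of [cauchy_sum k], and all its points off the circles of [near] are interior. *)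
Fixpoint outside (k : nat) (z : C) : Prop :=
  match k with
  | O => 1 <= Cmod z
  | S k => forall d, outside k (RtoC 3 * (z - dirC d))%C
  end.

Lemma outside_closed k : seq_closed (outside k).
Proof.
  induction k; intros u l Hu Hl; simpl in *.
  - apply Rnot_lt_le. intros Hlt. destruct (Hl (1 - Cmod l)) as [J HJ]; [lra|].
    specialize (HJ J (le_n _)). specialize (Hu J). pose proof (Cmod_le_add (u J) l). lra.
  - intros d. apply IHk with (fun j => RtoC 3 * (u j - dirC d))%C; auto.
    intros eps He. destruct (Hl (eps / 3)) as [J HJ]; [lra|]. exists J. intros j Hj.
    replace (RtoC 3 * (u j - dirC d) - RtoC 3 * (l - dirC d))%C with (RtoC 3 * (u j - l))%C by ring.
    rewrite Cmod_3. specialize (HJ j Hj). lra.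
Qed.

Lemma outside_far k : forall z, 3 / 2 <= Cmod z -> outside k z.
Proof.
  induction k; intros z Hz; simpl; [lra|]. intros d. apply IHk. pose proof (zoom_far z d). lra.
Qed.

Lemma dir_uniform_delta (P : dir -> R -> Prop) :
  (forall d x y, P d x -> y <= x -> P d y) ->
  (forall d, exists x, 0 < x /\ P d x) -> exists x, 0 < x /\ forall d, P d x.
Proof.
  intros Hm H.
  destruct (H (false, false)) as (x1 & H1 & P1). destruct (H (false, true)) as (x2 & H2 & P2).
  destruct (H (true, false)) as (x3 & H3 & P3). destruct (H (true, true)) as (x4 & H4 & P4).
  set (x := Rmin (Rmin x1 x2) (Rmin x3 x4)).
  pose proof (Rmin_l (Rmin x1 x2) (Rmin x3 x4)). pose proof (Rmin_r (Rmin x1 x2) (Rmin x3 x4)).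
  pose proof (Rmin_l x1 x2). pose proof (Rmin_r x1 x2). pose proof (Rmin_l x3 x4). pose proof (Rmin_r x3 x4).
  exists x. split; [unfold x; repeat apply Rmin_pos; auto|].
  intros [[] []]; eapply Hm; eauto; unfold x; lra.
Qed.

Definition cons_code (d : dir) (s : nat -> dir) : nat -> dir :=
  fun i => match i with O => d | S i => s i end.

Lemma outside_interior k : forall z, outside k z -> ~ (exists s, near k s z) ->
  exists delta, 0 < delta /\ forall w, Cmod (w - z) < delta -> outside k w.
Proof.
  induction k; intros z Hz Hn; simpl in *.
  - assert (Cmod z <> 1) by (intros E; apply Hn; exists (fun _ => (false, false)); auto).
    exists (Cmod z - 1). split; [lra|]. intros w Hw. pose proof (Cmod_le_add z w).
    rewrite (Cmod_sub_sym z w) in *. lra.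
  - destruct (dir_uniform_delta (fun d x => forall w, Cmod (w - z) < x ->
                outside k (RtoC 3 * (w - dirC d))%C)) as (x & Hx & H).
    + intros d x y H Hxy w Hw. apply H. lra.
    + intros d. destruct (IHk (RtoC 3 * (z - dirC d))%C (Hz d)) as (x & Hx & H).
      { intros [s Hs]. apply Hn. exists (cons_code d s). exact Hs. }
      exists (x / 3). split; [lra|]. intros w Hw. apply H.
      replace (RtoC 3 * (w - dirC d) - RtoC 3 * (z - dirC d))%C with (RtoC 3 * (w - z))%C by ring.
      rewrite Cmod_3. lra.
    + exists x. auto.
Qed.

Lemma taylor2_cauchy_sum k : forall z, outside k z -> taylor2 (cauchy_sum k) z.
Proof.
  induction k; intros z Hz; simpl in *.
  - apply taylor2_inv. apply Cmod_pos_neq. lra.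
  - apply taylor2_mult; [apply taylor2_const|]. unfold sum4.
    repeat apply taylor2_plus; apply taylor2_zoom; auto.
Qed.

(** All these measures have mass 1, so [z f(z)] tends to 1 at infinity, uniformly in [k]. The factor
    3/2 is the sum of the series of [cauchy_sum_succ]. *)
Lemma cauchy_sum_infinity k u : 3 / 2 < Cmod u ->
  Cmod (cauchy_sum k u - / u) <= 3 / 2 / (Cmod u - 3 / 2) ^ 2.
Proof.
  intros Hu. set (q := / (Cmod u - 3 / 2) ^ 2).
  assert (Hq : 0 < q) by (apply Rinv_0_lt_compat, pow_lt; lra).
  assert (Cmod (cauchy_sum k u - / u) <= 3 / 2 * (1 - (1 / 3) ^ k) * q).
  { induction k.
    - simpl. replace (/ u - / u)%C with (RtoC 0) by ring. rewrite Cmod_0. lra.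
    - pose proof (cauchy_sum_succ k u Hu).
      pose proof (Cmod_sub_tri (cauchy_sum (S k) u) (cauchy_sum k u) (/ u)).
      rewrite <- tech_pow_Rmult.
      change ((1 / 3) ^ k / (Cmod u - 3 / 2) ^ 2) with ((1 / 3) ^ k * q) in H. lra. }
  assert (0 <= (1 / 3) ^ k) by (apply pow_le; lra).
  change (3 / 2 / (Cmod u - 3 / 2) ^ 2) with (3 / 2 * q). nra.
Qed.

(** * Limits along codes, and the value at infinity in the hull *)

Section CodeLimits.

Variables X F : (nat -> dir) -> C.
Hypothesis XF : forall k s z, near k s z ->
  Cmod (z - X s) <= 9 / 2 * (1 / 3) ^ k /\ Cmod (cauchy_sum k z - F s) <= 104 * (3 / 4) ^ k.

Lemma pow_small q eps : 0 <= q < 1 -> 0 < eps -> exists k, forall j, (k <= j)%nat -> q ^ j < eps.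
Proof.
  intros Hq He. destruct (pow_lt_1_zero q) with (y := eps) as [k Hk]; auto.
  { rewrite Rabs_pos_eq; lra. }
  exists k. intros j Hj. specialize (Hk j Hj).
  rewrite Rabs_pos_eq in Hk; auto. apply pow_le; lra.
Qed.

Lemma le_of_pow_le a b c q : 0 <= q < 1 -> 0 <= c -> (forall k : nat, a <= b + c * q ^ k) -> a <= b.
Proof.
  intros Hq Hc H. apply Rnot_lt_le. intros Hlt.
  destruct (pow_small q ((a - b) / (c + 1)) Hq) as [k Hk].
  { apply Rdiv_lt_0_compat; lra. }
  specialize (Hk k (le_n _)). specialize (H k).
  assert (0 <= q ^ k) by (apply pow_le; lra).
  assert ((c + 1) * q ^ k < a - b).
  { replace (a - b) with ((c + 1) * ((a - b) / (c + 1))) by (field; lra).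
    apply Rmult_lt_compat_l; lra. }
  lra.
Qed.

Lemma X_bound s : Cmod (X s) <= 3 / 2.
Proof.
  apply le_of_pow_le with (c := 9 / 2) (q := 1 / 3); try lra. intros k.
  pose proof (near_near_point k s) as H. destruct (XF _ _ _ H). apply near_bounded in H.
  pose proof (Cmod_le_add (X s) (near_point k s)). rewrite Cmod_sub_sym in H2. lra.
Qed.

Lemma F_bound s : Cmod (F s) <= 105.
Proof.
  destruct (XF O s (RtoC 1)) as [_ H]; [apply Cmod_1|].
  simpl in H. replace (/ RtoC 1)%C with (RtoC 1) in H by (field).
  pose proof (Cmod_le_add (F s) (RtoC 1)). rewrite Cmod_1, Cmod_sub_sym in H0. lra.
Qed.

Lemma X_tail s : X s = (dirC (s O) + X (code_tail s) / RtoC 3)%C.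
Proof.
  apply Cmod_sub0. apply Rle_antisym; [|apply Cmod_ge_0].
  apply le_of_pow_le with (c := 9) (q := 1 / 3); try lra. intros k.
  pose proof (near_near_point (S k) s) as H. destruct (XF _ _ _ H) as [H1 _].
  destruct (XF _ _ _ (near_near_point k (code_tail s))) as [H2 _].
  assert (Cmod (near_point (S k) s - (dirC (s O) + X (code_tail s) / RtoC 3)) <= 3 / 2 * (1 / 3) ^ k).
  { replace (near_point (S k) s - (dirC (s O) + X (code_tail s) / RtoC 3))%C with
      ((near_point k (code_tail s) - X (code_tail s)) / RtoC 3)%C by (simpl; field).
    rewrite Cmod_div by (apply Cmod_pos_neq; rewrite Cmod_R, Rabs_pos_eq; lra).
    rewrite Cmod_R, Rabs_pos_eq by lra. lra. }
  pose proof (Cmod_sub_tri (X s) (near_point (S k) s) (dirC (s O) + X (code_tail s) / RtoC 3)).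
  rewrite (Cmod_sub_sym (X s) (near_point (S k) s)) in *.
  rewrite <- tech_pow_Rmult in H1. assert (0 <= (1 / 3) ^ k) by (apply pow_le; lra). lra.
Qed.

(** Points with different first digits are at least [7/5 - 2 * (3/2) / 3 = 2/5] apart, which exceeds
    1/3; later digits follow by self-similarity. *)
Lemma X_gap k : forall s t, Cmod (X s - X t) < (1 / 3) ^ k -> agree k s t.
Proof.
  induction k; intros s t H i Hi; [lia|].
  rewrite <- tech_pow_Rmult in H.
  assert (Hk : (1 / 3) ^ k <= 1).
  { clear. induction k; simpl; [lra|]. assert (0 <= (1 / 3) ^ k) by (apply pow_le; lra). lra. }
  rewrite (X_tail s), (X_tail t) in H.
  assert (H3 : forall z, Cmod (z / RtoC 3) = Cmod z / 3).
  { intros z. rewrite Cmod_div by (apply Cmod_pos_neq; rewrite Cmod_R, Rabs_pos_eq; lra).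
    rewrite Cmod_R, Rabs_pos_eq by lra. lra. }
  assert (E : s O = t O).
  { apply NNPP. intros Hne. apply dirC_separated in Hne.
    pose proof (Cmod_le_add (dirC (s O) - dirC (t O))%C
      (dirC (s O) + X (code_tail s) / RtoC 3 - (dirC (t O) + X (code_tail t) / RtoC 3))%C) as H1.
    replace (dirC (s O) - dirC (t O) -
      (dirC (s O) + X (code_tail s) / RtoC 3 - (dirC (t O) + X (code_tail t) / RtoC 3)))%C with
      (X (code_tail t) / RtoC 3 - X (code_tail s) / RtoC 3)%C in H1 by ring.
    pose proof (Cmod_sub_le (X (code_tail t) / RtoC 3) (X (code_tail s) / RtoC 3)).
    rewrite !H3 in *. pose proof (X_bound (code_tail s)). pose proof (X_bound (code_tail t)). lra. }
  rewrite E in H.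
  replace (dirC (t O) + X (code_tail s) / RtoC 3 - (dirC (t O) + X (code_tail t) / RtoC 3))%C with
    ((X (code_tail s) - X (code_tail t)) / RtoC 3)%C in H by (field).
  rewrite H3 in H. destruct i; auto. apply (IHk (code_tail s) (code_tail t)); [lra | lia].
Qed.

(** Codes with [k] common digits share a circle of level [k], so both constants are twice those of
    [XF]. *)
Lemma agree_close k s t : agree k s t ->
  Cmod (X s - X t) <= 9 * (1 / 3) ^ k /\ Cmod (F s - F t) <= 208 * (3 / 4) ^ k.
Proof.
  intros H. pose proof (near_near_point k s) as Hs. pose proof (near_agree _ _ _ _ H Hs) as Ht.
  destruct (XF _ _ _ Hs). destruct (XF _ _ _ Ht).
  pose proof (Cmod_sub_tri (X s) (near_point k s) (X t)).
  pose proof (Cmod_sub_tri (F s) (cauchy_sum k (near_point k s)) (F t)).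
  rewrite (Cmod_sub_sym (X s) (near_point k s)) in *.
  rewrite (Cmod_sub_sym (F s) (cauchy_sum k (near_point k s))) in *. lra.
Qed.

Lemma prod_diff_bound (x y x' y' : C) A B :
  Cmod x <= A -> Cmod y' <= B ->
  Cmod (x * y - x' * y') <= A * Cmod (y - y') + B * Cmod (x - x').
Proof.
  intros HA HB. replace (x * y - x' * y')%C with (x * (y - y') + y' * (x - x'))%C by ring.
  eapply Rle_trans; [apply Cmod_triangle|]. rewrite !Cmod_mult.
  apply Rplus_le_compat; apply Rmult_le_compat_r; auto; apply Cmod_ge_0.
Qed.

Lemma third_le k : (1 / 3) ^ k <= (3 / 4) ^ k.
Proof. apply pow_incr. lra. Qed.

Lemma XF_bound s : Cmod (X s * F s) <= 158.
Proof.
  rewrite Cmod_mult. pose proof (X_bound s). pose proof (F_bound s).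
  pose proof (Cmod_ge_0 (X s)). pose proof (Cmod_ge_0 (F s)). nra.
Qed.

Lemma pow34_le_1 k : 0 <= (3 / 4) ^ k <= 1.
Proof. split; [apply pow_le; lra|]. rewrite <- (pow1 k). apply pow_incr. lra. Qed.

(* [(0, 1)] is the value at infinity of [(f, z f)] for the Cauchy transforms [f]. *)
Lemma code_hull_infinity N p M : (3 <= N)%nat -> is_poly N p ->
  (forall s, Cmod (p (pt3 (F s) (X s * F s) (RtoC 0))) <= M) ->
  Cmod (p (pt3 (RtoC 0) (RtoC 1) (RtoC 0))) <= M.
Proof.
  intros HN Hp HM. apply Rnot_lt_le. intros Hlt.
  set (P := Cmod (p (pt3 (RtoC 0) (RtoC 1) (RtoC 0)))) in *.
  set (eps := (P - M) / 3). assert (Heps : 0 < eps) by (unfold eps; lra).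
  (* 400 exceeds every coordinate met below: [|z f|] is at most [3/2 * 209] on the circles and at
     most 2 far out. *)
  destruct (poly_bounded_lipschitz3 N p 400 HN Hp ltac:(lra)) as (L & HL & HLip).
  assert (H00 : Cmod (RtoC 0) <= 400) by (rewrite Cmod_0; lra).
  assert (H01 : Cmod (RtoC 1) <= 400) by (rewrite Cmod_1; lra).
  assert (HM0 : 0 <= M).
  { eapply Rle_trans; [apply Cmod_ge_0 | apply (HM (fun _ => (false, false)))]. }
  destruct (pow_small (3 / 4) (eps / (L * 800)) ltac:(lra)) as [k Hk].
  { apply Rdiv_lt_0_compat; lra. }
  specialize (Hk k (le_n _)).
  set (f := cauchy_sum k). set (h := fun z => p (pt3 (f z) (z * f z)%C (RtoC 0)) : C).
  pose proof (pow34_le_1 k) as Hp34. pose proof (third_le k) as Hp3.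
  (* On the circles of level [k], [h] is within [eps] of a value of [p] on the limit set, where [M]
     applies. The 800 bounds [104 + 3/2 * 104 + 105 * 9/2], and [209 = 104 + 105]. *)
  assert (Hnear : forall z, (exists s, near k s z) -> Cmod (h z) <= M + eps /\ Cmod (f z) <= 209).
  { intros z [s Hs]. destruct (XF _ _ _ Hs) as [H1 H2]. fold f in H2. pose proof (near_bounded _ _ _ Hs) as Hz.
    pose proof (F_bound s) as HF. pose proof (XF_bound s) as HXF.
    pose proof (Cmod_le_add (f z) (F s)) as Hf.
    assert (Hf' : Cmod (f z) <= 209) by lra. split; auto.
    pose proof (prod_diff_bound z (f z) (X s) (F s) _ _ Hz HF) as H3.
    assert (Hzf : Cmod (z * f z) <= 400).
    { rewrite Cmod_mult. pose proof (Cmod_ge_0 z). pose proof (Cmod_ge_0 (f z)). nra. }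
    destruct (HLip (f z) (z * f z)%C (RtoC 0) (F s) (X s * F s)%C (RtoC 0)) as [_ H4]; try lra.
    unfold dist3 in H4. replace (RtoC 0 - RtoC 0)%C with (RtoC 0) in H4 by ring. rewrite Cmod_0 in H4.
    assert (Cmod (f z - F s) + Cmod (z * f z - X s * F s) + 0 <= 800 * (3 / 4) ^ k) by lra.
    assert (L * (Cmod (f z - F s) + Cmod (z * f z - X s * F s) + 0) <= eps).
    { apply Rle_trans with (L * (800 * (3 / 4) ^ k)); [apply Rmult_le_compat_l; lra|].
      apply Rle_trans with (L * 800 * (eps / (L * 800))); [|right; field; lra].
      rewrite <- Rmult_assoc. apply Rmult_le_compat_l; lra. }
    specialize (HM s).
    pose proof (Cmod_le_add (h z) (p (pt3 (F s) (X s * F s)%C (RtoC 0)))). unfold h in *. lra. }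
  assert (Hfar : forall z, 12 <= Cmod z -> Cmod (f z) <= 2 / Cmod z /\ Cmod (z * f z - RtoC 1) <= 6 / Cmod z
             /\ Cmod (h z) <= L).
  { intros z Hz. pose proof (cauchy_sum_bound k z ltac:(lra)) as H1. fold f in H1.
    pose proof (cauchy_sum_infinity k z ltac:(lra)) as H2. fold f in H2.
    assert (z <> RtoC 0) by (apply Cmod_pos_neq; lra).
    assert (A1 : / (Cmod z - 3 / 2) <= 2 / Cmod z).
    { replace (2 / Cmod z) with (/ (Cmod z / 2)) by (field; lra). apply Rinv_le_contravar; lra. }
    assert (A2 : Cmod (z * f z - RtoC 1) <= 6 / Cmod z).
    { replace (z * f z - RtoC 1)%C with (z * (f z - / z))%C by (field; auto). rewrite Cmod_mult.
      apply Rle_trans with (Cmod z * (3 / 2 / (Cmod z / 2) ^ 2)); [|right; field; lra].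
      apply Rmult_le_compat_l; [lra|]. eapply Rle_trans; [apply H2|].
      apply Rdiv_le_den; [lra | apply pow_lt; lra | apply pow_incr; lra]. }
    assert (A3 : 6 / Cmod z <= 1).
    { apply Rle_trans with (6 / 12); [apply Rdiv_le_den; lra | lra]. }
    assert (A4 : 2 / Cmod z <= 1).
    { apply Rle_trans with (2 / 12); [apply Rdiv_le_den; lra | lra]. }
    split; [lra|]. split; auto.
    pose proof (Cmod_le_add (z * f z) (RtoC 1)) as A5. rewrite Cmod_1 in A5.
    apply (HLip (f z) (z * f z)%C (RtoC 0) (f z) (z * f z)%C (RtoC 0)); lra. }
  (* Far enough out for [h z1] to be within [eps] of the value of [p] at [(0, 1, 0)], since the
     coordinates differ by at most [2 / r + 6 / r]. *)
  set (r := 12 + 8 * L / eps). assert (Hr : 0 < 8 * L / eps) by (apply Rdiv_lt_0_compat; lra).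
  set (z1 := RtoC r). assert (Hz1 : Cmod z1 = r) by (unfold z1; rewrite Cmod_R, Rabs_pos_eq; unfold r; lra).
  destruct (Hfar z1) as (B1 & B2 & _); [unfold r in *; lra|]. rewrite Hz1 in B1, B2.
  assert (Hr12 : 12 <= r) by (unfold r; lra).
  assert (C1 : 6 / r <= 1 / 2).
  { apply Rle_trans with (6 / 12); [apply Rdiv_le_den; lra | lra]. }
  assert (C2 : 2 / r <= 1).
  { apply Rle_trans with (2 / 12); [apply Rdiv_le_den; lra | lra]. }
  assert (Hf1 : 0 < Cmod (f z1)).
  { apply Cmod_gt_0. intros E. rewrite E in B2. replace (z1 * RtoC 0 - RtoC 1)%C with (- RtoC 1)%C in B2 by ring.
    rewrite Cmod_opp, Cmod_1 in B2. lra. }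
  assert (Hh1 : M + 2 * eps <= Cmod (h z1)).
  { pose proof (Cmod_le_add (z1 * f z1) (RtoC 1)) as A5. rewrite Cmod_1 in A5.
    destruct (HLip (RtoC 0) (RtoC 1) (RtoC 0) (f z1) (z1 * f z1)%C (RtoC 0)) as [_ H4]; try lra.
    unfold dist3 in H4. replace (RtoC 0 - RtoC 0)%C with (RtoC 0) in H4 by ring. rewrite Cmod_0 in H4.
    rewrite (Cmod_sub_sym (RtoC 1)) in H4.
    replace (RtoC 0 - f z1)%C with (- f z1)%C in H4 by ring. rewrite Cmod_opp in H4.
    assert (L * (Cmod (f z1) + Cmod (z1 * f z1 - RtoC 1) + 0) <= eps).
    { apply Rle_trans with (L * (8 / r)).
      - apply Rmult_le_compat_l; [lra|]. replace (8 / r) with (2 / r + 6 / r) by (field; lra). lra.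
      - apply Rle_trans with (L * (8 / (8 * L / eps))); [|right; field; lra].
        apply Rmult_le_compat_l; [lra|]. apply Rdiv_le_den; unfold r; lra. }
    pose proof (Cmod_le_add (p (pt3 (RtoC 0) (RtoC 1) (RtoC 0))) (h z1)). unfold h in *.
    fold P in H0. unfold eps in *. lra. }
  (* [h] need not tend to 0 at infinity, so the maximum principle is applied to [h ^ n * f], which
     does. The factor [f] then becomes harmless when powers of [M + eps] and [M + 2 * eps] are
     compared for large [n]. *)
  assert (Hpow : forall n, Cmod (h z1) ^ n * Cmod (f z1) <= (M + eps) ^ n * 209).
  { intros n. rewrite <- Cmod_pow, <- Cmod_mult.
    apply (maximum_principle (outside k) (fun z => exists s, near k s z) (fun z => h z ^ n * f z)%C).
    - apply Rmult_le_pos; [apply pow_le|]; lra.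
    - apply outside_closed.
    - intros z Hz. pose proof (taylor2_cauchy_sum k z Hz) as HT.
      apply taylor2_mult; auto. apply taylor2_pow.
      apply (taylor2_poly N p (fun z => pt3 (f z) (z * f z)%C (RtoC 0))); auto.
      intros [|[|[|i]]]; simpl; auto; try apply taylor2_const.
      apply taylor2_mult; auto. apply taylor2_id.
    - intros z Hz Hz'. apply outside_interior; auto.
    - intros z Hz Hs. destruct (Hnear z Hs). rewrite Cmod_mult, Cmod_pow.
      apply Rmult_le_compat; auto; try apply Cmod_ge_0.
      + apply pow_le, Cmod_ge_0.
      + apply pow_incr. split; auto. apply Cmod_ge_0.
    - intros e He. exists (12 + 2 * L ^ n / e). intros z _ Hz.
      assert (0 < L ^ n) by (apply pow_lt; auto).
      assert (0 < 2 * L ^ n / e) by (apply Rdiv_lt_0_compat; lra).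
      destruct (Hfar z ltac:(lra)) as (D1 & _ & D3).
      rewrite Cmod_mult, Cmod_pow.
      apply Rle_trans with (L ^ n * (2 / Cmod z)).
      + apply Rmult_le_compat; auto; [apply pow_le, Cmod_ge_0 | apply Cmod_ge_0 |].
        apply pow_incr. split; auto. apply Cmod_ge_0.
      + apply Rle_trans with (L ^ n * (2 / (2 * L ^ n / e))); [|right; field; lra].
        apply Rmult_le_compat_l; [lra|]. apply Rdiv_le_den; lra.
    - apply outside_far. lra. }
  set (m := M + eps) in *. set (m' := M + 2 * eps) in *.
  assert (Hm : 0 < m) by (unfold m; lra). assert (Hmm : m < m') by (unfold m, m'; lra).
  destruct (pow_small (m / m') (Cmod (f z1) / 209)) as [n Hn].
  { split; [left; apply Rdiv_lt_0_compat; lra|]. apply Rmult_lt_reg_r with m'; [lra|].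
    unfold Rdiv. rewrite Rmult_assoc, Rinv_l; lra. }
  { apply Rdiv_lt_0_compat; lra. }
  specialize (Hn n (le_n _)). specialize (Hpow n).
  assert (m' ^ n <= Cmod (h z1) ^ n) by (apply pow_incr; lra).
  assert (0 < m' ^ n) by (apply pow_lt; lra).
  assert (m ^ n = (m / m') ^ n * m' ^ n).
  { rewrite <- Rpow_mult_distr. f_equal. field. lra. }
  rewrite H1 in Hpow.
  assert (m' ^ n * Cmod (f z1) <= Cmod (h z1) ^ n * Cmod (f z1)) by (apply Rmult_le_compat_r; lra).
  assert ((m / m') ^ n * m' ^ n * 209 < Cmod (f z1) / 209 * m' ^ n * 209).
  { apply Rmult_lt_compat_r; [lra|]. apply Rmult_lt_compat_r; lra. }
  lra.
Qed.

End CodeLimits.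

(** * A chain-disconnected compact set in C^2 with a nontrivial hull *)

(** Total disconnectedness of a compact set will be used uniformly: for every [eps] there is a
    [delta] for which [delta]-chains stay within [eps]. *)
Inductive chain {T : Type} (S : T -> Prop) (d : T -> T -> R) (delta : R) (x : T) : T -> Prop :=
| chain_refl : S x -> chain S d delta x x
| chain_step y z : chain S d delta x y -> S z -> d y z < delta -> chain S d delta x z.

Arguments chain_refl {T S d delta x}.
Arguments chain_step {T S d delta x}.

Section Chains.

Variables (T : Type) (S : T -> Prop) (d : T -> T -> R) (delta : R).

Lemma chain_end x y : chain S d delta x y -> S y.
Proof. induction 1; auto. Qed.

Lemma chain_start x y : chain S d delta x y -> S x.
Proof. induction 1; auto. Qed.

Lemma chain_trans x y z : chain S d delta x y -> chain S d delta y z -> chain S d delta x z.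
Proof. intros H. induction 1; auto. eapply chain_step; eauto. Qed.

Lemma chain_sym : (forall x y, d x y = d y x) -> forall x y, chain S d delta x y -> chain S d delta y x.
Proof.
  intros Hd x y H. induction H; [apply chain_refl; auto|].
  eapply chain_trans; [|exact IHchain].
  eapply chain_step; [apply chain_refl; auto | eapply chain_end; eauto | rewrite Hd; auto].
Qed.

Lemma chain_restrict (Q : T -> Prop) x y : (forall z, chain S d delta x z -> Q z) ->
  chain S d delta x y -> chain (fun z => S z /\ Q z) d delta x y.
Proof.
  intros HQ H. induction H.
  - apply chain_refl. split; auto. apply HQ. apply chain_refl; auto.
  - eapply chain_step; eauto. split; auto. apply HQ. eapply chain_step; eauto.
Qed.

End Chains.

Lemma chain_map {T T' : Type} (S : T -> Prop) (S' : T' -> Prop) d d' (g : T -> T') delta delta' x y :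
  (forall x, S x -> S' (g x)) ->
  (forall x y, S x -> S y -> d x y < delta -> d' (g x) (g y) < delta') ->
  chain S d delta x y -> chain S' d' delta' (g x) (g y).
Proof.
  intros HS Hd H. induction H; [apply chain_refl; auto|].
  eapply chain_step; eauto. apply Hd; auto. eapply chain_end; eauto.
Qed.

Definition dist2 (p q : C * C) : R := Cmod (fst p - fst q) + Cmod (snd p - snd q).

Lemma dist2_sym p q : dist2 p q = dist2 q p.
Proof. unfold dist2. rewrite (Cmod_sub_sym (fst p)), (Cmod_sub_sym (snd p)). reflexivity. Qed.

Record planar_cantor (E0 : C -> C -> Prop) : Prop := {
  pc_bounded : forall a b, E0 a b -> Cmod a <= 200 /\ Cmod b <= 200;
  pc_compact : forall u v : nat -> C, (forall k, E0 (u k) (v k)) ->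
    exists a b phi, (forall j, (j <= phi j)%nat) /\ E0 a b /\
      cv (fun j => u (phi j)) a /\ cv (fun j => v (phi j)) b;
  pc_chain : forall eta, 0 < eta -> exists delta, 0 < delta /\
    forall p q, chain (fun p => E0 (fst p) (snd p)) dist2 delta p q -> dist2 p q < eta;
  pc_notin : ~ E0 (RtoC 0) (RtoC 1);
  pc_hull : forall N p M, (3 <= N)%nat -> is_poly N p ->
    (forall a b, E0 a b -> Cmod (p (pt3 a b (RtoC 0))) <= M) ->
    Cmod (p (pt3 (RtoC 0) (RtoC 1) (RtoC 0))) <= M }.

Lemma agree_trans {A} k (s t r : nat -> A) : agree k s t -> agree k t r -> agree k s r.
Proof. intros H1 H2 i Hi. rewrite H1, H2; auto. Qed.

Lemma uniform_index (P : nat -> nat -> Prop) : (forall i, exists J, forall j, (J <= j)%nat -> P i j) ->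
  forall k, exists J, forall i j, (i < k)%nat -> (J <= j)%nat -> P i j.
Proof.
  intros H. induction k as [|k [J HJ]].
  - exists O. intros; lia.
  - destruct (H k) as [J' HJ']. exists (J + J')%nat. intros i j Hi Hj.
    destruct (Nat.eq_dec i k) as [->|]; [apply HJ' | apply HJ]; lia.
Qed.

Lemma planar_cantor_exists : exists E0, planar_cantor E0.
Proof.
  destruct code_limits as (X & F & XF).
  pose (E0 := fun a b => exists s, a = F s /\ b = (X s * F s)%C).
  pose proof (X_bound X F XF) as HX. pose proof (F_bound X F XF) as HF.
  pose proof (agree_close X F XF) as Hag.
  (* [1465 = 208 + 3/2 * 208 + 105 * 9], from the two coordinates. *)
  assert (Hag2 : forall k s t, agree k s t ->
            dist2 (F s, X s * F s)%C (F t, X t * F t)%C <= 1465 * (3 / 4) ^ k).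
  { intros k s t H. destruct (Hag k s t H) as [H1 H2]. unfold dist2; simpl.
    pose proof (prod_diff_bound (X s) (F s) (X t) (F t) _ _ (HX s) (HF t)).
    pose proof (third_le k). lra. }
  exists E0. split.
  - intros a b (s & -> & ->). pose proof (HF s). pose proof (XF_bound X F XF s). lra.
  - intros u v Huv. destruct (choice _ Huv) as [s Hs].
    destruct (bounded_complex_subseq (fun k => X (s k)) (3 / 2)) as (x & phi & Hphi & Hx).
    { intros; apply HX. }
    (* By [X_gap], convergence of the points [X] forces every digit to become constant; the limit
       code [s0] is read off digit by digit. *)
    assert (HJ : forall i, exists J, forall j, (J <= j)%nat -> agree (S i) (s (phi J)) (s (phi j))).
    { intros i. destruct (Hx ((1 / 3) ^ S i / 2)) as [J HJ].
      { apply Rdiv_lt_0_compat; [apply pow_lt|]; lra. }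
      exists J. intros j Hj. apply (X_gap X F XF).
      pose proof (Cmod_sub_tri (X (s (phi J))) x (X (s (phi j)))).
      rewrite (Cmod_sub_sym x (X (s (phi j)))) in H.
      pose proof (HJ J (le_n _)). pose proof (HJ j Hj). lra. }
    destruct (choice _ HJ) as [J HJ'].
    set (s0 := fun i => s (phi (J i)) i).
    assert (Hs0 : forall k, exists J, forall j, (J <= j)%nat -> agree k s0 (s (phi j))).
    { intros k.
      assert (Hi : forall i, exists J, forall j, (J <= j)%nat -> s0 i = s (phi j) i).
      { intros i. exists (J i). intros j Hj. apply (HJ' i j Hj i). lia. }
      destruct (uniform_index _ Hi k) as [J' HJ2].
      exists J'. intros j Hj i Hik. apply HJ2; auto. }
    assert (Hcv : forall eps, 0 < eps -> exists J, forall j, (J <= j)%nat ->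
              dist2 (u (phi j), v (phi j)) (F s0, X s0 * F s0)%C < eps).
    { intros eps He. destruct (pow_small (3 / 4) (eps / 1465)) as [k Hk]; [lra | lra|].
      destruct (Hs0 k) as [J' HJ2]. exists J'. intros j Hj.
      destruct (Hs (phi j)) as [-> ->]. rewrite dist2_sym.
      eapply Rle_lt_trans; [apply (Hag2 k); auto|]. specialize (Hk k (le_n _)). lra. }
    exists (F s0), (X s0 * F s0)%C, phi. split; auto. split; [exists s0; auto|].
    split; intros eps He; destruct (Hcv eps He) as [J' HJ2]; exists J'; intros j Hj;
      specialize (HJ2 j Hj); unfold dist2 in HJ2; simpl in HJ2.
    + pose proof (Cmod_ge_0 (v (phi j) - X s0 * F s0)). lra.
    + pose proof (Cmod_ge_0 (u (phi j) - F s0)). lra.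
  - intros eta Heta. set (xi := eta / 20). assert (Hxi : 0 < xi) by (unfold xi; lra).
    destruct (pow_small (3 / 4) (xi / 2 / 1465)) as [k Hk]; [lra | lra|]. specialize (Hk k (le_n _)).
    set (delta := xi * (1 / 3) ^ k / 3).
    assert (Hp : 0 < (1 / 3) ^ k) by (apply pow_lt; lra).
    assert (Hdelta : 0 < delta) by (unfold delta; apply Rdiv_lt_0_compat; [nra | lra]).
    exists delta. split; auto.
    set (S0 := fun p : C * C => E0 (fst p) (snd p)).
    (* Where [F] is not small, [X] is the quotient of the two coordinates, so a short step moves [X]
       by less than [(1/3) ^ k] and preserves [k] digits. *)
    assert (Hstep : forall s t, xi <= Cmod (F s) ->
              dist2 (F s, X s * F s)%C (F t, X t * F t)%C < delta -> agree k s t).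
    { intros s t Hs Hd. apply (X_gap X F XF). unfold dist2 in Hd; simpl in Hd.
      pose proof (Cmod_ge_0 (X s * F s - X t * F t)). pose proof (Cmod_ge_0 (F s - F t)).
      assert (Cmod (X s - X t) * Cmod (F s) < 3 * delta).
      { rewrite <- Cmod_mult.
        replace ((X s - X t) * F s)%C with ((X s * F s - X t * F t) - X t * (F s - F t))%C by ring.
        eapply Rle_lt_trans; [apply Cmod_sub_le|]. rewrite Cmod_mult. specialize (HX t).
        assert (Cmod (X t) * Cmod (F s - F t) <= 3 / 2 * Cmod (F s - F t))
          by (apply Rmult_le_compat_r; lra). lra. }
      apply Rmult_lt_reg_r with xi; auto.
      apply Rle_lt_trans with (Cmod (X s - X t) * Cmod (F s)).
      - apply Rmult_le_compat_l; auto. apply Cmod_ge_0.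
      - unfold delta in *. lra. }
    (* The lower bound needed by [Hstep] persists along the chain: among codes with the same [k]
       digits, [F] varies by less than [xi]. *)
    assert (Hbig : forall p q s, chain S0 dist2 delta p q -> p = (F s, X s * F s)%C ->
              2 * xi <= Cmod (F s) -> exists t, q = (F t, X t * F t)%C /\ agree k s t).
    { intros p q s H Hs Hb. induction H as [|y z H IH Hz Hyz].
      - exists s. split; auto. intros i _; auto.
      - destruct (IH) as (t & -> & Ht). destruct Hz as (r & Hr1 & Hr2).
        exists r. split; [destruct z; simpl in *; congruence|].
        apply agree_trans with t; auto. apply Hstep.
        + destruct (Hag k s t Ht) as [_ H2]. pose proof (Cmod_le_add (F s) (F t)). lra.
        + replace (F r, X r * F r)%C with z; auto. destruct z; simpl in *; congruence. }
    assert (Hbig' : forall p q, chain S0 dist2 delta p q -> 2 * xi <= Cmod (fst p) -> dist2 p q < eta).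
    { intros p q H Hb. destruct (chain_start _ _ _ _ _ _ H) as (s & Hs1 & Hs2).
      assert (p = (F s, X s * F s)%C) as -> by (destruct p; simpl in *; congruence).
      destruct (Hbig _ _ s H eq_refl Hb) as (t & -> & Ht).
      eapply Rle_lt_trans; [apply (Hag2 k); auto|]. unfold xi in *. lra. }
    intros p q H.
    destruct (Rle_lt_dec (2 * xi) (Cmod (fst p))) as [Hle|Hlt]; [apply Hbig'; auto|].
    destruct (Rle_lt_dec (2 * xi) (Cmod (fst q))) as [Hle'|Hlt'].
    + rewrite dist2_sym. apply Hbig'; auto. apply chain_sym; auto. apply dist2_sym.
    + destruct (chain_start _ _ _ _ _ _ H) as (s & Hs1 & Hs2).
      destruct (chain_end _ _ _ _ _ _ H) as (t & Ht1 & Ht2).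
      unfold dist2. rewrite Hs2, Ht2, Hs1, Ht1 in *.
      pose proof (Cmod_sub_le (F s) (F t)). pose proof (Cmod_sub_le (X s * F s) (X t * F t)).
      rewrite !Cmod_mult in *.
      assert (Cmod (X s) * Cmod (F s) <= 3 / 2 * Cmod (F s))
        by (apply Rmult_le_compat_r; [apply Cmod_ge_0 | apply HX]).
      assert (Cmod (X t) * Cmod (F t) <= 3 / 2 * Cmod (F t))
        by (apply Rmult_le_compat_r; [apply Cmod_ge_0 | apply HX]).
      unfold xi in *. lra.
  - intros (s & Hs1 & Hs2). rewrite <- Hs1 in Hs2. rewrite Cmult_0_r in Hs2.
    apply RtoC_inj in Hs2. lra.
  - intros N p M HN Hp HM. apply (code_hull_infinity X F XF N p M HN Hp).
    intros s. apply HM. exists s; auto.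
Qed.

(** * The tower of square roots *)

Definition hull3 (N : nat) (A : C -> C -> C -> Prop) (a b w : C) : Prop :=
  forall p, is_poly N p -> forall M, (forall a' b' w', A a' b' w' -> Cmod (p (pt3 a' b' w')) <= M) ->
    Cmod (p (pt3 a b w)) <= M.

Lemma not_hull3_peak N A a b w : ~ hull3 N A a b w -> exists P theta, is_poly N P /\ 0 <= theta < 1 /\
  (forall a' b' w', A a' b' w' -> Cmod (P (pt3 a' b' w')) <= theta) /\ P (pt3 a b w) = RtoC 1 :> C.
Proof.
  intros H. apply not_all_ex_not in H as [p H]. apply imply_to_and in H as [Hp H].
  apply not_all_ex_not in H as [M H]. apply imply_to_and in H as [HM H]. apply Rnot_le_lt in H.
  destruct (classic (exists a' b' w', A a' b' w')) as [(a' & b' & w' & HA)|HA].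
  - assert (HM0 : 0 <= M) by (eapply Rle_trans; [apply Cmod_ge_0 | apply HM; eauto]).
    set (v := p (pt3 a b w) : C) in *. change (M < Cmod v) in H.
    assert (Hv : v <> RtoC 0) by (apply Cmod_pos_neq; lra).
    exists (fun x => / v * p x)%C, (M / Cmod v). split.
    { apply poly_times; auto. apply poly_cst. }
    split.
    { split; [apply Rmult_le_pos; auto; left; apply Rinv_0_lt_compat; lra|].
      apply Rmult_lt_reg_r with (Cmod v); [lra|]. unfold Rdiv. rewrite Rmult_assoc, Rinv_l; lra. }
    split.
    + intros x y z Hxyz. rewrite Cmod_mult, Cmod_inv by auto. unfold Rdiv. rewrite Rmult_comm.
      apply Rmult_le_compat_r; [left; apply Rinv_0_lt_compat; lra|]. apply HM; auto.
    + change (/ v * v = RtoC 1)%C. field. auto.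
  - exists (fun _ => RtoC 1), 0. split; [apply poly_cst|]. split; [lra|]. split; auto.
    intros x y z Hxyz. exfalso. apply HA. eauto.
Qed.

(** Even and odd parts in [y]: with [y' = (y * y - r) / c], polynomials upstairs are generated by 1
    and [y] over those in [(a, b, y')], and a product of two odd parts is rewritten by
    [y * y = r + c * y']. *)
Lemma even_odd_split N (r : C -> C -> C) (c : C) p : (3 <= N)%nat -> c <> RtoC 0 ->
  is_poly N (fun v => r (v 0%nat) (v 1%nat)) -> is_poly N p ->
  exists q0 q1, is_poly N q0 /\ is_poly N q1 /\ forall a b y,
    (p (pt3 a b y) = q0 (pt3 a b ((y * y - r a b) / c)) + y * q1 (pt3 a b ((y * y - r a b) / c)) :> C)%C.
Proof.
  intros HN Hc Hr. induction 1 as [x | i Hi | p q Hp IHp Hq IHq | p q Hp IHp Hq IHq].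
  - exists (fun _ => x), (fun _ => RtoC 0). split; [apply poly_cst|]. split; [apply poly_cst|].
    intros. cring.
  - destruct (Nat.eq_dec i 2) as [->|Hi2].
    + exists (fun _ => RtoC 0), (fun _ => RtoC 1). split; [apply poly_cst|]. split; [apply poly_cst|].
      intros. simpl. cring.
    + exists (fun v => v i), (fun _ => RtoC 0). split; [apply poly_coord; auto|].
      split; [apply poly_cst|]. intros. destruct i as [|[|[|i]]]; [..|congruence|]; simpl; cring.
  - destruct IHp as (p0 & p1 & P0 & P1 & HP). destruct IHq as (q0 & q1 & Q0 & Q1 & HQ).
    exists (fun v => p0 v + q0 v)%C, (fun v => p1 v + q1 v)%C.
    split; [apply poly_plus; auto|]. split; [apply poly_plus; auto|].
    intros. rewrite CaddE, HP, HQ. cring.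
  - destruct IHp as (p0 & p1 & P0 & P1 & HP). destruct IHq as (q0 & q1 & Q0 & Q1 & HQ).
    exists (fun v => p0 v * q0 v + (r (v 0%nat) (v 1%nat) + c * v 2%nat) * (p1 v * q1 v))%C,
      (fun v => p0 v * q1 v + p1 v * q0 v)%C.
    assert (is_poly N (fun v => v 2%nat)) by (apply poly_coord; lia).
    split; [repeat first [apply poly_plus | apply poly_times | apply poly_cst | assumption]|].
    split; [repeat first [apply poly_plus | apply poly_times | assumption]|].
    intros a b y. rewrite CmulE, HP, HQ. set (v := pt3 a b ((y * y - r a b) / c)%C).
    replace (r (v 0%nat) (v 1%nat) + c * v 2%nat)%C with (y * y)%C by (unfold v; simpl; field; auto).
    cring.
Qed.

(** If neither root lay in the hull, peak polynomials [P] at [s] and [Q] at [- s] could be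
    interpolated to a polynomial equal to 1 at both roots and small on the set upstairs. Its even
    part, the average over the roots, descends to the base; it is 1 at [y'] and stays below 1 on
    [A], a contradiction. *)
Lemma hull3_lift N (A : C -> C -> C -> Prop) (r : C -> C -> C) (c : C) B a b y' :
  (3 <= N)%nat -> c <> RtoC 0 -> is_poly N (fun v => r (v 0%nat) (v 1%nat)) ->
  (forall a b y, A a b ((y * y - r a b) / c)%C -> Cmod y <= B) ->
  hull3 N A a b y' ->
  exists y, (y * y = r a b + c * y')%C /\ hull3 N (fun a b y => A a b ((y * y - r a b) / c)%C) a b y.
Proof.
  intros HN Hc Hr HB Hy'.
  set (A' := fun a b y => A a b ((y * y - r a b) / c)%C).
  destruct (C_sqrt_ex (r a b + c * y')%C) as [s Hs].
  assert (Hbase : forall t, (t * t = s * s)%C -> ((t * t - r a b) / c)%C = y').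
  { intros t Ht. rewrite Ht, Hs. field. auto. }
  assert (H2 : RtoC 2 <> RtoC 0) by (intros E; apply RtoC_inj in E; lra).
  assert (Hno : forall q theta, is_poly N q -> theta < 1 ->
            (forall a b y, A' a b y -> Cmod (q (pt3 a b y)) <= theta) ->
            q (pt3 a b s) = RtoC 1 :> C -> q (pt3 a b (- s)%C) = RtoC 1 :> C -> False).
  { intros q theta Hq Ht Hb E1 E2.
    destruct (even_odd_split N r c q HN Hc Hr Hq) as (q0 & q1 & Q0 & Q1 & HQ).
    assert (E0 : q0 (pt3 a b y') = RtoC 1 :> C).
    { rewrite HQ in E1, E2. rewrite Hbase in E1 by reflexivity. rewrite Hbase in E2 by ring.
      assert (E : (RtoC 2 * q0 (pt3 a b y') = RtoC 2 * RtoC 1)%C).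
      { replace (RtoC 2 * RtoC 1)%C with (RtoC 1 + RtoC 1)%C
          by (rewrite <- RtoC_mult, <- RtoC_plus; f_equal; lra).
        rewrite <- E1 at 1. rewrite <- E2. replace (RtoC 2) with (RtoC 1 + RtoC 1)%C
          by (rewrite <- RtoC_plus; f_equal; lra). ring. }
      replace (q0 (pt3 a b y') : C) with (/ RtoC 2 * (RtoC 2 * q0 (pt3 a b y')))%C by (field; auto).
      rewrite E. field. }
    assert (Cmod (q0 (pt3 a b y')) <= theta).
    { apply (Hy' q0 Q0). intros a1 b1 v Hv.
      destruct (C_sqrt_ex (r a1 b1 + c * v)%C) as [y Hyy].
      assert (Hb1 : forall t, (t * t = y * y)%C -> ((t * t - r a1 b1) / c)%C = v).
      { intros t Htt. rewrite Htt, Hyy. field. auto. }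
      assert (B1 : A' a1 b1 y) by (unfold A'; rewrite Hb1; auto).
      assert (B2 : A' a1 b1 (- y)%C) by (unfold A'; rewrite Hb1; auto; ring).
      apply Hb in B1. apply Hb in B2.
      rewrite HQ in B1, B2. rewrite Hb1 in B1 by reflexivity. rewrite Hb1 in B2 by ring.
      set (u := q0 (pt3 a1 b1 v) : C) in *. set (u' := q1 (pt3 a1 b1 v) : C) in *.
      change (Cmod u <= theta).
      assert (2 * Cmod u <= 2 * theta); [|lra].
      replace (2 * Cmod u) with (Cmod (RtoC 2 * u)) by (rewrite Cmod_mult, Cmod_R, Rabs_pos_eq; lra).
      replace (RtoC 2 * u)%C with ((u + y * u') + (u + - y * u'))%C.
      - eapply Rle_trans; [apply Cmod_triangle | lra].
      - replace (RtoC 2) with (RtoC 1 + RtoC 1)%C by (rewrite <- RtoC_plus; f_equal; lra). ring. }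
    rewrite E0, Cmod_1 in H. lra. }
  destruct (classic (hull3 N A' a b s)) as [|N1]; [exists s; auto|].
  destruct (classic (hull3 N A' a b (- s)%C)) as [|N2].
  { exists (- s)%C. split; auto. rewrite <- Hs. ring. }
  exfalso.
  destruct (not_hull3_peak _ _ _ _ _ N1) as (P & th1 & HP & Ht1 & HPb & HPs).
  destruct (not_hull3_peak _ _ _ _ _ N2) as (Q & th2 & HQ & Ht2 & HQb & HQs).
  (* For a double root [P] alone serves; the interpolation weights below divide by [s]. *)
  destruct (classic (s = RtoC 0)) as [Hs0|Hs0].
  { apply (Hno P th1); auto; [lra|]. replace (- s)%C with s; auto. rewrite Hs0. ring. }
  set (th := Rmax th1 th2).
  assert (Hth : 0 <= th < 1).
  { split; [unfold th; eapply Rle_trans; [apply Ht1 | apply Rmax_l]|].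
    unfold th. apply Rmax_lub_lt; lra. }
  pose proof (proj1 (Cmod_gt_0 s) Hs0) as Hsp.
  (* [D] bounds the weights [1 + y / s] and [1 - y / s] on the set upstairs, where [|y| <= B]; the
     power [k] then makes each of the two summands at most 1/4. *)
  set (D := 1 + Rabs B / Cmod s). assert (HD : 1 <= D).
  { unfold D. assert (0 <= Rabs B / Cmod s)
      by (apply Rmult_le_pos; [apply Rabs_pos | left; apply Rinv_0_lt_compat; auto]). lra. }
  destruct (pow_small th (/ (2 * D)) Hth) as [k Hk].
  { apply Rinv_0_lt_compat. lra. }
  specialize (Hk k (le_n _)).
  apply (Hno (fun v => / RtoC 2 * (RtoC 1 + / s * v 2%nat) * P v ^ k
                       + / RtoC 2 * (RtoC 1 - / s * v 2%nat) * Q v ^ k)%C (1 / 2)).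
  - assert (is_poly N (fun v => v 2%nat)) by (apply poly_coord; lia).
    repeat first [apply poly_minus | apply poly_plus | apply poly_times | apply poly_cst
                  | apply poly_pow | assumption].
  - lra.
  - intros a1 b1 y Hy. cbn [pt3].
    pose proof (HB _ _ _ Hy) as HyB. specialize (HPb _ _ _ Hy). specialize (HQb _ _ _ Hy).
    set (p1 := P (pt3 a1 b1 y) : C) in *. set (q1 := Q (pt3 a1 b1 y) : C) in *.
    change (Cmod p1 <= th1) in HPb. change (Cmod q1 <= th2) in HQb.
    change (Cmod (/ RtoC 2 * (RtoC 1 + / s * y) * p1 ^ k + / RtoC 2 * (RtoC 1 - / s * y) * q1 ^ k) <= 1 / 2).
    assert (Hq : forall z, Cmod (/ RtoC 2 * z) = Cmod z / 2).
    { intros z. rewrite Cmod_mult, Cmod_inv, Cmod_R, Rabs_pos_eq by (auto; lra). lra. }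
    assert (Hys : Cmod (/ s * y) <= Rabs B / Cmod s).
    { rewrite Cmod_mult, Cmod_inv by auto. unfold Rdiv. rewrite Rmult_comm.
      apply Rmult_le_compat_r; [left; apply Rinv_0_lt_compat; auto|].
      eapply Rle_trans; [apply HyB | apply Rle_abs]. }
    pose proof (Cmod_triangle (RtoC 1) (/ s * y)) as T1. pose proof (Cmod_sub_le (RtoC 1) (/ s * y)) as T2.
    rewrite Cmod_1 in T1, T2.
    assert (Hpk : Cmod p1 ^ k <= th ^ k).
    { apply pow_incr. split; [apply Cmod_ge_0|]. eapply Rle_trans; [apply HPb | apply Rmax_l]. }
    assert (Hqk : Cmod q1 ^ k <= th ^ k).
    { apply pow_incr. split; [apply Cmod_ge_0|]. eapply Rle_trans; [apply HQb | apply Rmax_r]. }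
    eapply Rle_trans; [apply Cmod_triangle|]. rewrite (Cmod_mult _ (p1 ^ k)), (Cmod_mult _ (q1 ^ k)).
    rewrite !Hq, !Cmod_pow.
    assert (K1 : Cmod (RtoC 1 + / s * y) * Cmod p1 ^ k <= D * th ^ k).
    { apply Rmult_le_compat; auto; [apply Cmod_ge_0 | apply pow_le, Cmod_ge_0 | unfold D; lra]. }
    assert (K2 : Cmod (RtoC 1 - / s * y) * Cmod q1 ^ k <= D * th ^ k).
    { apply Rmult_le_compat; auto; [apply Cmod_ge_0 | apply pow_le, Cmod_ge_0 | unfold D; lra]. }
    assert (D * th ^ k <= 1 / 2).
    { apply Rle_trans with (D * / (2 * D)); [apply Rmult_le_compat_l; lra | right; field; lra]. }
    lra.
  - change (/ RtoC 2 * (RtoC 1 + / s * s) * P (pt3 a b s) ^ k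
            + / RtoC 2 * (RtoC 1 - / s * s) * Q (pt3 a b s) ^ k = RtoC 1)%C.
    rewrite HPs, Cpow_1_l.
    replace (/ s * s)%C with (RtoC 1) by (field; auto).
    replace (RtoC 1 + RtoC 1)%C with (RtoC 2) by (rewrite <- RtoC_plus; f_equal; lra). field; auto.
  - change (/ RtoC 2 * (RtoC 1 + / s * - s) * P (pt3 a b (- s)) ^ k
            + / RtoC 2 * (RtoC 1 - / s * - s) * Q (pt3 a b (- s)) ^ k = RtoC 1)%C.
    rewrite HQs, Cpow_1_l.
    replace (/ s * - s)%C with (- RtoC 1)%C by (field; auto).
    replace (RtoC 1 - - RtoC 1)%C with (RtoC 2) by (rewrite <- RtoC_opp, <- RtoC_minus; f_equal; lra).
    field; auto.
Qed.

Section Tower.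

Variable al : nat -> C.
Hypothesis al_bound : forall j, Cmod (al j) <= 201.

(** The square root is [(1/2) ^ (2 ^ j)]: decay at this doubly exponential rate survives the
    repeated square roots taken on the way down the tower. *)
Definition scale (j : nat) : R := (1 / 4) ^ (2 ^ j).

Definition branch (j : nat) (a b : C) : C := ((if Nat.even j then a else b) - al j)%C.

(** [tower j 0] is [y_j]. The offset [s] is there because a lift to a double cover inserts a level
    before the first one; [tower_succ] gives the recursion at the other end. *)
Fixpoint tower (k s : nat) (a b w : C) : C :=
  match k with
  | O => w
  | S k => tower k (S s) a b ((w * w - branch s a b) / RtoC (scale s))%C
  end.

Lemma scale_pos j : 0 < scale j.
Proof. apply pow_lt. lra. Qed.

Lemma scale_le_1 j : scale j <= 1.
Proof. apply Rle_trans with (1 ^ (2 ^ j)); [apply pow_incr; lra | rewrite pow1; lra]. Qed.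

Lemma scale_neq0 j : RtoC (scale j) <> RtoC 0.
Proof. intros E. apply RtoC_inj in E. pose proof (scale_pos j). lra. Qed.

Lemma Cmod_scale j z : Cmod (RtoC (scale j) * z) = scale j * Cmod z.
Proof. rewrite Cmod_mult, Cmod_R, Rabs_pos_eq; auto. left; apply scale_pos. Qed.

Lemma tower_succ k : forall s a b w, tower (S k) s a b w =
  ((tower k s a b w * tower k s a b w - branch (s + k) a b) / RtoC (scale (s + k)))%C.
Proof.
  induction k; intros s a b w.
  - simpl. rewrite Nat.add_0_r. reflexivity.
  - change (tower (S (S k)) s a b w) with
      (tower (S k) (S s) a b ((w * w - branch s a b) / RtoC (scale s))%C).
    rewrite IHk. replace (s + S k)%nat with (S s + k)%nat by lia. reflexivity.
Qed.

Lemma tower_square k a b w :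
  (tower k 0 a b w * tower k 0 a b w = branch k a b + RtoC (scale k) * tower (S k) 0 a b w)%C.
Proof. rewrite tower_succ. simpl (0 + k)%nat. field. apply scale_neq0. Qed.

Lemma poly_branch N j : (3 <= N)%nat -> is_poly N (fun v => branch j (v 0%nat) (v 1%nat)).
Proof.
  intros HN. unfold branch. apply poly_minus; [|apply poly_cst].
  destruct (Nat.even j); apply poly_coord; lia.
Qed.

Lemma poly_tower N k : (3 <= N)%nat -> forall s g, is_poly N g ->
  is_poly N (fun v => tower k s (v 0%nat) (v 1%nat) (g v)).
Proof.
  intros HN. induction k; intros s g Hg; simpl; auto.
  apply (IHk (S s) (fun v => (g v * g v - branch s (v 0%nat) (v 1%nat)) / RtoC (scale s))%C).
  apply poly_times; [|apply poly_cst]. apply poly_minus; [apply poly_times; auto|].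
  apply poly_branch; auto.
Qed.

Lemma poly_tower0 N k : (3 <= N)%nat ->
  is_poly N (fun v => tower k 0 (v 0%nat) (v 1%nat) (v 2%nat)).
Proof. intros HN. apply (poly_tower N k HN 0 (fun v => v 2%nat)). apply poly_coord. lia. Qed.

Lemma branch_bound j a b : Cmod a <= 200 -> Cmod b <= 200 -> Cmod (branch j a b) <= 401.
Proof.
  intros Ha Hb. unfold branch.
  pose proof (Cmod_sub_le (if Nat.even j then a else b) (al j)). specialize (al_bound j).
  destruct (Nat.even j); lra.
Qed.

Lemma branch_diff j a b a' b' :
  Cmod (branch j a b - branch j a' b') <= Cmod (a - a') + Cmod (b - b').
Proof.
  unfold branch. pose proof (Cmod_ge_0 (a - a')). pose proof (Cmod_ge_0 (b - b')).
  destruct (Nat.even j).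
  - replace (a - al j - (a' - al j))%C with (a - a')%C by ring. lra.
  - replace (b - al j - (b' - al j))%C with (b - b')%C by ring. lra.
Qed.

(** A bound at the top descends, since [|y_j|^2 <= 401 + 100] is far below [100 ^ 2]. So a finite
    stage is controlled by its last level. *)
Lemma tower_bound k : forall s a b w, Cmod a <= 200 -> Cmod b <= 200 ->
  Cmod (tower k s a b w) <= 100 -> forall j, (j <= k)%nat -> Cmod (tower j s a b w) <= 100.
Proof.
  induction k; intros s a b w Ha Hb H j Hj.
  - replace j with O by lia. exact H.
  - simpl in H. pose proof (IHk (S s) a b _ Ha Hb H) as IH.
    destruct j; [|apply IH; lia].
    specialize (IH O ltac:(lia)). simpl in *.
    set (w' := ((w * w - branch s a b) / RtoC (scale s))%C) in *.
    assert (E : (w * w = branch s a b + RtoC (scale s) * w')%C).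
    { unfold w'. field. apply scale_neq0. }
    assert (Cmod w * Cmod w <= 501).
    { rewrite <- Cmod_mult, E. pose proof (Cmod_triangle (branch s a b) (RtoC (scale s) * w')).
      rewrite Cmod_scale in H0. pose proof (branch_bound s a b Ha Hb).
      pose proof (scale_le_1 s). pose proof (scale_pos s). pose proof (Cmod_ge_0 w'). nra. }
    pose proof (Cmod_ge_0 w). nra.
Qed.

Variable E0 : C -> C -> Prop.
Hypothesis HE0 : planar_cantor E0.

Definition Etower (a b w : C) : Prop := E0 a b /\ forall j, Cmod (tower j 0 a b w) <= 100.

Lemma Etower_bounds a b w : Etower a b w -> Cmod a <= 200 /\ Cmod b <= 200 /\ Cmod w <= 200.
Proof.
  intros [H1 H2]. destruct (pc_bounded _ HE0 _ _ H1). specialize (H2 O). simpl in H2. lra.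
Qed.

(** With the top value set to 0, the lifting starts from the copy of [E0] at third coordinate 0,
    whose hull contains [(0, 1, 0)], and is repeated [k] times. *)
Lemma hull3_tower N k : (3 <= N)%nat -> forall s,
  exists w, hull3 N (fun a b w => E0 a b /\ tower k s a b w = RtoC 0) (RtoC 0) (RtoC 1) w.
Proof.
  intros HN. induction k; intros s.
  - exists (RtoC 0). intros p Hp M HM. apply (pc_hull _ HE0 N p M HN Hp).
    intros a b Hab. apply HM. simpl. auto.
  - destruct (IHk (S s)) as [w' Hw'].
    assert (HB : forall a b y, E0 a b /\ tower k (S s) a b ((y * y - branch s a b) / RtoC (scale s))%C = RtoC 0 ->
              Cmod y <= 100).
    { intros a b y [H1 H2]. destruct (pc_bounded _ HE0 _ _ H1).
      apply (tower_bound (S k) s a b y) with (j := O); auto; [|lia].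
      simpl. rewrite H2, Cmod_0. lra. }
    destruct (hull3_lift N (fun a b w => E0 a b /\ tower k (S s) a b w = RtoC 0) (branch s)
                (RtoC (scale s)) 100 _ _ _ HN (scale_neq0 s) (poly_branch N s HN) HB Hw')
      as (y & _ & Hy).
    exists y. exact Hy.
Qed.

Lemma poly_cv3 N p (a b w : nat -> C) a0 b0 w0 B : (3 <= N)%nat -> is_poly N p -> 0 <= B ->
  (forall j, Cmod (a j) <= B /\ Cmod (b j) <= B /\ Cmod (w j) <= B) ->
  cv a a0 -> cv b b0 -> cv w w0 ->
  cv (fun j => p (pt3 (a j) (b j) (w j))) (p (pt3 a0 b0 w0)).
Proof.
  intros HN Hp HB Hb Ha Hbb Hw.
  destruct (poly_bounded_lipschitz3 N p (B + 1) HN Hp ltac:(lra)) as (L & HL & HLip).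
  intros eps He.
  set (d := Rmin 1 (eps / (3 * L))).
  assert (Hd0 : 0 < eps / (3 * L)) by (apply Rdiv_lt_0_compat; lra).
  assert (Hd : 0 < d) by (apply Rmin_pos; lra).
  assert (Hd1 : d <= 1) by apply Rmin_l. assert (Hd2 : d <= eps / (3 * L)) by apply Rmin_r.
  destruct (Ha d Hd) as [J1 H1]. destruct (Hbb d Hd) as [J2 H2]. destruct (Hw d Hd) as [J3 H3].
  exists (J1 + J2 + J3)%nat. intros j Hj.
  specialize (H1 j ltac:(lia)). specialize (H2 j ltac:(lia)). specialize (H3 j ltac:(lia)).
  destruct (Hb j) as (B1 & B2 & B3).
  pose proof (Cmod_le_add a0 (a j)). pose proof (Cmod_le_add b0 (b j)). pose proof (Cmod_le_add w0 (w j)).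
  rewrite (Cmod_sub_sym a0) in *. rewrite (Cmod_sub_sym b0) in *. rewrite (Cmod_sub_sym w0) in *.
  destruct (HLip (a j) (b j) (w j) a0 b0 w0) as [_ HD]; try lra.
  eapply Rle_lt_trans; [apply HD|]. unfold dist3.
  apply Rlt_le_trans with (L * (3 * (eps / (3 * L)))); [|right; field; lra].
  apply Rmult_lt_compat_l; lra.
Qed.

Lemma cv_bound u l B : cv u l -> (forall J, exists j, (J <= j)%nat /\ Cmod (u j) <= B) -> Cmod l <= B.
Proof.
  intros Hu H. replace l with (l - RtoC 0)%C by ring. apply cv_Cmod_le with (1 := Hu).
  intros J. destruct (H J) as (j & Hj & Hb). exists j. split; auto.
  replace (u j - RtoC 0)%C with (u j) by ring. auto.
Qed.

Lemma cv_bound_below u l B : cv u l -> (forall J, exists j, (J <= j)%nat /\ B <= Cmod (u j)) -> B <= Cmod l.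
Proof.
  intros Hu H. apply Rnot_lt_le. intros Hlt. destruct (Hu (B - Cmod l)) as [J HJ]; [lra|].
  destruct (H J) as (j & Hj & Hb). specialize (HJ j Hj). pose proof (Cmod_le_add (u j) l). lra.
Qed.

(** The [k]-th point has to satisfy only the first bounds, up to level [k]: the statement then
    serves both the compactness of the tower and the passage to the limit from the finite stages. *)
Lemma Etower_limit (a b w : nat -> C) : (forall k, E0 (a k) (b k)) ->
  (forall j k, (j <= k)%nat -> Cmod (tower j 0 (a k) (b k) (w k)) <= 100) ->
  exists a0 b0 w0 phi, (forall j, (j <= phi j)%nat) /\ Etower a0 b0 w0 /\
    cv (fun j => a (phi j)) a0 /\ cv (fun j => b (phi j)) b0 /\ cv (fun j => w (phi j)) w0.
Proof.
  intros H0 Ht.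
  destruct (pc_compact _ HE0 a b H0) as (a0 & b0 & phi & Hphi & Hab & Ha & Hb).
  destruct (bounded_complex_subseq (fun j => w (phi j)) 100) as (w0 & psi & Hpsi & Hw).
  { intros k. apply (Ht O). lia. }
  exists a0, b0, w0, (fun j => phi (psi j)).
  assert (Hle : forall j, (j <= phi (psi j))%nat).
  { intros j. specialize (Hpsi j). specialize (Hphi (psi j)). lia. }
  pose proof (cv_sub _ _ psi Hpsi Ha) as Ha'. pose proof (cv_sub _ _ psi Hpsi Hb) as Hb'.
  split; auto. split; auto. split; auto.
  intros j. pose proof (poly_tower0 3 j (le_n _)) as Hp.
  refine (cv_bound _ _ _ (poly_cv3 3 _ _ _ _ a0 b0 w0 200 (le_n _) Hp _ _ Ha' Hb' Hw) _).
  - lra.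
  - intros k. destruct (pc_bounded _ HE0 _ _ (H0 (phi (psi k)))).
    assert (Cmod (w (phi (psi k))) <= 100) by (apply (Ht O); lia). lra.
  - intros J. exists (J + j)%nat. split; [lia|]. simpl. apply Ht. specialize (Hle (J + j)%nat). lia.
Qed.

Lemma Etower_compact (a b w : nat -> C) : (forall k, Etower (a k) (b k) (w k)) ->
  exists a0 b0 w0 phi, (forall j, (j <= phi j)%nat) /\ Etower a0 b0 w0 /\
    cv (fun j => a (phi j)) a0 /\ cv (fun j => b (phi j)) b0 /\ cv (fun j => w (phi j)) w0.
Proof. intros H. apply Etower_limit; intros; apply H. Qed.

Lemma Etower_hull N : (3 <= N)%nat -> exists w, hull3 N Etower (RtoC 0) (RtoC 1) w.
Proof.
  intros HN.
  destruct (choice _ (fun k => hull3_tower N k HN 0)) as [w Hw].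
  set (A := fun k a b w => E0 a b /\ tower k 0 a b w = RtoC 0) in *.
  assert (HA : forall k a b w, A k a b w -> forall j, (j <= k)%nat -> Cmod (tower j 0 a b w) <= 100).
  { intros k a b v [H1 H2] j Hj. destruct (pc_bounded _ HE0 _ _ H1).
    apply tower_bound with k; auto. rewrite H2, Cmod_0. lra. }
  assert (Hb : forall k, Cmod (w k) <= 100).
  { intros k. apply (Hw k (fun v => v 2%nat) (poly_coord N 2 ltac:(lia)) 100).
    intros a b v Hv. apply (HA k a b v Hv O). lia. }
  destruct (bounded_complex_subseq w 100 Hb) as (w0 & phi & Hphi & Hcv).
  exists w0. intros p Hp M HM. apply Rnot_lt_le. intros Hlt.
  set (P := Cmod (p (pt3 (RtoC 0) (RtoC 1) w0))) in *. set (eps := (P - M) / 2).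
  assert (He : 0 < eps) by (unfold eps; lra).
  assert (Hcst : forall c : C, cv (fun _ => c) c).
  { intros c e He'. exists O. intros. replace (c - c)%C with (RtoC 0) by ring. rewrite Cmod_0. auto. }
  assert (Hpcv : cv (fun j => p (pt3 (RtoC 0) (RtoC 1) (w (phi j)))) (p (pt3 (RtoC 0) (RtoC 1) w0))).
  { apply (poly_cv3 N p (fun _ => RtoC 0) (fun _ => RtoC 1) (fun j => w (phi j))) with (B := 100); auto; try lra.
    intros j. rewrite Cmod_0, Cmod_1. specialize (Hb (phi j)). lra. }
  destruct (Hpcv eps He) as [J HJ].
  (* If [p] separated the limit from the tower, every late stage would contain a point with
     [|p| >= M + eps]; such points accumulate at a point of the tower. *)
  assert (Hex : forall k, exists q : C * C * C, A (phi (J + k)%nat) (fst (fst q)) (snd (fst q)) (snd q) /\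
            M + eps <= Cmod (p (pt3 (fst (fst q)) (snd (fst q)) (snd q)))).
  { intros k. apply NNPP. intros Hn.
    assert (Cmod (p (pt3 (RtoC 0) (RtoC 1) (w (phi (J + k)%nat)))) <= M + eps).
    { apply (Hw (phi (J + k)%nat) p Hp). intros a b v Hv. apply Rnot_lt_le. intros Hl.
      apply Hn. exists (a, b, v). split; auto. simpl. lra. }
    specialize (HJ (J + k)%nat ltac:(lia)).
    pose proof (Cmod_le_add (p (pt3 (RtoC 0) (RtoC 1) w0)) (p (pt3 (RtoC 0) (RtoC 1) (w (phi (J + k)%nat))))).
    rewrite (Cmod_sub_sym (p (pt3 (RtoC 0) (RtoC 1) w0))) in *. fold P in H0. unfold eps in *. lra. }
  destruct (choice _ Hex) as [q Hq].
  destruct (Etower_limit (fun k => fst (fst (q k))) (fun k => snd (fst (q k))) (fun k => snd (q k)))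
    as (a0 & b0 & v0 & psi & Hpsi & HE & Ca & Cb & Cw).
  { intros k. apply Hq. }
  { intros j k Hj. apply (HA _ _ _ _ (proj1 (Hq k))). specialize (Hphi (J + k)%nat). lia. }
  specialize (HM _ _ _ HE).
  assert (M + eps <= Cmod (p (pt3 a0 b0 v0))); [|lra].
  refine (cv_bound_below _ _ _ (poly_cv3 N p _ _ _ a0 b0 v0 200 HN Hp _ _ Ca Cb Cw) _).
  - lra.
  - intros j. destruct (Hq (psi j)) as [HAq _]. destruct (pc_bounded _ HE0 _ _ (proj1 HAq)).
    pose proof (HA _ _ _ _ HAq O ltac:(lia)) as HA0. simpl in HA0. lra.
  - intros J'. exists J'. split; auto. apply Hq.
Qed.

(** * Oscillation along chains over a small part of the base *)

Definition pt := (C * C * C)%type.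
Definition distp (e e' : pt) : R :=
  dist3 (fst (fst e)) (snd (fst e)) (snd e) (fst (fst e')) (snd (fst e')) (snd e').

Definition twp (j : nat) (e : pt) : C := tower j 0 (fst (fst e)) (snd (fst e)) (snd e).

(** Only bounds on polynomials, without membership of the base point in [E0]: this is what a hull
    inherits. *)
Definition in_tower (e : pt) : Prop :=
  Cmod (fst (fst e)) <= 200 /\ Cmod (snd (fst e)) <= 200 /\ forall j, Cmod (twp j e) <= 100.

(** [S] is arbitrary so that the estimate applies both to pieces of the tower and to a path that a
    disc would trace in a single fibre. *)
Definition small_oscillation (j : nat) (o : R) : Prop := exists delta, 0 < delta /\
  forall (S : pt -> Prop), (forall e, S e -> in_tower e) ->
    (forall e e', S e -> S e' -> dist2 (fst e) (fst e') < delta) ->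
    forall e e', chain S distp delta e e' -> Cmod (twp j e' - twp j e) <= o.

Lemma small_oscillation_trivial j : small_oscillation j 200.
Proof.
  exists 1. split; [lra|]. intros S HS _ e e' H.
  pose proof (proj2 (proj2 (HS _ (chain_start _ _ _ _ _ _ H))) j).
  pose proof (proj2 (proj2 (HS _ (chain_end _ _ _ _ _ _ H))) j).
  pose proof (Cmod_sub_le (twp j e') (twp j e)). lra.
Qed.

(* If [y^2] varies by [O(q^2)] along a chain with steps [O(q)], then so does [y] by [O(q)]:
   either [|y|] is [O(q)] throughout, or the two square roots are too far apart to jump. *)
Lemma small_oscillation_pred j o : 0 < o -> small_oscillation (S j) o ->
  small_oscillation j (6 * sqrt (scale j * o)).
Proof.
  intros Ho (d1 & Hd1 & H1). set (q := sqrt (scale j * o)).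
  pose proof (scale_pos j) as Hc.
  assert (Hq2 : q * q = scale j * o) by (apply sqrt_sqrt; apply Rmult_le_pos; lra).
  assert (Hq : 0 < q) by (apply sqrt_lt_R0, Rmult_lt_0_compat; lra).
  destruct (poly_bounded_lipschitz3 3 _ 200 (le_n _) (poly_tower0 3 j (le_n _)) ltac:(lra)) as (L & HL & HLip).
  set (d := Rmin d1 (Rmin (q * q * (4 / 10)) (q / L))).
  assert (A0 : 0 < q / L) by (apply Rdiv_lt_0_compat; lra).
  assert (A1 : 0 < q * q) by (apply Rmult_lt_0_compat; auto).
  assert (Hd : 0 < d) by (unfold d; repeat apply Rmin_pos; lra).
  assert (Hdd1 : d <= d1) by apply Rmin_l.
  assert (Hdd2 : d <= q * q * (4 / 10)) by (unfold d; eapply Rle_trans; [apply Rmin_r | apply Rmin_l]).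
  assert (Hdd3 : d <= q / L) by (unfold d; eapply Rle_trans; [apply Rmin_r | apply Rmin_r]).
  exists d. split; auto. intros S HS Hdiam e e' Hch.
  (* The product of the difference and the sum is at most [q^2] from the next level plus
     [4/10 * q^2] from the base, and the square root of 14/10 is below 12/10. *)
  assert (Hsq : forall e', chain S distp d e e' ->
            Cmod (twp j e' - twp j e) <= 12 / 10 * q \/ Cmod (twp j e' + twp j e) <= 12 / 10 * q).
  { intros e2 H2.
    assert (Cmod (twp (Datatypes.S j) e2 - twp (Datatypes.S j) e) <= o).
    { apply (H1 S HS).
      - intros x y Hx Hy. specialize (Hdiam x y Hx Hy). lra.
      - apply (chain_map S S distp distp (fun x => x) d d1); auto. intros. lra. }
    assert (Hb : Cmod (branch j (fst (fst e2)) (snd (fst e2)) - branch j (fst (fst e)) (snd (fst e))) <= d).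
    { eapply Rle_trans; [apply branch_diff|]. left.
      apply (Hdiam e2 e); [eapply chain_end | eapply chain_start]; eauto. }
    assert (Hp : Cmod (twp j e2 - twp j e) * Cmod (twp j e2 + twp j e) <= 14 / 10 * (q * q)).
    { rewrite <- Cmod_mult.
      replace ((twp j e2 - twp j e) * (twp j e2 + twp j e))%C with
        (twp j e2 * twp j e2 - twp j e * twp j e)%C by ring.
      unfold twp at 1 2 3 4. rewrite !tower_square. fold (twp (Datatypes.S j) e2) (twp (Datatypes.S j) e).
      match goal with |- Cmod (?x1 + ?c * ?y1 - (?x2 + ?c * ?y2)) <= _ =>
        replace (x1 + c * y1 - (x2 + c * y2))%C with ((x1 - x2) + c * (y1 - y2))%C by ring end.
      eapply Rle_trans; [apply Cmod_triangle|]. rewrite Cmod_scale.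
      assert (scale j * Cmod (twp (Datatypes.S j) e2 - twp (Datatypes.S j) e) <= q * q)
        by (rewrite Hq2; apply Rmult_le_compat_l; lra).
      lra. }
    destruct (Rle_lt_dec (Cmod (twp j e2 - twp j e)) (12 / 10 * q)); [auto|right].
    apply Rnot_lt_le. intros Hlt. nra. }
  assert (Hstep : forall e1 e2, S e1 -> S e2 -> distp e1 e2 < d -> Cmod (twp j e2 - twp j e1) <= q).
  { intros e1 e2 S1 S2 H12. destruct (HS _ S1) as (B1 & B2 & B3). destruct (HS _ S2) as (B4 & B5 & B6).
    specialize (B3 O). specialize (B6 O). unfold twp in B3, B6; simpl in B3, B6.
    destruct (HLip (fst (fst e1)) (snd (fst e1)) (snd e1) (fst (fst e2)) (snd (fst e2)) (snd e2)) as [_ H3];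
      try lra.
    rewrite Cmod_sub_sym. eapply Rle_trans; [apply H3|].
    apply Rle_trans with (L * (q / L)); [|right; field; lra].
    apply Rmult_le_compat_l; [lra|]. unfold distp in H12. lra. }
  (* For small [y] even a sign change costs at most [12/10 + 2 * 24/10 = 6] times [q]. For large [y]
     a jump in one step would put the new value within [22/10 * q] of [y] and within [12/10 * q] of
     [- y], which are more than [48/10 * q] apart. *)
  destruct (Rle_lt_dec (Cmod (twp j e)) (24 / 10 * q)) as [Hs|Hs].
  - destruct (Hsq e' Hch) as [H|H]; [lra|].
    replace (twp j e' - twp j e)%C with ((twp j e' + twp j e) - (twp j e + twp j e))%C by ring.
    eapply Rle_trans; [apply Cmod_sub_le|]. pose proof (Cmod_triangle (twp j e) (twp j e)). lra.
  - assert (Cmod (twp j e' - twp j e) <= 12 / 10 * q); [|lra].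
    induction Hch as [|y z Hch IH Hz Hyz].
    + replace (twp j e - twp j e)%C with (RtoC 0) by ring. rewrite Cmod_0. lra.
    + destruct (Hsq z) as [H|H]; auto; [eapply chain_step; eauto|].
      pose proof (Hstep y z (chain_end _ _ _ _ _ _ Hch) Hz Hyz) as H2.
      pose proof (Cmod_sub_tri (twp j z) (twp j y) (twp j e)) as H3.
      pose proof (Cmod_sub_le (twp j z + twp j e) (twp j z - twp j e)) as H4.
      replace (twp j z + twp j e - (twp j z - twp j e))%C with (RtoC 2 * twp j e)%C in H4.
      * rewrite Cmod_mult, Cmod_R, Rabs_pos_eq in H4 by lra. lra.
      * replace (RtoC 2) with (RtoC 1 + RtoC 1)%C by (rewrite <- RtoC_plus; f_equal; lra). ring.
Qed.

(** Descent from the trivial bound at level [m]. With [o = 200 * x^2] and [scale j = y^2] the new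
    bound is [6 * sqrt 200 * x * y], which is below [200 * x * y], so the constant 200 reproduces
    itself and the exponent gains [2 ^ j]. *)
Lemma small_oscillation_at m : forall i j, (i + j = m)%nat ->
  small_oscillation j (200 * (1 / 2) ^ (i * 2 ^ j)).
Proof.
  induction i; intros j Hij.
  - simpl. rewrite Rmult_1_r. apply small_oscillation_trivial.
  - specialize (IHi (S j) ltac:(lia)).
    set (x := (1 / 2) ^ (i * 2 ^ j)). assert (Hx : 0 < x) by (apply pow_lt; lra).
    assert (E1 : (1 / 2) ^ (i * 2 ^ S j) = x * x).
    { unfold x. rewrite <- pow_add. f_equal. simpl. lia. }
    set (y := (1 / 2) ^ (2 ^ j)). assert (Hy : 0 < y) by (apply pow_lt; lra).
    assert (E2 : scale j = y * y).
    { unfold scale, y. rewrite <- Rpow_mult_distr. f_equal. lra. }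
    assert (E3 : (1 / 2) ^ (S i * 2 ^ j) = y * x).
    { unfold x, y. rewrite <- pow_add. f_equal. }
    rewrite E1 in IHi. apply small_oscillation_pred in IHi; [|nra].
    destruct IHi as (d & Hd & H). exists d. split; auto.
    intros S HS Hdiam e e' Hch. eapply Rle_trans; [apply (H S HS Hdiam e e' Hch)|].
    rewrite E3, E2.
    assert (sqrt (y * y * (200 * (x * x))) <= 15 * (y * x)).
    { rewrite <- (sqrt_square (15 * (y * x))) by (assert (0 < y * x) by (apply Rmult_lt_0_compat; auto); lra).
      apply sqrt_le_1_alt. assert (0 <= (y * x) * (y * x)) by apply Rle_0_sqr. lra. }
    assert (0 < y * x) by (apply Rmult_lt_0_compat; auto). lra.
Qed.

Lemma fibre_chain eps : 0 < eps -> exists delta, 0 < delta /\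
  forall (S : pt -> Prop), (forall e, S e -> in_tower e) ->
    (forall e e', S e -> S e' -> dist2 (fst e) (fst e') < delta) ->
    forall e e', chain S distp delta e e' -> Cmod (snd e' - snd e) <= eps.
Proof.
  intros He. destruct (pow_small (1 / 2) (eps / 200)) as [m Hm]; [lra | lra|].
  destruct (small_oscillation_at m m 0 ltac:(lia)) as (d & Hd & H).
  exists d. split; auto. intros S HS Hdiam e e' Hch.
  eapply Rle_trans; [apply (H S HS Hdiam e e' Hch)|].
  simpl (2 ^ 0)%nat. rewrite Nat.mul_1_r. specialize (Hm m (le_n _)). lra.
Qed.

Lemma Etower_chain eps : 0 < eps -> exists delta, 0 < delta /\
  forall e e', chain (fun e => Etower (fst (fst e)) (snd (fst e)) (snd e)) distp delta e e' ->
    distp e e' < eps.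
Proof.
  intros He. destruct (fibre_chain (eps / 3)) as (d1 & Hd1 & H1); [lra|].
  destruct (pc_chain _ HE0 (Rmin (d1 / 2) (eps / 3))) as (d2 & Hd2 & H2).
  { apply Rmin_pos; lra. }
  exists (Rmin d1 d2). split; [apply Rmin_pos; auto|]. intros e e' Hch.
  pose proof (Rmin_l d1 d2) as M1. pose proof (Rmin_r d1 d2) as M2.
  pose proof (Rmin_l (d1 / 2) (eps / 3)) as M3. pose proof (Rmin_r (d1 / 2) (eps / 3)) as M4.
  set (SE := fun e : pt => Etower (fst (fst e)) (snd (fst e)) (snd e)) in *.
  (* The projection to [E0] comes first: it keeps all base points within [d1 / 2] of the initial
     one, hence within [d1] of each other, as the fibre estimate requires. *)
  assert (Hbase : forall z, chain SE distp (Rmin d1 d2) e z -> dist2 (fst e) (fst z) < Rmin (d1 / 2) (eps / 3)).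
  { intros z Hz. apply H2.
    apply (chain_map SE (fun p => E0 (fst p) (snd p)) distp dist2 fst (Rmin d1 d2)); auto.
    - intros x Hx. apply Hx.
    - intros x y _ _ Hxy. unfold distp, dist3 in Hxy. unfold dist2.
      pose proof (Cmod_ge_0 (snd x - snd y)). lra. }
  pose proof (chain_restrict _ _ _ _ _ _ _ Hbase Hch) as Hch'.
  assert (Cmod (snd e' - snd e) <= eps / 3).
  { apply (H1 _) with (3 := chain_map _ _ distp distp (fun x => x) (Rmin d1 d2) d1 _ _
             (fun x H => H) (fun x y _ _ H => Rlt_le_trans _ _ _ H M1) Hch').
    - intros x [Hx _]. destruct (Etower_bounds _ _ _ Hx) as (B1 & B2 & _).
      split; auto. split; auto. intros j. apply Hx.
    - intros x y [_ Hx] [_ Hy].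
      pose proof (Cmod_sub_tri (fst (fst x)) (fst (fst e)) (fst (fst y))).
      pose proof (Cmod_sub_tri (snd (fst x)) (snd (fst e)) (snd (fst y))).
      rewrite dist2_sym in Hx. unfold dist2 in *. lra. }
  specialize (Hbase e' Hch). unfold distp, dist3. unfold dist2 in Hbase.
  rewrite (Cmod_sub_sym (snd e)). lra.
Qed.

End Tower.

(** * Analytic discs in the tower *)

Definition deriv_at (f : C -> C) (w l : C) : Prop :=
  forall eps, 0 < eps -> exists delta, 0 < delta /\
    forall h, Cmod h < delta -> Cmod (f (w + h) - f w - l * h)%C <= eps * Cmod h.

Lemma differentiable_deriv f w : C_differentiable_at f w -> exists l, deriv_at f w l.
Proof. intros [l H]. exists l. exact H. Qed.

Lemma deriv_continuous f w l : deriv_at f w l -> forall eps, 0 < eps ->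
  exists delta, 0 < delta /\ forall z, Cmod (z - w) < delta -> Cmod (f z - f w) < eps.
Proof.
  intros H eps He. destruct (H 1) as (d & Hd & Hf); [lra|].
  pose proof (Cmod_ge_0 l).
  exists (Rmin d (eps / (Cmod l + 1))).
  assert (0 < eps / (Cmod l + 1)) by (apply Rdiv_lt_0_compat; lra).
  split; [apply Rmin_pos; auto|]. intros z Hz.
  pose proof (Rmin_l d (eps / (Cmod l + 1))). pose proof (Rmin_r d (eps / (Cmod l + 1))).
  specialize (Hf (z - w)%C ltac:(lra)). replace (w + (z - w))%C with z in Hf by ring.
  pose proof (Cmod_le_add (f z - f w)%C (l * (z - w))%C) as HA. rewrite Cmod_mult in HA.
  apply Rle_lt_trans with ((Cmod l + 1) * Cmod (z - w)); [lra|].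
  apply Rlt_le_trans with ((Cmod l + 1) * (eps / (Cmod l + 1))); [|right; field; lra].
  apply Rmult_lt_compat_l; lra.
Qed.

(** The mean value theorem on the radius to [w], for the real and the imaginary part separately. *)
Lemma deriv_zero_const f : (forall w, Cmod w < 1 -> deriv_at f w (RtoC 0)) ->
  forall w, Cmod w < 1 -> f w = f (RtoC 0).
Proof.
  intros H w Hw.
  assert (Hs : forall s, 0 <= s <= 1 -> forall eps, 0 < eps -> exists delta, 0 < delta /\
            forall h, Rabs h < delta -> Cmod (f (RtoC (s + h) * w)%C - f (RtoC s * w)%C) <= eps * Rabs h).
  { intros s Hs eps He.
    assert (Hsw : Cmod (RtoC s * w) < 1).
    { rewrite Cmod_mult, Cmod_R, Rabs_pos_eq by lra. pose proof (Cmod_ge_0 w). nra. }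
    destruct (H _ Hsw eps He) as (d & Hd & Hf). exists d. split; auto. intros h Hh.
    assert (Hm : Cmod (RtoC h * w) <= Rabs h).
    { rewrite Cmod_mult, Cmod_R. pose proof (Cmod_ge_0 w). pose proof (Rabs_pos h). nra. }
    specialize (Hf (RtoC h * w)%C ltac:(lra)).
    replace (RtoC s * w + RtoC h * w)%C with (RtoC (s + h) * w)%C in Hf by (rewrite RtoC_plus; ring).
    match type of Hf with Cmod (?x - RtoC 0 * ?y) <= _ => replace (x - RtoC 0 * y)%C with x in Hf by ring end.
    eapply Rle_trans; [apply Hf|]. apply Rmult_le_compat_l; lra. }
  assert (Hc : forall part : C -> R, (forall z, Rabs (part z) <= Cmod z) ->
            (forall x y, part (x - y)%C = part x - part y) -> part (f w) = part (f (RtoC 0))).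
  { intros part Hp Hpm.
    destruct (MVT_cor2 (fun s => part (f (RtoC s * w)%C)) (fun _ => 0) 0 1) as (c & Hc & _); [lra| |].
    - intros s Hs01 eps He. destruct (Hs s Hs01 (eps / 2)) as (d & Hd & Hf); [lra|].
      exists (mkposreal d Hd). intros h Hh0 Hh. specialize (Hf h Hh). cbn beta.
      rewrite <- Hpm. rewrite Rminus_0_r. unfold Rdiv. rewrite Rabs_mult, Rabs_inv.
      pose proof (Rabs_pos_lt h Hh0).
      apply Rmult_lt_reg_r with (Rabs h); auto. rewrite Rmult_assoc, Rinv_l by lra.
      eapply Rle_lt_trans; [rewrite Rmult_1_r; apply Hp|]. nra.
    - rewrite Rmult_0_l in Hc.
      replace (RtoC 1 * w)%C with w in Hc by ring. replace (RtoC 0 * w)%C with (RtoC 0) in Hc by ring. lra. }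
  rewrite (surjective_pairing (f w)), (surjective_pairing (f (RtoC 0))). f_equal.
  - apply (Hc fst); [apply fst_le_Cmod|]. intros [] []; reflexivity.
  - apply (Hc snd); [apply snd_le_Cmod|]. intros [] []; reflexivity.
Qed.

(** Increments of [f] are real in every direction, so [l * u] is real for every unit [u]; the
    directions 1 and [Ci] kill both parts of [l]. *)
Lemma real_valued_deriv_zero f w l : Cmod w < 1 -> (forall z, Cmod z < 1 -> snd (f z) = 0) ->
  deriv_at f w l -> l = RtoC 0.
Proof.
  intros Hw Hf Hd.
  assert (Hl : forall u : C, Cmod u = 1 -> snd (l * u)%C = 0).
  { intros u Hu. apply NNPP. intros Hne. set (e := Rabs (snd (l * u)%C)).
    assert (He : 0 < e) by (apply Rabs_pos_lt; auto).
    destruct (Hd (e / 2)) as (d & Hd0 & H); [lra|].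
    set (s := Rmin (d / 2) ((1 - Cmod w) / 2)).
    assert (Hs : 0 < s) by (apply Rmin_pos; lra).
    pose proof (Rmin_l (d / 2) ((1 - Cmod w) / 2)) as S1. pose proof (Rmin_r (d / 2) ((1 - Cmod w) / 2)) as S2.
    fold s in S1, S2.
    assert (Hm : Cmod (RtoC s * u) = s) by (rewrite Cmod_mult, Cmod_R, Hu, Rabs_pos_eq; lra).
    specialize (H (RtoC s * u)%C ltac:(lra)). rewrite Hm in H.
    assert (Hin : Cmod (w + RtoC s * u) < 1) by (pose proof (Cmod_triangle w (RtoC s * u)); lra).
    pose proof (Hf _ Hin) as F1. pose proof (Hf _ Hw) as F2.
    pose proof (snd_le_Cmod (f (w + RtoC s * u) - f w - l * (RtoC s * u))%C) as H1.
    assert (E : snd (f (w + RtoC s * u) - f w - l * (RtoC s * u))%C = - (s * snd (l * u)%C)).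
    { change (snd (f (w + RtoC s * u)%C) + - snd (f w) + - snd (l * (RtoC s * u))%C = - (s * snd (l * u)%C)).
      rewrite F1, F2. unfold Cmult, RtoC; simpl. ring. }
    rewrite E, Rabs_Ropp, Rabs_mult, (Rabs_pos_eq s) in H1 by lra. fold e in H1. nra. }
  pose proof (Hl (RtoC 1) Cmod_1) as H1. pose proof (Hl Ci Cmod_Ci) as H2.
  destruct l as [x y]. simpl in H1, H2. unfold RtoC. f_equal; lra.
Qed.

(* A continuous [gamma] cannot satisfy [gamma^2 ~ l rho e^(i theta)] around a full circle:
   [gamma e^(-i theta/2)] would change sign without its real part (along [sqrt l]) vanishing. *)
Lemma no_circle_sqrt (gamma : R -> C) (l : C) rho : l <> RtoC 0 -> 0 < rho ->
  continuity (fun x => fst (gamma x)) -> continuity (fun x => snd (gamma x)) ->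
  gamma (2 * PI) = gamma 0 ->
  (forall x, Cmod (gamma x * gamma x - l * (RtoC rho * (cos x, sin x)))%C <= Cmod l * rho / 2) -> False.
Proof.
  intros Hl Hrho C1 C2 Hper Hsq.
  destruct (C_sqrt_ex l) as [lam Hlam].
  (* The factor [Cconj lam] normalises the direction: [v ^ 2] stays within half of the positive
     number [|l|^2 * rho] around it, so [v] is never purely imaginary. *)
  set (v := fun x => (gamma x * (cos (x / 2), - sin (x / 2))%R * Cconj lam)%C).
  set (g := fun x => fst (v x)).
  assert (Hg : continuity g).
  { assert (Cc : continuity (fun x => cos (x / 2))) by (intros x; reg).
    assert (Cs : continuity (fun x => sin (x / 2))) by (intros x; reg).
    assert (E : g = (fun x => (fst (gamma x) * cos (x / 2) + snd (gamma x) * sin (x / 2)) * fst lam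
       + (snd (gamma x) * cos (x / 2) - fst (gamma x) * sin (x / 2)) * snd lam)).
    { apply functional_extensionality. intros x. unfold g, v, Cmult, Cconj; simpl. ring. }
    rewrite E.
    assert (K : forall c : R, continuity (fun _ => c)) by (intros c; apply continuity_const; intros ? ?; auto).
    apply (continuity_plus (fun x => (fst (gamma x) * cos (x / 2) + snd (gamma x) * sin (x / 2)) * fst lam)
             (fun x => (snd (gamma x) * cos (x / 2) - fst (gamma x) * sin (x / 2)) * snd lam)).
    - apply (continuity_mult (fun x => fst (gamma x) * cos (x / 2) + snd (gamma x) * sin (x / 2))
               (fun _ => fst lam)); auto.
      apply (continuity_plus (fun x => fst (gamma x) * cos (x / 2)) (fun x => snd (gamma x) * sin (x / 2)));
        [apply (continuity_mult (fun x => fst (gamma x)) (fun x => cos (x / 2)))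
        |apply (continuity_mult (fun x => snd (gamma x)) (fun x => sin (x / 2)))]; auto.
    - apply (continuity_mult (fun x => snd (gamma x) * cos (x / 2) - fst (gamma x) * sin (x / 2))
               (fun _ => snd lam)); auto.
      apply (continuity_minus (fun x => snd (gamma x) * cos (x / 2)) (fun x => fst (gamma x) * sin (x / 2)));
        [apply (continuity_mult (fun x => snd (gamma x)) (fun x => cos (x / 2)))
        |apply (continuity_mult (fun x => fst (gamma x)) (fun x => sin (x / 2)))]; auto. }
  assert (Hg0 : forall x, g x <> 0).
  { intros x Hx. specialize (Hsq x).
    pose proof (proj1 (Cmod_gt_0 l) Hl) as Hlp.
    set (e := (cos (x / 2), - sin (x / 2)) : C).
    assert (He : Cmod e = 1).
    { unfold e, Cmod. simpl. replace (cos (x / 2) * (cos (x / 2) * 1) + - sin (x / 2) * (- sin (x / 2) * 1))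
        with (Rsqr (sin (x / 2)) + Rsqr (cos (x / 2))) by (unfold Rsqr; ring).
      rewrite sin2_cos2. apply sqrt_1. }
    assert (Hee : (e * e * (cos x, sin x) = RtoC 1)%C).
    { assert (E1 : cos x = cos (x / 2) * cos (x / 2) - sin (x / 2) * sin (x / 2)).
      { replace x with (2 * (x / 2)) at 1 by field. apply cos_2a. }
      assert (E2 : sin x = 2 * sin (x / 2) * cos (x / 2)).
      { replace x with (2 * (x / 2)) at 1 by field. apply sin_2a. }
      pose proof (sin2_cos2 (x / 2)) as E3. unfold Rsqr in E3.
      assert (E4 : sin (x / 2) * sin (x / 2) = 1 - cos (x / 2) * cos (x / 2)) by lra.
      rewrite E1, E2. unfold e, Cmult, RtoC; simpl. f_equal; [|ring].
      ring_simplify.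
      replace (sin (x / 2) ^ 4) with ((sin (x / 2) * sin (x / 2)) * (sin (x / 2) * sin (x / 2))) by ring.
      replace (sin (x / 2) ^ 2) with (sin (x / 2) * sin (x / 2)) by ring. rewrite E4. ring. }
    assert (Hv : (v x * v x - Cconj l * l * RtoC rho
                  = (gamma x * gamma x - l * (RtoC rho * (cos x, sin x))) * (e * e) * Cconj l)%C).
    { assert (Hcl : (Cconj lam * Cconj lam = Cconj l)%C) by (rewrite <- Hlam; symmetry; apply Cmult_conj).
      transitivity (gamma x * gamma x * (e * e) * Cconj l - Cconj l * l * RtoC rho * (e * e * (cos x, sin x)))%C.
      - rewrite Hee, <- Hcl. unfold v. fold e. ring.
      - ring. }
    assert (Hb : Cmod (v x * v x - Cconj l * l * RtoC rho) <= Cmod l * Cmod l * rho / 2).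
    { rewrite Hv, !Cmod_mult, Cmod_conj, He. nra. }
    assert (Hll : (Cconj l * l)%C = RtoC (Cmod l * Cmod l)).
    { replace (Cmod l * Cmod l) with (Cmod l ^ 2) by ring. rewrite Cmod2_conj. ring. }
    rewrite Hll, <- RtoC_mult in Hb.
    pose proof (fst_le_Cmod (v x * v x - RtoC (Cmod l * Cmod l * rho))%C) as Hf.
    unfold g in Hx.
    assert (E : fst (v x * v x - RtoC (Cmod l * Cmod l * rho))%C =
                - (snd (v x) * snd (v x)) - Cmod l * Cmod l * rho).
    { change (fst (v x) * fst (v x) - snd (v x) * snd (v x) + - (Cmod l * Cmod l * rho) =
              - (snd (v x) * snd (v x)) - Cmod l * Cmod l * rho).
      rewrite Hx. ring. }
    rewrite E in Hf.
    assert (0 < Cmod l * Cmod l * rho) by (repeat apply Rmult_lt_0_compat; auto).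
    pose proof (Rle_0_sqr (snd (v x))). unfold Rsqr in *.
    rewrite Rabs_left in Hf by lra. lra. }
  assert (Hend : g (2 * PI) = - g 0).
  { unfold g, v. rewrite Hper. replace (2 * PI / 2) with PI by field. replace (0 / 2) with 0 by field.
    rewrite cos_PI, sin_PI, cos_0, sin_0. unfold Cmult; simpl. ring. }
  destruct (IVT_cor g 0 (2 * PI) Hg) as (z & _ & Hz).
  - pose proof PI_RGT_0; lra.
  - rewrite Hend. pose proof (Rle_0_sqr (g 0)). unfold Rsqr in *. lra.
  - apply (Hg0 z Hz).
Qed.

Lemma continuity_pt_eps f x : continuity_pt f x <-> forall eps, 0 < eps -> exists delta, 0 < delta /\
  forall y, Rabs (y - x) < delta -> Rabs (f y - f x) < eps.
Proof.
  split.
  - intros H eps He. destruct (H eps He) as (d & Hd & H'). exists d. split; auto. intros y Hy.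
    destruct (Req_dec x y) as [->|Hne].
    + rewrite Rminus_diag, Rabs_R0. auto.
    + apply H'. split; [split; [exact I | auto]|]. exact Hy.
  - intros H eps He. destruct (H eps He) as (d & Hd & H'). exists d. split; auto.
    intros y [_ Hy]. apply H'. exact Hy.
Qed.

Section TowerDisc.

Variable al : nat -> C.
Hypothesis al_dense : forall z eps J (fl : bool), Cmod z <= 200 -> 0 < eps ->
  exists j, (J <= j)%nat /\ Nat.even j = fl /\ Cmod (al j - z) < eps.

Variables A B W : C -> C.
Hypothesis disc_tower : forall t, Cmod t < 1 -> in_tower al (A t, B t, W t).
Hypothesis dA : forall t, Cmod t < 1 -> exists l, deriv_at A t l.
Hypothesis dB : forall t, Cmod t < 1 -> exists l, deriv_at B t l.
Hypothesis dW : forall t, Cmod t < 1 -> exists l, deriv_at W t l.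

Lemma twp_disc_continuous j t : Cmod t < 1 -> forall eps, 0 < eps -> exists delta, 0 < delta /\
  forall z, Cmod z < 1 -> Cmod (z - t) < delta ->
    Cmod (twp al j (A z, B z, W z) - twp al j (A t, B t, W t)) < eps.
Proof.
  intros Ht eps He.
  destruct (poly_bounded_lipschitz3 3 _ 200 (le_n _) (poly_tower0 al 3 j (le_n _)) ltac:(lra)) as (L & HL & HLip).
  set (e := eps / (3 * L)). assert (He' : 0 < e) by (apply Rdiv_lt_0_compat; lra).
  destruct (dA t Ht) as [a Ha]. destruct (dB t Ht) as [b Hb]. destruct (dW t Ht) as [w Hw].
  destruct (deriv_continuous _ _ _ Ha e He') as (d1 & Hd1 & H1).
  destruct (deriv_continuous _ _ _ Hb e He') as (d2 & Hd2 & H2).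
  destruct (deriv_continuous _ _ _ Hw e He') as (d3 & Hd3 & H3).
  exists (Rmin d1 (Rmin d2 d3)). split; [repeat apply Rmin_pos; auto|]. intros z Hz Hzt.
  pose proof (Rmin_l d1 (Rmin d2 d3)). pose proof (Rmin_r d1 (Rmin d2 d3)).
  pose proof (Rmin_l d2 d3). pose proof (Rmin_r d2 d3).
  specialize (H1 z ltac:(lra)). specialize (H2 z ltac:(lra)). specialize (H3 z ltac:(lra)).
  destruct (disc_tower z Hz) as (B1 & B2 & B3). destruct (disc_tower t Ht) as (B4 & B5 & B6).
  specialize (B3 O). specialize (B6 O). unfold twp in B3, B6. simpl in *.
  destruct (HLip (A z) (B z) (W z) (A t) (B t) (W t)) as [_ H7]; try lra.
  eapply Rle_lt_trans; [apply H7|]. unfold dist3.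
  apply Rlt_le_trans with (L * (3 * e)); [|right; unfold e; field; lra].
  apply Rmult_lt_compat_l; lra.
Qed.

Lemma scale_small eps : 0 < eps -> exists J, forall j, (J <= j)%nat -> scale j < eps.
Proof.
  intros He. destruct (pow_small (1 / 4) eps) as [J HJ]; [lra | lra|]. exists J. intros j Hj.
  apply HJ. pose proof (Nat.pow_gt_lin_r 2 j ltac:(lia)). lia.
Qed.

(** On a circle of radius [rho] about [t], [y_j^2] equals [l * h] up to three errors of at most
    [m / 8], where [m = |l| * rho]: the remainder of the derivative, the distance from [al j] to
    [Z t], and [scale j * y_(j+1)]. As 3/8 is below 1/2, [no_circle_sqrt] applies. *)
Lemma disc_deriv_zero (fl : bool) t l : Cmod t < 1 -> deriv_at (if fl then A else B) t l -> l = RtoC 0.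
Proof.
  intros Ht Hl. apply NNPP. intros Hne. pose proof (proj1 (Cmod_gt_0 l) Hne) as Hlp.
  set (Z := if fl then A else B) in *.
  destruct (Hl (Cmod l / 8)) as (d & Hd & HZ); [lra|].
  set (rho := Rmin (d / 2) ((1 - Cmod t) / 2)).
  assert (Hrho : 0 < rho) by (apply Rmin_pos; lra).
  pose proof (Rmin_l (d / 2) ((1 - Cmod t) / 2)) as R1. pose proof (Rmin_r (d / 2) ((1 - Cmod t) / 2)) as R2.
  fold rho in R1, R2.
  set (m := Cmod l * rho). assert (Hm : 0 < m) by (apply Rmult_lt_0_compat; auto).
  destruct (scale_small (m / 800)) as [J HJ]; [lra|].
  assert (HZb : Cmod (Z t) <= 200).
  { destruct (disc_tower t Ht) as (B1 & B2 & _). unfold Z. destruct fl; auto. }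
  destruct (al_dense (Z t) (m / 8) J fl HZb ltac:(lra)) as (j & Hj & Hev & Hal).
  set (c := fun x => (t + RtoC rho * (cos x, sin x))%C).
  assert (Hcs : forall x, Cmod (cos x, sin x) = 1).
  { intros x. unfold Cmod. simpl. replace (cos x * (cos x * 1) + sin x * (sin x * 1))
      with (Rsqr (sin x) + Rsqr (cos x)) by (unfold Rsqr; ring). rewrite sin2_cos2. apply sqrt_1. }
  assert (Hh : forall x, Cmod (RtoC rho * (cos x, sin x)) = rho).
  { intros x. rewrite Cmod_mult, Hcs, Cmod_R, Rabs_pos_eq; lra. }
  assert (Hc : forall x, Cmod (c x) < 1).
  { intros x. pose proof (Cmod_triangle t (RtoC rho * (cos x, sin x))). rewrite Hh in *. unfold c. lra. }
  set (gamma := fun x => twp al j (A (c x), B (c x), W (c x))).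
  assert (Hcont : forall x eps, 0 < eps -> exists delta, 0 < delta /\
            forall y, Rabs (y - x) < delta -> Cmod (gamma y - gamma x) < eps).
  { intros x eps He. destruct (twp_disc_continuous j (c x) (Hc x) eps He) as (d1 & Hd1 & H1).
    destruct (proj1 (continuity_pt_eps cos x) (continuity_cos x) (d1 / (2 * rho))) as (d2 & Hd2 & H2).
    { apply Rdiv_lt_0_compat; lra. }
    destruct (proj1 (continuity_pt_eps sin x) (continuity_sin x) (d1 / (2 * rho))) as (d3 & Hd3 & H3).
    { apply Rdiv_lt_0_compat; lra. }
    exists (Rmin d2 d3). split; [apply Rmin_pos; auto|]. intros y Hy. apply H1; auto.
    specialize (H2 y (Rlt_le_trans _ _ _ Hy (Rmin_l _ _))).
    specialize (H3 y (Rlt_le_trans _ _ _ Hy (Rmin_r _ _))).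
    replace (c y - c x)%C with (RtoC rho * ((cos y, sin y) - (cos x, sin x)))%C by (unfold c; ring).
    rewrite Cmod_mult, Cmod_R, Rabs_pos_eq by lra.
    pose proof (Cmod_le_abs ((cos y, sin y) - (cos x, sin x))%C) as H4. simpl in H4.
    unfold Rminus in H2, H3.
    apply Rlt_le_trans with (rho * (2 * (d1 / (2 * rho)))); [|right; field; lra].
    apply Rmult_lt_compat_l; lra. }
  apply (no_circle_sqrt gamma l rho Hne Hrho).
  - intros x. apply continuity_pt_eps. intros eps He. destruct (Hcont x eps He) as (d1 & Hd1 & H1).
    exists d1. split; auto. intros y Hy. eapply Rle_lt_trans; [|apply (H1 y Hy)].
    apply (fst_le_Cmod (gamma y - gamma x)%C).
  - intros x. apply continuity_pt_eps. intros eps He. destruct (Hcont x eps He) as (d1 & Hd1 & H1).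
    exists d1. split; auto. intros y Hy. eapply Rle_lt_trans; [|apply (H1 y Hy)].
    apply (snd_le_Cmod (gamma y - gamma x)%C).
  - unfold gamma, c. rewrite cos_2PI, sin_2PI, cos_0, sin_0. reflexivity.
  - intros x. unfold gamma, twp. cbn [fst snd]. rewrite tower_square.
    assert (E : branch al j (A (c x)) (B (c x)) = (Z (c x) - al j)%C).
    { unfold branch, Z. rewrite Hev. destruct fl; reflexivity. }
    rewrite E. set (y := tower al (S j) 0 (A (c x)) (B (c x)) (W (c x))).
    assert (Hy : Cmod y <= 100).
    { destruct (disc_tower (c x) (Hc x)) as (_ & _ & B3). apply (B3 (S j)). }
    set (h := (RtoC rho * (cos x, sin x))%C).
    specialize (HZ h). unfold h in HZ at 1. rewrite Hh in HZ. specialize (HZ ltac:(lra)).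
    fold (c x) in HZ. change (t + h)%C with (c x) in HZ. unfold h in HZ at 2. rewrite Hh in HZ.
    replace (Z (c x) - al j + RtoC (scale j) * y - l * h)%C with
      ((Z (c x) - Z t - l * h) + (Z t - al j) + RtoC (scale j) * y)%C by ring.
    eapply Rle_trans; [apply Cmod_triangle|]. rewrite Cmod_scale.
    pose proof (Cmod_triangle (Z (c x) - Z t - l * h) (Z t - al j)).
    rewrite (Cmod_sub_sym (Z t) (al j)) in *.
    specialize (HJ j Hj). pose proof (scale_pos j). pose proof (Cmod_ge_0 y).
    assert (scale j * Cmod y <= m / 8) by nra.
    fold m. replace (Cmod l / 8 * rho) with (m / 8) in HZ by (unfold m; field). lra.
Qed.

Lemma disc_constant t : Cmod t < 1 ->
  A t = A (RtoC 0) /\ B t = B (RtoC 0) /\ W t = W (RtoC 0).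
Proof.
  assert (HA : forall t, Cmod t < 1 -> A t = A (RtoC 0)).
  { apply deriv_zero_const. intros w Hw. destruct (dA w Hw) as [l Hl].
    rewrite <- (disc_deriv_zero true w l Hw Hl). auto. }
  assert (HB : forall t, Cmod t < 1 -> B t = B (RtoC 0)).
  { apply deriv_zero_const. intros w Hw. destruct (dB w Hw) as [l Hl].
    rewrite <- (disc_deriv_zero false w l Hw Hl). auto. }
  intros Ht. split; [auto|]. split; [auto|].
  (* With the base point constant, [W (s t)] moves in a single fibre as [s] runs over [0, 1]. A fine
     subdivision gives a chain, and [fibre_chain] brings its ends within half of their own
     distance. *)
  apply Cmod_sub0. apply Rle_antisym; [|apply Cmod_ge_0]. apply Rnot_lt_le. intros Hlt.
  set (eps := Cmod (W t - W (RtoC 0)) / 2).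
  destruct (fibre_chain al eps) as (d & Hd & Hch); [unfold eps; lra|].
  set (w := fun s : R => W (RtoC s * t)%C).
  assert (Hin : forall s, 0 <= s <= 1 -> Cmod (RtoC s * t) < 1).
  { intros s Hs. rewrite Cmod_mult, Cmod_R, Rabs_pos_eq by lra. pose proof (Cmod_ge_0 t). nra. }
  assert (Hwc : forall s, 0 <= s <= 1 -> forall e, 0 < e -> exists delta, 0 < delta /\
            forall y, Rabs (y - s) < delta -> Cmod (w y - w s) < e).
  { intros s Hs e He. destruct (dW _ (Hin s Hs)) as [l Hl].
    destruct (deriv_continuous _ _ _ Hl e He) as (d1 & Hd1 & H1). exists d1. split; auto.
    intros y Hy. apply H1. replace (RtoC y * t - RtoC s * t)%C with (RtoC (y - s) * t)%C
      by (rewrite RtoC_minus; ring).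
    rewrite Cmod_mult, Cmod_R. pose proof (Rabs_pos (y - s)). pose proof (Cmod_ge_0 t). nra. }
  assert (Hd2 : 0 < d / 2) by lra.
  destruct (Heine (fun s => fst (w s)) (fun c => 0 <= c <= 1) (compact_P3 0 1)) with (eps := mkposreal _ Hd2)
    as [d1 H1].
  { intros s Hs. apply continuity_pt_eps. intros e He. destruct (Hwc s Hs e He) as (d1 & Hd1 & H1).
    exists d1. split; auto. intros y Hy. eapply Rle_lt_trans; [|apply (H1 y Hy)].
    apply (fst_le_Cmod (w y - w s)%C). }
  destruct (Heine (fun s => snd (w s)) (fun c => 0 <= c <= 1) (compact_P3 0 1)) with (eps := mkposreal _ Hd2)
    as [d2 H2].
  { intros s Hs. apply continuity_pt_eps. intros e He. destruct (Hwc s Hs e He) as (d2 & Hd2' & H2).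
    exists d2. split; auto. intros y Hy. eapply Rle_lt_trans; [|apply (H2 y Hy)].
    apply (snd_le_Cmod (w y - w s)%C). }
  simpl in H1, H2.
  set (S := fun e : pt => exists s, 0 <= s <= 1 /\ e = (A (RtoC 0), B (RtoC 0), w s)).
  destruct (inv_INR_lt (Rmin d1 d2)) as [n Hn].
  { apply Rmin_pos; [apply d1 | apply d2]. }
  specialize (Hn n (le_n _)). pose proof (Rmin_l d1 d2). pose proof (Rmin_r d1 d2).
  pose proof (inv_INR_pos n) as Hn0.
  assert (Hfr : forall i, (i <= n + 1)%nat -> 0 <= INR i * / (INR n + 1) <= 1).
  { intros i Hi. pose proof (pos_INR i). pose proof (pos_INR n).
    assert (INR i <= INR n + 1) by (rewrite <- S_INR; apply le_INR; lia).
    split; [apply Rmult_le_pos; lra|]. apply Rle_trans with ((INR n + 1) * / (INR n + 1)).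
    - apply Rmult_le_compat_r; lra.
    - rewrite Rinv_r; lra. }
  assert (Hchain : forall i, (i <= n + 1)%nat ->
            chain S distp d (A (RtoC 0), B (RtoC 0), w 0) (A (RtoC 0), B (RtoC 0), w (INR i * / (INR n + 1)))).
  { induction i; intros Hi.
    - simpl INR. rewrite Rmult_0_l. apply chain_refl. exists 0. split; [lra | auto].
    - eapply chain_step; [apply IHi; lia | |].
      + exists (INR (Datatypes.S i) * / (INR n + 1)). split; auto.
      + unfold distp, dist3. cbn [fst snd].
        replace (A (RtoC 0) - A (RtoC 0))%C with (RtoC 0) by ring.
        replace (B (RtoC 0) - B (RtoC 0))%C with (RtoC 0) by ring. rewrite Cmod_0.
        assert (Hd3 : Rabs (INR i * / (INR n + 1) - INR (Datatypes.S i) * / (INR n + 1)) < Rmin d1 d2).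
        { rewrite S_INR. replace (INR i * / (INR n + 1) - (INR i + 1) * / (INR n + 1))
            with (- / (INR n + 1)) by ring. rewrite Rabs_Ropp, Rabs_pos_eq; lra. }
        specialize (H1 _ _ (Hfr i ltac:(lia)) (Hfr (Datatypes.S i) Hi) ltac:(lra)).
        specialize (H2 _ _ (Hfr i ltac:(lia)) (Hfr (Datatypes.S i) Hi) ltac:(lra)).
        set (x := INR i * / (INR n + 1)) in *. set (y := INR (Datatypes.S i) * / (INR n + 1)) in *.
        pose proof (Cmod_le_abs (w x - w y)%C) as H5.
        change (fst (w x - w y)%C) with (fst (w x) - fst (w y)) in H5.
        change (snd (w x - w y)%C) with (snd (w x) - snd (w y)) in H5.
        lra. }
  specialize (Hchain (n + 1)%nat (le_n _)).
  replace (INR (n + 1) * / (INR n + 1)) with 1 in Hchain.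
  2: { rewrite plus_INR. simpl (INR 1). pose proof (pos_INR n). field. lra. }
  apply (Hch S) in Hchain.
  - simpl in Hchain. unfold w in Hchain. replace (RtoC 1 * t)%C with t in Hchain by ring.
    replace (RtoC 0 * t)%C with (RtoC 0) in Hchain by ring. unfold eps in Hchain. lra.
  - intros e (s & Hs & ->). unfold w. rewrite <- (HA _ (Hin s Hs)), <- (HB _ (Hin s Hs)).
    apply disc_tower. auto.
  - intros e e' (s & Hs & ->) (s' & Hs' & ->). unfold dist2; simpl.
    replace (A (RtoC 0) - A (RtoC 0))%C with (RtoC 0) by ring.
    replace (B (RtoC 0) - B (RtoC 0))%C with (RtoC 0) by ring. rewrite Cmod_0. lra.
Qed.

End TowerDisc.

(** * Cantor sets in uncountable compact sets *)

Definition dist1 (n : nat) (x y : nat -> R) : R := rsum n (fun i => Rabs (x i - y i)).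

Lemma dist1_nonneg n x y : 0 <= dist1 n x y.
Proof. apply rsum_nonneg. intros; apply Rabs_pos. Qed.

Lemma dist1_refl n x : dist1 n x x = 0.
Proof.
  unfold dist1. rewrite (rsum_ext n _ (fun _ => 0)); [rewrite rsum_const; ring|].
  intros. rewrite Rminus_diag. apply Rabs_R0.
Qed.

Lemma dist1_sym n x y : dist1 n x y = dist1 n y x.
Proof. apply rsum_ext. intros. apply Rabs_minus_sym. Qed.

Lemma dist1_tri n x y z : dist1 n x z <= dist1 n x y + dist1 n y z.
Proof.
  unfold dist1. rewrite <- rsum_plus. apply rsum_le. intros i _.
  replace (x i - z i) with ((x i - y i) + (y i - z i)) by ring. apply Rabs_triang.
Qed.

Lemma dist1_eq0 n x y : in_Rn n x -> in_Rn n y -> dist1 n x y = 0 -> x = y.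
Proof.
  intros Hx Hy H. apply functional_extensionality. intros i.
  destruct (le_lt_dec n i) as [Hi|Hi]; [rewrite Hx, Hy; auto|].
  assert (Rabs (x i - y i) <= dist1 n x y).
  { apply (rsum_term n (fun i => Rabs (x i - y i))); auto. intros; apply Rabs_pos. }
  pose proof (Rabs_pos (x i - y i)). apply Rminus_diag_uniq.
  apply NNPP. intros Hne. apply Rabs_pos_lt in Hne. lra.
Qed.

Lemma distR_abs n x y : distR n x y = sqrt (rsum n (fun i => Rabs (x i - y i) ^ 2)).
Proof. unfold distR. f_equal. apply rsum_ext. intros. symmetry. apply pow2_abs. Qed.

Lemma distR_le_dist1 n x y : distR n x y <= dist1 n x y.
Proof. rewrite distR_abs. apply sqrt_rsum_sq_le. intros; apply Rabs_pos. Qed.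

Lemma dist1_le_distR n x y : dist1 n x y <= INR n * distR n x y.
Proof.
  rewrite <- rsum_const. apply rsum_le. intros i Hi. rewrite distR_abs.
  apply (term_le_sqrt_rsum_sq n (fun i => Rabs (x i - y i))); auto. apply Rabs_pos.
Qed.

Lemma distR_small_dist1 n eps : 0 < eps -> exists delta, 0 < delta /\
  forall x y, distR n x y < delta -> dist1 n x y < eps.
Proof.
  intros He. pose proof (pos_INR n). exists (eps / (INR n + 1)).
  split; [apply Rdiv_lt_0_compat; lra|]. intros x y Hxy.
  eapply Rle_lt_trans; [apply dist1_le_distR|].
  assert (0 <= distR n x y) by apply sqrt_pos.
  apply Rle_lt_trans with ((INR n + 1) * distR n x y); [nra|].
  apply Rlt_le_trans with ((INR n + 1) * (eps / (INR n + 1))); [|right; field; lra].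
  apply Rmult_lt_compat_l; lra.
Qed.

(** The proposition [P] allows covers indexed by a plain type: an index whose side condition fails
    contributes the empty set. *)
Lemma open_dist1_ball n (P : Prop) x r : is_open (distR n) (fun y => P /\ dist1 n x y < r).
Proof.
  intros y [HP Hy]. destruct (distR_small_dist1 n (r - dist1 n x y)) as (e & He & H); [lra|].
  exists e. split; auto. intros z Hz. split; auto. specialize (H _ _ Hz).
  pose proof (dist1_tri n x y z). lra.
Qed.

Lemma finite_min (P : nat -> R -> Prop) : (forall i x y, P i x -> y <= x -> P i y) ->
  (forall i, exists x, 0 < x /\ P i x) -> forall k, exists x, 0 < x /\ forall i, (i < k)%nat -> P i x.
Proof.
  intros Hm H. induction k as [|k (x & Hx & IH)].
  - exists 1. split; [lra|]. intros; lia.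
  - destruct (H k) as (y & Hy & HP). exists (Rmin x y). split; [apply Rmin_pos; auto|].
    intros i Hi. destruct (Nat.eq_dec i k) as [->|].
    + apply Hm with y; auto. apply Rmin_r.
    + apply Hm with x; [apply IH; lia | apply Rmin_l].
Qed.

Section PerfectSet.

Variables (n : nat) (K : (nat -> R) -> Prop).
Hypothesis HKsub : forall x, K x -> in_Rn n x.
Hypothesis HKcpt : is_compact_in (distR n) K.

Lemma K_compact (u : nat -> nat -> R) : (forall k, K (u k)) ->
  exists x phi, K x /\ (forall j, (j <= phi j)%nat) /\
    forall eps, 0 < eps -> exists J, forall j, (J <= j)%nat -> dist1 n (u (phi j)) x < eps.
Proof.
  intros Hu.
  assert (exists x, K x /\ forall eps m, 0 < eps -> exists k, (m <= k)%nat /\ dist1 n x (u k) < eps) as (x & Hx & Hcl).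
  { apply NNPP. intros Hn.
    assert (H : forall x, K x -> exists eps m, 0 < eps /\ forall k, (m <= k)%nat -> eps <= dist1 n x (u k)).
    { intros x Hx. apply NNPP. intros Hn'. apply Hn. exists x. split; auto. intros eps m He.
      apply NNPP. intros Hk. apply Hn'. exists eps, m. split; auto. intros k Hk'.
      apply Rnot_lt_le. intros Hlt. apply Hk. eauto. }
    (* Without a cluster point, each point has a ball avoided by a tail of [u]; an index records
       centre, radius and start of the tail. A finite subcover would miss [u M] for [M] the largest
       start. *)
    destruct (HKcpt ((nat -> R) * R * nat)%type (fun i y =>
       (0 < snd (fst i) /\ forall k, (snd i <= k)%nat -> snd (fst i) <= dist1 n (fst (fst i)) (u k)) /\
       dist1 n (fst (fst i)) y < snd (fst i))) as [l Hl].
    - intros i. apply open_dist1_ball.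
    - intros x Hx. destruct (H x Hx) as (eps & m & He & Hm). exists (x, eps, m). simpl.
      rewrite dist1_refl. auto.
    - set (M := list_max (map snd l)).
      destruct (Hl (u M) (Hu M)) as (i & Hi & [_ H1] & H2).
      assert (snd i <= M)%nat.
      { pose proof (proj1 (list_max_le (map snd l) M) (le_n _)) as HF. rewrite Forall_forall in HF.
        apply HF. apply in_map. auto. }
      specialize (H1 M H0). lra. }
  assert (forall j, exists k, (j <= k)%nat /\ dist1 n x (u k) < / (INR j + 1)) as Hj.
  { intros j. apply Hcl. apply inv_INR_pos. }
  destruct (choice _ Hj) as [phi Hphi]. exists x, phi. split; auto. split; [intros; apply Hphi|].
  intros eps He. destruct (inv_INR_lt eps He) as [J HJ]. exists J. intros j Hjj.
  rewrite dist1_sym. specialize (HJ j Hjj). pose proof (proj2 (Hphi j)). lra.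
Qed.

(** Finite nets at the scales [1 / (m + 1)], listed in one sequence. The centres need not lie in
    [K]; they only have to provide countably many balls. *)
Lemma K_dense_seq : exists h : nat -> nat -> R, forall x eps, K x -> 0 < eps -> exists k, dist1 n (h k) x < eps.
Proof.
  assert (forall m : nat, exists l : list (nat -> R), forall x, K x -> exists c, In c l /\ dist1 n c x < / (INR m + 1)) as H.
  { intros m. destruct (HKcpt (nat -> R) (fun c y => True /\ dist1 n c y < / (INR m + 1))) as [l Hl].
    - intros c. apply open_dist1_ball.
    - intros x Hx. exists x. split; auto. rewrite dist1_refl. apply inv_INR_pos.
    - exists l. intros x Hx. destruct (Hl x Hx) as (c & Hc & _ & Hd). eauto. }
  destruct (choice _ H) as [l Hl].
  exists (fun k => let (m, i) := of_nat k in nth i (l m) (fun _ => 0)).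
  intros x eps Hx He. destruct (inv_INR_lt eps He) as [m Hm]. specialize (Hm m (le_n _)).
  destruct (Hl m x Hx) as (c & Hc & Hd).
  destruct (In_nth (l m) c (fun _ => 0) Hc) as (i & _ & Hi).
  exists (to_nat (m, i)). rewrite cancel_of_to, Hi. lra.
Qed.

Definition condensation (x : nat -> R) : Prop :=
  forall eps, 0 < eps -> uncountable (fun y => K y /\ dist1 n x y < eps).

Lemma countable_subset {T} (A B : T -> Prop) : (forall x, A x -> B x) ->
  (exists h : nat -> T, forall x, B x -> exists k, h k = x) ->
  exists h : nat -> T, forall x, A x -> exists k, h k = x.
Proof. intros H [h Hh]. exists h. auto. Qed.

(** Such a point lies in one of countably many balls that meet [K] in a countable set; choice
    supplies an enumeration for each of these. *)
Lemma noncondensation_countable :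
  exists h : nat -> nat -> R, forall x, K x /\ ~ condensation x -> exists k, h k = x.
Proof.
  destruct K_dense_seq as [h Hh].
  set (V := fun (c : nat * nat) (y : nat -> R) => K y /\ dist1 n (h (fst c)) y < / (INR (snd c) + 1)).
  assert (forall c, exists e : nat -> nat -> R, ~ uncountable (V c) -> forall x, V c x -> exists k, e k = x) as H.
  { intros c. destruct (classic (uncountable (V c))) as [Hc|Hc].
    - exists (fun _ _ => 0). intros Hn. contradiction.
    - apply NNPP in Hc as [e He]. exists e. auto. }
  destruct (choice _ H) as [e He].
  exists (fun k => let (c, i) := of_nat k in e (of_nat c) i).
  intros x [Hx Hc].
  apply not_all_ex_not in Hc as [eps Hc]. apply imply_to_and in Hc as [He0 Hc].
  destruct (inv_INR_lt (eps / 2)) as [m Hm]; [lra|]. specialize (Hm m (le_n _)).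
  destruct (Hh x _ Hx (inv_INR_pos m)) as [k Hk].
  destruct (He (k, m)) with (x := x) as [i Hi].
  - intros Hun. apply Hun. apply NNPP in Hc. revert Hc. apply countable_subset.
    intros y [Hy Hy']. split; auto. simpl in Hy'. pose proof (dist1_tri n x (h k) y).
    rewrite (dist1_sym n x (h k)) in H0. lra.
  - split; auto.
  - exists (to_nat (to_nat (k, m), i)). rewrite !cancel_of_to. exact Hi.
Qed.

(** Otherwise a ball about [x] would meet [K] only in [x] and in points that are not condensation
    points, a countable set. *)
Lemma condensation_neighbour x eps : K x -> condensation x -> 0 < eps ->
  exists y, K y /\ condensation y /\ dist1 n x y < eps /\ x <> y.
Proof.
  intros Hx Hc He. apply NNPP. intros Hn. apply (Hc eps He).
  destruct noncondensation_countable as [h Hh].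
  exists (fun k => match k with O => x | S k => h k end).
  intros y [Hy Hd]. destruct (classic (x = y)) as [->|Hne]; [exists O; auto|].
  destruct (Hh y) as [k Hk].
  - split; auto. intros Hcy. apply Hn. exists y. auto.
  - exists (S k). auto.
Qed.

Hypothesis HKunc : uncountable K.

Lemma condensation_exists : exists x, K x /\ condensation x.
Proof.
  apply NNPP. intros Hn. apply HKunc. destruct noncondensation_countable as [h Hh].
  exists h. intros x Hx. apply Hh. split; auto. intros Hc. apply Hn. eauto.
Qed.

Let state := ((nat -> R) * R)%type.
Let good (s : state) : Prop := K (fst s) /\ condensation (fst s) /\ 0 < snd s.

Lemma splitting_step : exists g : state -> bool -> state, forall s, good s ->
  (forall b, good (g s b) /\ dist1 n (fst s) (fst (g s b)) <= snd s / 2 /\ snd (g s b) <= snd s / 2) /\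
  snd (g s true) = snd (g s false) /\
  2 * snd (g s true) < dist1 n (fst (g s true)) (fst (g s false)).
Proof.
  apply (choice (fun s (g : bool -> state) => good s ->
    (forall b, good (g b) /\ dist1 n (fst s) (fst (g b)) <= snd s / 2 /\ snd (g b) <= snd s / 2) /\
    snd (g true) = snd (g false) /\ 2 * snd (g true) < dist1 n (fst (g true)) (fst (g false)))).
  intros [x r]. destruct (classic (good (x, r))) as [(Hx & Hc & Hr)|Hn].
  - simpl in *. destruct (condensation_neighbour x (r / 2) Hx Hc) as (y & Hy & Hcy & Hd & Hne); [lra|].
    assert (Hp : 0 < dist1 n x y).
    { destruct (Rle_lt_or_eq_dec _ _ (dist1_nonneg n x y)) as [|E]; auto. exfalso. apply Hne.
      apply (dist1_eq0 n); auto. }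
    (* A quarter of the distance makes the two balls disjoint; half of the radius keeps them in the
       parent ball, as centres move by at most [r / 2]. *)
    set (r' := Rmin (r / 2) (dist1 n x y / 4)).
    assert (Hr' : 0 < r') by (apply Rmin_pos; lra).
    pose proof (Rmin_l (r / 2) (dist1 n x y / 4)). pose proof (Rmin_r (r / 2) (dist1 n x y / 4)).
    fold r' in H, H0.
    exists (fun b : bool => if b then (x, r') else (y, r')). intros _. simpl. split; [|split; [auto | lra]].
    intros []; simpl; unfold good; simpl; rewrite ?dist1_refl; repeat split; auto; lra.
  - exists (fun _ => (x, r)). intros; contradiction.
Qed.

(** Limits of the centres along the branches of a binary tree of nested balls with centres in [K]
    and disjoint siblings. *)
Lemma cantor_embedding : exists psi : (nat -> bool) -> nat -> R,
  (forall b, K (psi b)) /\ (forall b b', psi b = psi b' -> forall i, b i = b' i) /\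
  forall eps, 0 < eps -> exists k, forall b b', agree k b b' -> dist1 n (psi b) (psi b') < eps.
Proof.
  destruct splitting_step as [g Hg]. destruct condensation_exists as (x0 & Hx0 & Hc0).
  set (node := fix node (b : nat -> bool) (k : nat) : state :=
         match k with O => (x0, 1) | S k => g (node b k) (b k) end).
  assert (Hgood : forall b k, good (node b k)).
  { intros b. induction k; simpl; [repeat split; simpl; auto; lra|]. apply (Hg _ IHk). }
  assert (Hrad : forall b k, 0 < snd (node b k) <= (1 / 2) ^ k).
  { intros b. induction k; [simpl; lra|]. split; [apply (Hgood b (S k))|].
    destruct (Hg _ (Hgood b k)) as [H _]. specialize (H (b k)). cbn [node]. simpl pow. lra. }
  assert (Hnest : forall b k m, dist1 n (fst (node b k)) (fst (node b (k + m)%nat)) + snd (node b (k + m)%nat)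
                               <= snd (node b k)).
  { intros b k. induction m; [rewrite Nat.add_0_r, dist1_refl; lra|].
    rewrite Nat.add_succ_r. destruct (Hg _ (Hgood b (k + m)%nat)) as [H _]. specialize (H (b (k + m)%nat)).
    change (node b (S (k + m))) with (g (node b (k + m)%nat) (b (k + m)%nat)).
    pose proof (dist1_tri n (fst (node b k)) (fst (node b (k + m)%nat)) (fst (g (node b (k + m)%nat) (b (k + m)%nat)))).
    lra. }
  assert (Hlim : forall b, exists x, K x /\ forall k, dist1 n (fst (node b k)) x <= snd (node b k)).
  { intros b. destruct (K_compact (fun k => fst (node b k))) as (x & phi & Hx & Hphi & Hcv).
    { intros k. apply Hgood. }
    exists x. split; auto. intros k. apply Rnot_lt_le. intros Hlt.
    destruct (Hcv (dist1 n (fst (node b k)) x - snd (node b k))) as [J HJ]; [lra|].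
    specialize (HJ (J + k)%nat ltac:(lia)). specialize (Hphi (J + k)%nat).
    set (m := phi (J + k)%nat) in *.
    pose proof (Hnest b k (m - k)%nat). replace (k + (m - k))%nat with m in H by lia.
    pose proof (dist1_tri n (fst (node b k)) (fst (node b m)) x). pose proof (Hrad b m). lra. }
  destruct (choice _ Hlim) as [psi Hpsi].
  assert (Hnode : forall k b b', agree k b b' -> node b k = node b' k).
  { induction k; intros b b' H; simpl; auto. rewrite (H k) by lia. rewrite (IHk b b'); auto.
    intros i Hi. apply H. lia. }
  exists psi. split; [intros; apply Hpsi|]. split.
  - intros b b' E.
    assert (H : forall k, agree k b b').
    { induction k; intros i Hi; [lia|]. destruct (Nat.eq_dec i k) as [->|]; [|apply IHk; lia].
      apply NNPP. intros Hne.
      pose proof (proj2 (Hpsi b) (S k)) as P1. pose proof (proj2 (Hpsi b') (S k)) as P2.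
      rewrite <- E in P2.
      change (node b (S k)) with (g (node b k) (b k)) in P1.
      change (node b' (S k)) with (g (node b' k) (b' k)) in P2.
      rewrite <- (Hnode k b b' IHk) in P2.
      destruct (Hg _ (Hgood b k)) as (_ & Er & Hd).
      set (s := node b k) in *.
      destruct (b k) eqn:E1; destruct (b' k) eqn:E2; try congruence.
      + pose proof (dist1_tri n (fst (g s true)) (psi b) (fst (g s false))).
        rewrite (dist1_sym n (psi b)) in H. lra.
      + pose proof (dist1_tri n (fst (g s true)) (psi b) (fst (g s false))).
        rewrite (dist1_sym n (psi b)) in H. lra. }
    intros i. apply (H (S i)). lia.
  - intros eps He. destruct (pow_small (1 / 2) (eps / 2)) as [k Hk]; [lra | lra|].
    specialize (Hk k (le_n _)). exists k. intros b b' H.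
    pose proof (proj2 (Hpsi b) k) as P1. pose proof (proj2 (Hpsi b') k) as P2.
    rewrite <- (Hnode k b b' H) in P2. pose proof (Hrad b k).
    pose proof (dist1_tri n (psi b) (fst (node b k)) (psi b')). rewrite (dist1_sym n (psi b) (fst (node b k))) in H1. lra.
Qed.

End PerfectSet.

(** * Embedding and extension *)

Lemma distp_sym e e' : distp e e' = distp e' e.
Proof.
  unfold distp, dist3. rewrite (Cmod_sub_sym (fst (fst e))), (Cmod_sub_sym (snd (fst e))),
    (Cmod_sub_sym (snd e)). reflexivity.
Qed.

Lemma distp_tri e e' e'' : distp e e'' <= distp e e' + distp e' e''.
Proof.
  unfold distp, dist3.
  pose proof (Cmod_sub_tri (fst (fst e)) (fst (fst e')) (fst (fst e''))).
  pose proof (Cmod_sub_tri (snd (fst e)) (snd (fst e')) (snd (fst e''))).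
  pose proof (Cmod_sub_tri (snd e) (snd e') (snd e'')). lra.
Qed.

Lemma distp_pos e e' : e <> e' -> 0 < distp e e'.
Proof.
  intros H. unfold distp, dist3. destruct e as [[a b] w]. destruct e' as [[a' b'] w']. simpl.
  pose proof (Cmod_ge_0 (a - a')). pose proof (Cmod_ge_0 (b - b')). pose proof (Cmod_ge_0 (w - w')).
  apply Rnot_le_lt. intros Hle. apply H.
  rewrite (Cmod_sub0 a a'), (Cmod_sub0 b b'), (Cmod_sub0 w w'); auto; lra.
Qed.

(* The bits record membership in the chain classes, at all scales, of the points near a dense sequence. *)
Lemma chain_disconnected_bits (SE : pt -> Prop) :
  (forall eps, 0 < eps -> exists delta, 0 < delta /\
     forall e e', chain SE distp delta e e' -> distp e e' < eps) ->
  exists chi : pt -> nat -> bool,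
    (forall e e', SE e -> SE e' -> (forall i, chi e i = chi e' i) -> e = e') /\
    forall k, exists delta, 0 < delta /\
      forall e e', SE e -> SE e' -> distp e e' < delta -> agree k (chi e) (chi e').
Proof.
  intros Hch. destruct complex_dense_seq as [q Hq].
  set (ctr := fun i => let (j1, r) := of_nat i in let (j2, j3) := of_nat r in (q j1, q j2, q j3) : pt).
  (* The index codes a scale and a centre. Points within half the scale of the same centre are one
     step apart, so for each index at most one chain class receives the bit. *)
  set (U := fun (i : nat) (e : pt) => let (m, c) := of_nat i in
         exists e', distp e' (ctr c) < / (INR m + 1) / 2 /\ chain SE distp (/ (INR m + 1)) e e').
  exists (fun e i => if excluded_middle_informative (U i e) then true else false). split.
  - intros e e' He He' Heq. apply NNPP. intros Hne. pose proof (distp_pos e e' Hne) as Hp.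
    destruct (Hch _ Hp) as (d & Hd & Hd'). destruct (inv_INR_lt d Hd) as [m Hm].
    specialize (Hm m (le_n _)). pose proof (inv_INR_pos m) as Hm0. set (r := / (INR m + 1)) in *.
    destruct (Hq (fst (fst e)) (r / 8) O) as (j1 & _ & H1); [lra|].
    destruct (Hq (snd (fst e)) (r / 8) O) as (j2 & _ & H2); [lra|].
    destruct (Hq (snd e) (r / 8) O) as (j3 & _ & H3); [lra|].
    set (c := to_nat (j1, to_nat (j2, j3))). specialize (Heq (to_nat (m, c))).
    assert (Hc : distp e (ctr c) < r / 2).
    { unfold ctr, c. rewrite !cancel_of_to. unfold distp, dist3. cbn [fst snd].
      rewrite (Cmod_sub_sym (fst (fst e))), (Cmod_sub_sym (snd (fst e))), (Cmod_sub_sym (snd e)). lra. }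
    assert (HU : U (to_nat (m, c)) e).
    { unfold U. rewrite cancel_of_to. exists e. split; auto. apply chain_refl; auto. }
    destruct (excluded_middle_informative (U (to_nat (m, c)) e)); [|contradiction].
    destruct (excluded_middle_informative (U (to_nat (m, c)) e')) as [HU'|]; [|discriminate].
    unfold U in HU'. rewrite cancel_of_to in HU'. destruct HU' as (e2 & H4 & H5).
    fold r in H4, H5.
    assert (chain SE distp r e' e).
    { eapply chain_step; [exact H5 | auto |]. pose proof (distp_tri e2 (ctr c) e).
      rewrite (distp_sym (ctr c) e) in H. lra. }
    assert (distp e' e < distp e e'); [|rewrite distp_sym in H0; lra].
    apply Hd'. apply (chain_map SE SE distp distp (fun x => x) r d); auto. intros; lra.
  - intros k. destruct (finite_min (fun i delta => forall e e', SE e -> SE e' -> distp e e' < delta ->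
      (U i e <-> U i e'))) with (k := k) as (x & Hx & H).
    + intros i x y H Hyx e e' He He' Hd. apply H; auto. lra.
    + intros i. unfold U. destruct (of_nat i) as [m c]. exists (/ (INR m + 1)).
      split; [apply inv_INR_pos|].
      assert (Hone : forall e e', SE e -> SE e' -> distp e e' < / (INR m + 1) ->
        (exists e0, distp e0 (ctr c) < / (INR m + 1) / 2 /\ chain SE distp (/ (INR m + 1)) e e0) ->
        exists e0, distp e0 (ctr c) < / (INR m + 1) / 2 /\ chain SE distp (/ (INR m + 1)) e' e0).
      { intros e e' He He' Hd (e0 & H1 & H2). exists e0. split; auto.
        eapply chain_trans; [|exact H2].
        eapply chain_step; [apply chain_refl; auto | auto | rewrite distp_sym; auto]. }
      intros e e' He He' Hd. split; [apply Hone | apply Hone]; auto. rewrite distp_sym; auto.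
    + exists x. split; auto. intros e e' He He' Hd i Hi. specialize (H i Hi e e' He He' Hd).
      destruct (excluded_middle_informative (U i e)); destruct (excluded_middle_informative (U i e')); tauto.
Qed.

Lemma glb_exists (P : R -> Prop) m : (exists y, P y) -> (forall y, P y -> m <= y) ->
  exists g, (forall y, P y -> g <= y) /\ (forall b, (forall y, P y -> b <= y) -> b <= g).
Proof.
  intros [y0 Hy0] Hm.
  destruct (completeness (fun y => P (- y))) as [s [H1 H2]].
  - exists (- m). intros y Hy. specialize (Hm _ Hy). lra.
  - exists (- y0). rewrite Ropp_involutive. auto.
  - exists (- s). split.
    + intros y Hy. assert (- y <= s); [|lra]. apply H1. rewrite Ropp_involutive. auto.
    + intros b Hb. assert (s <= - b); [|lra]. apply H2. intros y Hy. specialize (Hb _ Hy). lra.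
Qed.

(* McShane extension for the concave modulus [inf_k (1/(k+1) + L_k d)]. *)
Lemma uniform_extension {T : Type} (S : T -> Prop) (phi : T -> nat -> R) n (v : T -> R) B :
  (exists e, S e) -> (forall e, S e -> Rabs (v e) <= B) ->
  (forall eps, 0 < eps -> exists delta, 0 < delta /\
     forall e e', S e -> S e' -> dist1 n (phi e) (phi e') < delta -> Rabs (v e - v e') < eps) ->
  exists F : (nat -> R) -> R, (forall e, S e -> F (phi e) = v e) /\
    forall eps, 0 < eps -> exists delta, 0 < delta /\
      forall x y, dist1 n x y < delta -> Rabs (F x - F y) < eps.
Proof.
  intros [e0 He0] HB Huc.
  assert (HB0 : 0 <= B) by (eapply Rle_trans; [apply Rabs_pos | apply (HB e0 He0)]).
  assert (forall k : nat, exists L, 0 <= L /\ forall e e', S e -> S e' ->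
            v e <= v e' + / (INR k + 1) + L * dist1 n (phi e) (phi e')) as HL.
  { intros k. pose proof (inv_INR_pos k). destruct (Huc _ H) as (d & Hd & Hd').
    exists (2 * B / d). split; [apply Rmult_le_pos; [lra | left; apply Rinv_0_lt_compat; auto]|].
    intros e e' He He'. pose proof (HB e He) as B1. pose proof (HB e' He') as B2.
    apply abs_le_between in B1. apply abs_le_between in B2.
    pose proof (dist1_nonneg n (phi e) (phi e')).
    destruct (Rlt_le_dec (dist1 n (phi e) (phi e')) d) as [Hlt|Hle].
    - specialize (Hd' e e' He He' Hlt). apply Rabs_def2 in Hd'.
      assert (0 <= 2 * B / d * dist1 n (phi e) (phi e')).
      { apply Rmult_le_pos; auto. apply Rmult_le_pos; [lra | left; apply Rinv_0_lt_compat; auto]. }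
      lra.
    - assert (2 * B <= 2 * B / d * dist1 n (phi e) (phi e')); [|lra].
      replace (2 * B) with (2 * B / d * d) at 1 by (field; lra).
      apply Rmult_le_compat_l; auto. apply Rmult_le_pos; [lra | left; apply Rinv_0_lt_compat; auto]. }
  destruct (choice _ HL) as [L HL'].
  assert (HF : forall x, exists g,
    (forall e k, S e -> g <= v e + / (INR k + 1) + L k * dist1 n x (phi e)) /\
    (forall b, (forall e k, S e -> b <= v e + / (INR k + 1) + L k * dist1 n x (phi e)) -> b <= g)).
  { intros x.
    destruct (glb_exists (fun y => exists e k, S e /\ y = v e + / (INR k + 1) + L k * dist1 n x (phi e)) (- B))
      as (g & G1 & G2).
    - exists (v e0 + / (INR 0 + 1) + L O * dist1 n x (phi e0)), e0, O. auto.
    - intros y (e & k & He & ->). specialize (HB e He). apply abs_le_between in HB.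
      pose proof (inv_INR_pos k). pose proof (dist1_nonneg n x (phi e)). destruct (HL' k) as [HLk _].
      assert (0 <= L k * dist1 n x (phi e)) by (apply Rmult_le_pos; auto). lra.
    - exists g. split.
      + intros e k He. apply G1. eauto.
      + intros b Hb. apply G2. intros y (e & k & He & ->). auto. }
  destruct (choice _ HF) as [F HF']. exists F. split.
  - intros e He. destruct (HF' (phi e)) as [G1 G2]. apply Rle_antisym.
    + apply Rnot_lt_le. intros Hlt. destruct (inv_INR_lt (F (phi e) - v e)) as [k Hk]; [lra|].
      specialize (Hk k (le_n _)). specialize (G1 e k He). rewrite dist1_refl in G1. lra.
    + apply G2. intros e' k He'. apply HL'; auto.
  - assert (Hone : forall x y k, F x <= F y + (/ (INR k + 1) + L k * dist1 n x y)).
    { intros x y k. destruct (HF' x) as [G1 _]. destruct (HF' y) as [_ G2].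
      assert (F x - (/ (INR k + 1) + L k * dist1 n x y) <= F y); [|lra].
      apply G2. intros e m He. pose proof (dist1_tri n x y (phi e)) as Ht.
      destruct (HL' k) as [Lk _]. destruct (HL' m) as [Lm _].
      pose proof (dist1_nonneg n x y). pose proof (dist1_nonneg n y (phi e)).
      pose proof (inv_INR_pos k). pose proof (inv_INR_pos m).
      destruct (Rle_dec (L m) (L k)) as [Hle|Hle].
      - specialize (G1 e m He).
        assert (L m * dist1 n x (phi e) <= L m * (dist1 n x y + dist1 n y (phi e))) by (apply Rmult_le_compat_l; lra).
        assert (L m * dist1 n x y <= L k * dist1 n x y) by (apply Rmult_le_compat_r; lra). lra.
      - specialize (G1 e k He).
        assert (L k * dist1 n x (phi e) <= L k * (dist1 n x y + dist1 n y (phi e))) by (apply Rmult_le_compat_l; lra).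
        assert (L k * dist1 n y (phi e) <= L m * dist1 n y (phi e)) by (apply Rmult_le_compat_r; lra). lra. }
    intros eps He. destruct (inv_INR_lt (eps / 2)) as [k Hk]; [lra|]. specialize (Hk k (le_n _)).
    destruct (HL' k) as [Lk _].
    exists (eps / 2 / (L k + 1)). split; [apply Rdiv_lt_0_compat; lra|]. intros x y Hd.
    pose proof (dist1_nonneg n x y).
    assert (L k * dist1 n x y < eps / 2).
    { apply Rle_lt_trans with ((L k + 1) * dist1 n x y); [nra|].
      apply Rlt_le_trans with ((L k + 1) * (eps / 2 / (L k + 1))); [|right; field; lra].
      apply Rmult_lt_compat_l; lra. }
    pose proof (Hone x y k). pose proof (Hone y x k). rewrite (dist1_sym n y x) in H2.
    apply Rabs_def1; lra.
Qed.

Lemma distance_function {T : Type} (S : T -> Prop) (phi : T -> nat -> R) n : (exists e, S e) ->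
  exists t : (nat -> R) -> R, (forall x, 0 <= t x) /\ (forall x y, Rabs (t x - t y) <= dist1 n x y) /\
    (forall e, S e -> t (phi e) = 0) /\
    (forall x eps, 0 < eps -> exists e, S e /\ dist1 n x (phi e) < t x + eps).
Proof.
  intros [e0 He0].
  assert (H : forall x, exists g, (forall e, S e -> g <= dist1 n x (phi e)) /\
             (forall b, (forall e, S e -> b <= dist1 n x (phi e)) -> b <= g)).
  { intros x. destruct (glb_exists (fun y => exists e, S e /\ y = dist1 n x (phi e)) 0) as (g & G1 & G2).
    - exists (dist1 n x (phi e0)), e0. auto.
    - intros y (e & _ & ->). apply dist1_nonneg.
    - exists g. split; [intros e He; apply G1; eauto|].
      intros b Hb. apply G2. intros y (e & He & ->). auto. }
  destruct (choice _ H) as [t Ht]. exists t.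
  assert (H0 : forall x, 0 <= t x) by (intros x; apply Ht; intros; apply dist1_nonneg).
  split; auto. split.
  - assert (Hone : forall x y, t x <= t y + dist1 n x y).
    { intros x y. assert (t x - dist1 n x y <= t y); [|lra]. apply Ht. intros e He.
      pose proof (proj1 (Ht x) e He). pose proof (dist1_tri n x y (phi e)). lra. }
    intros x y. pose proof (Hone x y). pose proof (Hone y x). rewrite (dist1_sym n y x) in *.
    apply Rabs_le. lra.
  - split.
    + intros e He. apply Rle_antisym; auto. rewrite <- (dist1_refl n (phi e)). apply Ht; auto.
    + intros x eps He. apply NNPP. intros Hn. assert (t x + eps <= t x); [|lra]. apply Ht.
      intros e Hs. apply Rnot_lt_le. intros Hlt. apply Hn. eauto.
Qed.

(** * Hulls over real coordinates *)

Lemma poly_continuous_at N p z : is_poly N p -> forall eps, 0 < eps -> exists delta, 0 < delta /\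
  forall w, (forall i, (i < N)%nat -> Cmod (z i - w i) < delta) -> Cmod (p z - p w) < eps.
Proof.
  intros Hp eps He. set (B := rsum N (fun i => Cmod (z i)) + 1).
  destruct (poly_bounded_lipschitz N p Hp B) as (L & HL & HLip).
  assert (Hz : forall i, (i < N)%nat -> Cmod (z i) <= B - 1).
  { intros i Hi. unfold B. pose proof (rsum_term N (fun i => Cmod (z i)) i (fun j _ => Cmod_ge_0 (z j)) Hi).
    simpl in H. lra. }
  pose proof (pos_INR N).
  assert (H0 : 0 <= INR N * L) by (apply Rmult_le_pos; auto).
  set (d := Rmin 1 (eps / (INR N * L + 1))).
  assert (Hd' : 0 < eps / (INR N * L + 1)) by (apply Rdiv_lt_0_compat; lra).
  assert (Hd : 0 < d) by (apply Rmin_pos; lra).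
  assert (Hd1 : d <= 1) by apply Rmin_l. assert (Hd2 : d <= eps / (INR N * L + 1)) by apply Rmin_r.
  exists d. split; auto. intros w Hw.
  destruct (HLip z w) as [_ H1].
  - intros i Hi. specialize (Hz i Hi). lra.
  - intros i Hi. specialize (Hz i Hi). specialize (Hw i Hi). pose proof (Cmod_le_add (w i) (z i)).
    rewrite (Cmod_sub_sym (w i)) in H1. lra.
  - eapply Rle_lt_trans; [apply H1|].
    assert (rsum N (fun i => Cmod (z i - w i)) <= INR N * d).
    { rewrite <- rsum_const. apply rsum_le. intros i Hi. left. auto. }
    apply Rle_lt_trans with (L * (INR N * d)); [apply Rmult_le_compat_l; auto|].
    apply Rle_lt_trans with (INR N * L * (eps / (INR N * L + 1))).
    + replace (L * (INR N * d)) with (INR N * L * d) by ring. apply Rmult_le_compat_l; auto.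
    + apply Rlt_le_trans with ((INR N * L + 1) * (eps / (INR N * L + 1))); [|right; field; lra].
      apply Rmult_lt_compat_r; lra.
Qed.

Section RealFibres.

Variables (n : nat) (K : (nat -> R) -> Prop).
Hypothesis HKcpt : is_compact_in (distR n) K.
Variables (N : nat) (G : (nat -> R) -> nat -> C) (B : R).
Hypothesis G_continuous : forall x, K x -> forall eps, 0 < eps -> exists delta, 0 < delta /\
  forall y, K y -> dist1 n x y < delta -> forall i, (i < N)%nat -> Cmod (G x i - G y i) < eps.
Hypothesis G_real : forall x i, K x -> (3 <= i)%nat -> snd (G x i) = 0.
Hypothesis G_bound : forall x i, K x -> (3 <= i)%nat -> Cmod (G x i) <= B.

Definition image_of (z : nat -> C) : Prop := exists x, K x /\ z = G x.

Lemma poly_G_continuous p : is_poly N p -> forall x, K x -> forall eps, 0 < eps ->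
  exists delta, 0 < delta /\ forall y, K y -> dist1 n y x < delta -> Cmod (p (G x) - p (G y)) < eps.
Proof.
  intros Hp x Hx eps He. destruct (poly_continuous_at N p (G x) Hp eps He) as (e & He' & H1).
  destruct (G_continuous x Hx e He') as (d & Hd & H2). exists d. split; auto. intros y Hy Hxy.
  apply H1. apply H2; auto. rewrite dist1_sym. auto.
Qed.

(** For [a + i b] the value of the coordinate at [v], the polynomial [1 - (u_i - a)^2 / L] lies in
    [0, 1] on the image, where [u_i] is real and bounded, but equals [1 + b^2 / L] at [v]. *)
Lemma hull_real v i : poly_hull N image_of v -> (3 <= i < N)%nat -> snd (v i) = 0.
Proof.
  intros [_ Hv] Hi. set (a := fst (v i)). set (b := snd (v i)).
  set (L := (Rabs B + Rabs a) ^ 2 + 1).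
  assert (HL : 1 <= L) by (unfold L; pose proof (pow2_ge_0 (Rabs B + Rabs a)); lra).
  assert (HiL : 0 < / L) by (apply Rinv_0_lt_compat; lra).
  set (p := fun u : nat -> C => (RtoC 1 - RtoC (/ L) * ((u i - RtoC a) * (u i - RtoC a)))%C).
  assert (Hp : is_poly N p).
  { assert (is_poly N (fun u => u i)) by (apply poly_coord; lia).
    repeat first [apply poly_minus | apply poly_times | apply poly_cst | assumption]. }
  assert (H : Cmod (p v) <= 1).
  { apply (Hv p Hp). intros z (x & Hx & ->). change (Cmod (p (G x)) <= 1).
    pose proof (G_real x i Hx ltac:(lia)) as Hr. pose proof (G_bound x i Hx ltac:(lia)) as Hb.
    unfold p. rewrite (surjective_pairing (G x i)), Hr. set (s := fst (G x i)).
    assert (Hs : Rabs s <= Rabs B).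
    { eapply Rle_trans; [apply fst_le_Cmod|]. eapply Rle_trans; [apply Hb | apply Rle_abs]. }
    assert (E : (RtoC 1 - RtoC (/ L) * (((s, 0) - RtoC a) * ((s, 0) - RtoC a)))%C =
                RtoC (1 - / L * ((s - a) * (s - a)))).
    { unfold RtoC, Cminus, Cplus, Copp, Cmult; simpl. f_equal; ring. }
    rewrite E, Cmod_R.
    assert (Hsa : (s - a) * (s - a) <= L).
    { assert (Rabs (s - a) <= Rabs B + Rabs a).
      { unfold Rminus. eapply Rle_trans; [apply Rabs_triang|]. rewrite Rabs_Ropp. lra. }
      replace ((s - a) * (s - a)) with (Rabs (s - a) ^ 2) by (rewrite pow2_abs; ring).
      unfold L. apply Rle_trans with ((Rabs B + Rabs a) ^ 2); [|lra].
      apply pow_incr. split; [apply Rabs_pos | auto]. }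
    assert (/ L * ((s - a) * (s - a)) <= 1).
    { replace 1 with (/ L * L) by (field; lra). apply Rmult_le_compat_l; lra. }
    assert (0 <= / L * ((s - a) * (s - a))) by (apply Rmult_le_pos; [lra | apply Rle_0_sqr]).
    apply Rabs_le. lra. }
  assert (E : p v = RtoC (1 + / L * (b * b))).
  { unfold p. rewrite (surjective_pairing (v i)). fold a b.
    unfold RtoC, Cminus, Cplus, Copp, Cmult; simpl. f_equal; ring. }
  rewrite E, Cmod_R in H. pose proof (Rle_abs (1 + / L * (b * b))).
  pose proof (Rle_0_sqr b). unfold Rsqr in *. fold b. assert (b * b <= 0) by (apply Rmult_le_reg_l with (/ L); lra). nra.
Qed.

Fixpoint sum_sq (tau : nat -> C) (m : nat) (u : nat -> C) : C :=
  match m with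
  | O => RtoC 0
  | S m => (sum_sq tau m u + (u (3 + m)%nat - tau (3 + m)%nat) * (u (3 + m)%nat - tau (3 + m)%nat))%C
  end.

Lemma poly_sum_sq tau m : (3 + m <= N)%nat -> is_poly N (sum_sq tau m).
Proof.
  induction m; intros Hm; simpl; [apply poly_cst|].
  assert (is_poly N (fun u => u (S (S (S m))))) by (apply poly_coord; lia).
  apply poly_plus; [apply IHm; lia|].
  apply poly_times; apply poly_minus; auto; apply poly_cst.
Qed.

Lemma sum_sq_real tau m u : (forall i, (i < m)%nat -> snd (u (3 + i)%nat) = 0 /\ snd (tau (3 + i)%nat) = 0) ->
  sum_sq tau m u = RtoC (rsum m (fun i => (fst (u (3 + i)%nat) - fst (tau (3 + i)%nat)) ^ 2)).
Proof.
  induction m; intros H; cbn [sum_sq rsum]; auto.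
  rewrite IHm by (intros; apply H; lia). rewrite RtoC_plus. f_equal.
  destruct (H m ltac:(lia)) as [H1 H2].
  rewrite (surjective_pairing (u (3 + m)%nat)), (surjective_pairing (tau (3 + m)%nat)), H1, H2.
  unfold RtoC, Cminus, Cplus, Copp, Cmult; simpl. f_equal; ring.
Qed.

(* Multiplication by powers of [1 - sum (u_i - v_i)^2 / L], which peaks on the real fibre through [v],
   localises hull membership to that fibre. *)
Lemma hull_fibre v p M : (3 <= N)%nat -> poly_hull N image_of v -> is_poly N p -> 0 <= M ->
  (forall x, K x -> (forall i, (3 <= i < N)%nat -> G x i = v i) -> Cmod (p (G x)) <= M) ->
  Cmod (p v) <= M.
Proof.
  intros HN Hv Hp HM HpM. apply Rnot_lt_le. intros Hlt.
  set (m := (N - 3)%nat).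
  assert (Hreal : forall i, (i < m)%nat -> snd (v (3 + i)%nat) = 0).
  { intros i Hi. apply hull_real; auto. unfold m in Hi. lia. }
  assert (Hvb : forall i, (i < m)%nat -> Cmod (v (3 + i)%nat) <= Rabs B).
  { intros i Hi. apply (proj2 Hv (fun u => u (3 + i)%nat)).
    - apply poly_coord. unfold m in Hi. lia.
    - intros z (x & Hx & ->). eapply Rle_trans; [apply G_bound; auto; lia | apply Rle_abs]. }
  set (L := INR m * (2 * Rabs B) ^ 2 + 1).
  assert (HL : 1 <= L).
  { unfold L. pose proof (pos_INR m). pose proof (pow2_ge_0 (2 * Rabs B)).
    assert (0 <= INR m * (2 * Rabs B) ^ 2) by (apply Rmult_le_pos; auto). lra. }
  assert (HiL : 0 < / L) by (apply Rinv_0_lt_compat; lra).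
  set (q := fun u : nat -> C => (RtoC 1 - RtoC (/ L) * sum_sq v m u)%C).
  assert (Hq : is_poly N q).
  { apply poly_minus; [apply poly_cst|]. apply poly_times; [apply poly_cst|].
    apply poly_sum_sq. unfold m. lia. }
  set (S2 := fun x => rsum m (fun i => (fst (G x (3 + i)%nat) - fst (v (3 + i)%nat)) ^ 2)).
  assert (HqG : forall x, K x -> q (G x) = RtoC (1 - / L * S2 x) /\ 0 <= / L * S2 x <= 1).
  { intros x Hx. split.
    - unfold q. rewrite sum_sq_real.
      + fold (S2 x). rewrite RtoC_minus, RtoC_mult. reflexivity.
      + intros i Hi. split; [apply G_real; auto; lia | auto].
    - assert (0 <= S2 x) by (apply rsum_nonneg; intros; apply pow2_ge_0).
      assert (S2 x <= L).
      { unfold L, S2. apply Rle_trans with (INR m * (2 * Rabs B) ^ 2); [|lra].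
        rewrite <- rsum_const. apply rsum_le. intros i Hi.
        rewrite <- pow2_abs. apply pow_incr. split; [apply Rabs_pos|].
        unfold Rminus. eapply Rle_trans; [apply Rabs_triang|]. rewrite Rabs_Ropp.
        pose proof (fst_le_Cmod (G x (3 + i)%nat)). pose proof (fst_le_Cmod (v (3 + i)%nat)).
        pose proof (G_bound x (3 + i)%nat Hx ltac:(lia)). pose proof (Hvb i Hi).
        pose proof (Rle_abs B). lra. }
      split; [apply Rmult_le_pos; lra|].
      replace 1 with (/ L * L) by (field; lra). apply Rmult_le_compat_l; lra. }
  assert (Hqv : q v = RtoC 1).
  { unfold q. rewrite sum_sq_real by auto.
    rewrite (rsum_ext m _ (fun _ => 0)); [rewrite rsum_const | intros; ring].
    rewrite Rmult_0_r. ring. }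
  set (eps := (Cmod (p v) - M) / 2). assert (He : 0 < eps) by (unfold eps; lra).
  (* Since [q v = 1], a failure of the conclusion makes [p * q ^ k] exceed [M + eps] somewhere on
     the image for every [k]. *)
  assert (Hex : forall k, exists x, K x /\ M + eps <= Cmod (p (G x)) * Cmod (q (G x)) ^ k).
  { intros k. apply NNPP. intros Hn.
    assert (Cmod (p v * q v ^ k) <= M + eps).
    { apply (proj2 Hv (fun u => p u * q u ^ k)%C).
      - apply poly_times; auto. apply poly_pow; auto.
      - intros z (x & Hx & ->). change (Cmod (p (G x) * q (G x) ^ k) <= M + eps).
        rewrite Cmod_mult, Cmod_pow. apply Rnot_lt_le. intros Hl. apply Hn. exists x. split; auto. lra. }
    rewrite Hqv, Cpow_1_l, Cmult_1_r in H. unfold eps in *. lra. }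
  destruct (choice _ Hex) as [u Hu].
  destruct (K_compact n K HKcpt u (fun k => proj1 (Hu k))) as (x & phi & Hx & Hphi & Hcv).
  assert (Hq1 : forall k, Cmod (q (G (u k))) <= 1).
  { intros k. destruct (HqG (u k) (proj1 (Hu k))) as [-> ?]. rewrite Cmod_R. apply Rabs_le. lra. }
  assert (Hpx : M + eps <= Cmod (p (G x))).
  { apply Rnot_lt_le. intros Hl.
    destruct (poly_G_continuous p Hp x Hx (M + eps - Cmod (p (G x)))) as (d & Hd & H1); [lra|].
    destruct (Hcv d Hd) as [J HJ]. specialize (H1 _ (proj1 (Hu (phi J))) (HJ J (le_n _))).
    destruct (Hu (phi J)) as [_ H2].
    assert (Cmod (q (G (u (phi J)))) ^ phi J <= 1).
    { rewrite <- (pow1 (phi J)). apply pow_incr. split; [apply Cmod_ge_0 | apply Hq1]. }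
    pose proof (Cmod_ge_0 (p (G (u (phi J))))).
    assert (Cmod (p (G (u (phi J)))) * Cmod (q (G (u (phi J)))) ^ phi J <= Cmod (p (G (u (phi J)))) * 1)
      by (apply Rmult_le_compat_l; auto).
    pose proof (Cmod_le_add (p (G (u (phi J)))) (p (G x))). rewrite Cmod_sub_sym in H4. lra. }
  destruct (HqG x Hx) as [Eq Hb].
  (* A limit point on the fibre of [v] contradicts [HpM]. Off the fibre, [q] is bounded below 1 near
     the limit point, so its powers tend to 0 while [p] stays bounded. *)
  destruct (Req_dec (S2 x) 0) as [E0|E0].
  - assert (Cmod (p (G x)) <= M); [|lra]. apply HpM; auto. intros i Hi.
    assert (Ei : fst (G x i) = fst (v i)).
    { assert (H : (fst (G x (3 + (i - 3))%nat) - fst (v (3 + (i - 3))%nat)) ^ 2 <= S2 x).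
      { apply (rsum_term m (fun i => (fst (G x (3 + i)%nat) - fst (v (3 + i)%nat)) ^ 2)).
        - intros; apply pow2_ge_0.
        - unfold m. lia. }
      replace (3 + (i - 3))%nat with i in H by lia. rewrite E0 in H. nra. }
    rewrite (surjective_pairing (G x i)), (surjective_pairing (v i)), Ei.
    f_equal. rewrite G_real by (auto; lia). symmetry. apply hull_real; auto.
  - assert (H0 : 0 < S2 x).
    { assert (0 <= S2 x) by (apply rsum_nonneg; intros; apply pow2_ge_0). lra. }
    set (th := 1 - / L * S2 x) in *.
    assert (Hth : 0 <= th < 1).
    { unfold th. assert (0 < / L * S2 x) by (apply Rmult_lt_0_compat; auto). lra. }
    set (th' := (1 + th) / 2). assert (Hth' : 0 <= th' < 1) by (unfold th'; lra).
    set (P := Cmod (p (G x)) + 1). assert (HP : 0 < P) by (unfold P; pose proof (Cmod_ge_0 (p (G x))); lra).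
    destruct (poly_G_continuous p Hp x Hx 1) as (d1 & Hd1 & H1); [lra|].
    destruct (poly_G_continuous q Hq x Hx (th' - th)) as (d2 & Hd2 & H2); [unfold th'; lra|].
    destruct (Hcv (Rmin d1 d2)) as [J HJ]; [apply Rmin_pos; auto|].
    destruct (pow_small th' (eps / P) Hth') as [J' HJ']; [apply Rdiv_lt_0_compat; lra|].
    set (j := (J + J')%nat). specialize (HJ j ltac:(lia)).
    pose proof (Rmin_l d1 d2). pose proof (Rmin_r d1 d2). destruct (Hu (phi j)) as [HK Huj].
    specialize (H1 _ HK ltac:(lra)). specialize (H2 _ HK ltac:(lra)).
    pose proof (Cmod_le_add (p (G (u (phi j)))) (p (G x))) as H5. rewrite Cmod_sub_sym in H5.
    pose proof (Cmod_le_add (q (G (u (phi j)))) (q (G x))) as H6. rewrite Cmod_sub_sym in H6.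
    assert (Hqx : Cmod (q (G x)) = th) by (rewrite Eq, Cmod_R, Rabs_pos_eq; lra).
    assert (Hqj : Cmod (q (G (u (phi j)))) ^ phi j <= th' ^ phi j).
    { apply pow_incr. split; [apply Cmod_ge_0 | lra]. }
    specialize (HJ' (phi j)). specialize (Hphi j). specialize (HJ' ltac:(lia)).
    assert (Cmod (p (G (u (phi j)))) * Cmod (q (G (u (phi j)))) ^ phi j <= P * th' ^ phi j).
    { apply Rmult_le_compat; auto; [apply Cmod_ge_0 | apply pow_le, Cmod_ge_0 | unfold P; lra]. }
    assert (P * th' ^ phi j < P * (eps / P)) by (apply Rmult_lt_compat_l; auto).
    replace (P * (eps / P)) with eps in H7 by (field; lra). lra.
Qed.

End RealFibres.

(** * Choice of the branch points, and summary of the tower *)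

Lemma branch_points_exist : exists al : nat -> C, (forall j, Cmod (al j) <= 201) /\
  forall z eps J (fl : bool), Cmod z <= 200 -> 0 < eps ->
    exists j, (J <= j)%nat /\ Nat.even j = fl /\ Cmod (al j - z) < eps.
Proof.
  destruct complex_dense_seq as [q Hq].
  (* Halving the index puts every dense point at an even and at an odd place. Points beyond 201
     become 0; approximants within 1 of a point of modulus at most 200 are not affected. *)
  exists (fun j => if Rle_dec (Cmod (q (Nat.div2 j))) 201 then q (Nat.div2 j) else RtoC 0). split.
  - intros j. destruct (Rle_dec _ _); auto. rewrite Cmod_0. lra.
  - intros z eps J fl Hz He. destruct (Hq z (Rmin eps 1) J) as (m & Hm & Hd); [apply Rmin_pos; lra|].
    pose proof (Rmin_l eps 1). pose proof (Rmin_r eps 1). pose proof (Cmod_le_add (q m) z).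
    exists (if fl then 2 * m else S (2 * m))%nat.
    assert (Hdiv : Nat.div2 (if fl then 2 * m else S (2 * m))%nat = m).
    { destruct fl; [apply Nat.div2_double | apply Nat.div2_succ_double]. }
    rewrite Hdiv. split; [destruct fl; lia|]. split.
    + destruct fl; [apply Nat.even_even | ].
      replace (S (2 * m)) with (2 * m + 1)%nat by lia. apply Nat.even_odd.
    + destruct (Rle_dec _ _); lra.
Qed.

(** [SE] is the compact set in C^3, and [Y] a larger set that contains every point obeying the
    bounds on the base coordinates and on all [Yp]. These bounds hold on the hull of [SE], so
    excluding discs from [Y] makes a description of that hull unnecessary. *)
Record tower_cantor (N : nat) (SE Y : pt -> Prop) (Yp : nat -> (nat -> C) -> C) : Prop := {
  tc_nonempty : exists e, SE e;
  tc_bounded : forall e, SE e -> Cmod (fst (fst e)) <= 200 /\ Cmod (snd (fst e)) <= 200 /\ Cmod (snd e) <= 200;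
  tc_compact : forall u : nat -> pt, (forall k, SE (u k)) -> exists e phi, (forall j, (j <= phi j)%nat) /\ SE e /\
    forall eps, 0 < eps -> exists J, forall j, (J <= j)%nat -> distp (u (phi j)) e < eps;
  tc_chain : forall eps, 0 < eps -> exists delta, 0 < delta /\
    forall e e', chain SE distp delta e e' -> distp e e' < eps;
  tc_hull : exists a b w, hull3 N (fun a b w => SE (a, b, w)) a b w /\ ~ SE (a, b, w);
  tc_poly : forall j, is_poly N (Yp j);
  tc_poly_bound : forall j e, SE e -> Cmod (Yp j (pt3 (fst (fst e)) (snd (fst e)) (snd e))) <= 100;
  tc_no_disc : forall A B W : C -> C,
    (forall t, Cmod t < 1 -> Y (A t, B t, W t)) ->
    (forall t, Cmod t < 1 -> exists l, deriv_at A t l) ->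
    (forall t, Cmod t < 1 -> exists l, deriv_at B t l) ->
    (forall t, Cmod t < 1 -> exists l, deriv_at W t l) ->
    forall t, Cmod t < 1 -> A t = A (RtoC 0) /\ B t = B (RtoC 0) /\ W t = W (RtoC 0);
  tc_Y : forall v : nat -> C, Cmod (v 0%nat) <= 200 -> Cmod (v 1%nat) <= 200 ->
    (forall j, Cmod (Yp j v) <= 100) -> Y (v 0%nat, v 1%nat, v 2%nat) }.

Lemma tower_cantor_exists N : (3 <= N)%nat -> exists SE Y Yp, tower_cantor N SE Y Yp.
Proof.
  intros HN. destruct branch_points_exist as (al & Hal & Hden).
  destruct planar_cantor_exists as [E0 HE0].
  set (SE := fun e : pt => Etower al E0 (fst (fst e)) (snd (fst e)) (snd e)).
  exists SE, (in_tower al), (fun j v => tower al j 0 (v 0%nat) (v 1%nat) (v 2%nat)).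
  destruct (Etower_hull al Hal E0 HE0 N HN) as [w Hw].
  split.
  - apply NNPP. intros Hn.
    assert (Cmod (RtoC 1) <= -1).
    { apply (Hw (fun _ => RtoC 1) (poly_cst N (RtoC 1))). intros a b v H. exfalso. apply Hn.
      exists (a, b, v). exact H. }
    rewrite Cmod_1 in H. lra.
  - intros e He. apply (Etower_bounds al E0 HE0 _ _ _ He).
  - intros u Hu.
    destruct (Etower_compact al E0 HE0 (fun k => fst (fst (u k))) (fun k => snd (fst (u k)))
                (fun k => snd (u k)) Hu) as (a & b & v & phi & Hphi & HE & Ca & Cb & Cw).
    exists (a, b, v), phi. split; auto. split; auto. intros eps He.
    destruct (Ca (eps / 3)) as [J1 H1]; [lra|]. destruct (Cb (eps / 3)) as [J2 H2]; [lra|].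
    destruct (Cw (eps / 3)) as [J3 H3]; [lra|]. exists (J1 + J2 + J3)%nat. intros j Hj.
    specialize (H1 j ltac:(lia)). specialize (H2 j ltac:(lia)). specialize (H3 j ltac:(lia)).
    unfold distp, dist3. cbn [fst snd]. lra.
  - apply (Etower_chain al E0 HE0).
  - exists (RtoC 0), (RtoC 1), w. split; [exact Hw|]. intros [H _]. apply (pc_notin _ HE0 H).
  - intros j. apply poly_tower0; auto.
  - intros j e [_ He]. apply He.
  - intros A B W H1 H2 H3 H4. apply (disc_constant al Hden A B W H1 H2 H3 H4).
  - intros v H1 H2 H3. split; [exact H1 | split; [exact H2 | exact H3]].
Qed.

(** * The embedding of [K] and the hull of its image *)

Lemma distC_le N (z w : nat -> C) eps : 0 <= eps -> (forall i, (i < N)%nat -> Cmod (z i - w i) <= eps) ->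
  distC N z w <= INR N * eps.
Proof.
  intros He H. eapply Rle_trans.
  - apply (sqrt_rsum_sq_le N (fun i => Cmod (z i - w i))). intros; apply Cmod_ge_0.
  - rewrite <- rsum_const. apply rsum_le. auto.
Qed.

Lemma le_distC N (z w : nat -> C) i : (i < N)%nat -> Cmod (z i - w i) <= distC N z w.
Proof.
  intros Hi. apply (term_le_sqrt_rsum_sq N (fun i => Cmod (z i - w i))); auto. apply Cmod_ge_0.
Qed.

Theorem theorem1p1 (n : nat) (K : (nat -> R) -> Prop)
  (HKsub : forall x, K x -> in_Rn n x)
  (HKcpt : is_compact_in (distR n) K)
  (HKunc : uncountable K) :
  exists X : (nat -> Cx) -> Prop,
    (forall z, X z -> in_Cn (n + 4) z) /\
    homeomorphic (n + 4) n X K /\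
    (exists z, poly_hull (n + 4) X z /\ ~ X z) /\
    contains_no_analytic_disc (n + 4) (poly_hull (n + 4) X).
Proof.
  set (N := (n + 4)%nat). assert (HN : (3 <= N)%nat) by (unfold N; lia).
  destruct (tower_cantor_exists N HN) as (SE & Y & Yp & HT).
  destruct (chain_disconnected_bits SE (tc_chain _ _ _ _ HT)) as (chi & chi_inj & chi_cont).
  destruct (cantor_embedding n K HKsub HKcpt HKunc) as (psi & psi_K & psi_inj & psi_cont).
  set (phi := fun e => psi (chi e)).
  assert (phi_inj : forall e e', SE e -> SE e' -> phi e = phi e' -> e = e').
  { intros e e' He He' E. exact (chi_inj e e' He He' (psi_inj _ _ E)). }
  assert (phi_cont : forall eps, 0 < eps -> exists delta, 0 < delta /\
            forall e e', SE e -> SE e' -> distp e e' < delta -> dist1 n (phi e) (phi e') < eps).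
  { intros eps He. destruct (psi_cont eps He) as [k Hk]. destruct (chi_cont k) as (d & Hd & H).
    exists d. split; auto. intros. apply Hk. auto. }
  assert (phi_lim : forall u phi' e x, (forall k, SE (u k)) -> SE e -> K x ->
            (forall eps, 0 < eps -> exists J, forall j, (J <= j)%nat -> distp (u (phi' j : nat)) e < eps) ->
            (forall eps J, 0 < eps -> exists j, (J <= j)%nat /\ dist1 n x (phi (u (phi' j))) < eps) ->
            x = phi e).
  { intros u f e x Hu He Hx Hcv Hd. apply (dist1_eq0 n); auto; [apply HKsub, psi_K|].
    apply Rle_antisym; [|apply dist1_nonneg]. apply Rnot_lt_le. intros Hlt.
    set (eps := dist1 n x (phi e) / 2). assert (He0 : 0 < eps) by (unfold eps; lra).
    destruct (phi_cont eps He0) as (d & Hd0 & H). destruct (Hcv d Hd0) as [J HJ].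
    destruct (Hd eps J He0) as (j & Hj & Hj'). specialize (H _ _ (Hu (f j)) He (HJ j Hj)).
    pose proof (dist1_tri n x (phi (u (f j))) (phi e)). unfold eps in *. lra. }
  (* A continuous injection of a compact set has a uniformly continuous inverse; the extension of
     that inverse to all of R^n needs the uniformity. *)
  assert (phi_inv : forall eps, 0 < eps -> exists delta, 0 < delta /\
            forall e e', SE e -> SE e' -> dist1 n (phi e) (phi e') < delta -> distp e e' < eps).
  { intros eps He. apply NNPP. intros Hn.
    assert (forall k : nat, exists q : pt * pt, SE (fst q) /\ SE (snd q) /\
              dist1 n (phi (fst q)) (phi (snd q)) < / (INR k + 1) /\ eps <= distp (fst q) (snd q)) as H.
    { intros k. apply NNPP. intros Hn'. apply Hn. exists (/ (INR k + 1)). split; [apply inv_INR_pos|].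
      intros e e' H1 H2 H3. apply Rnot_le_lt. intros Hle. apply Hn'. exists (e, e'). auto. }
    destruct (choice _ H) as [q Hq].
    destruct (tc_compact _ _ _ _ HT (fun k => fst (q k)) (fun k => proj1 (Hq k))) as (e & f & Hf & He1 & Hcv1).
    destruct (tc_compact _ _ _ _ HT (fun k => snd (q (f k))) (fun k => proj1 (proj2 (Hq (f k)))))
      as (e' & g & Hg & He2 & Hcv2).
    assert (E : phi e = phi e').
    { apply (phi_lim (fun k => snd (q (f k))) g e' (phi e)); auto.
      - intros k. apply Hq.
      - apply psi_K.
      - intros r J Hr. destruct (phi_cont (r / 2)) as (d & Hd & H1); [lra|].
        destruct (Hcv1 d Hd) as [J1 HJ1]. destruct (inv_INR_lt (r / 2)) as [J2 HJ2]; [lra|].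
        set (j := (J + J1 + J2)%nat). exists j. split; [lia|].
        specialize (Hg j). specialize (HJ1 (g j) ltac:(lia)).
        destruct (Hq (f (g j))) as (Q1 & Q2 & Q3 & _).
        specialize (H1 _ _ Q1 He1 HJ1). specialize (Hf (g j)). specialize (HJ2 (f (g j)) ltac:(lia)).
        pose proof (dist1_tri n (phi e) (phi (fst (q (f (g j))))) (phi (snd (q (f (g j)))))).
        rewrite (dist1_sym n (phi e) (phi (fst (q (f (g j)))))) in H0. lra. }
    apply phi_inj in E; auto. subst e'.
    destruct (Hcv1 (eps / 2)) as [J1 HJ1]; [lra|]. destruct (Hcv2 (eps / 2)) as [J2 HJ2]; [lra|].
    set (j := (J1 + J2)%nat). specialize (Hg j). specialize (HJ1 (g j) ltac:(lia)).
    specialize (HJ2 j ltac:(lia)). destruct (Hq (f (g j))) as (_ & _ & _ & Q4).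
    pose proof (distp_tri (fst (q (f (g j)))) e (snd (q (f (g j))))).
    rewrite (distp_sym e (snd (q (f (g j))))) in H0. lra. }
  assert (Hext : forall part : pt -> R, (forall e, SE e -> Rabs (part e) <= 200) ->
            (forall e e', Rabs (part e - part e') <= distp e e') ->
            exists F : (nat -> R) -> R, (forall e, SE e -> F (phi e) = part e) /\
              forall eps, 0 < eps -> exists delta, 0 < delta /\
                forall x y, dist1 n x y < delta -> Rabs (F x - F y) < eps).
  { intros part Hb Hl. apply (uniform_extension SE phi n part 200); auto.
    - apply (tc_nonempty _ _ _ _ HT).
    - intros eps He. destruct (phi_inv eps He) as (d & Hd & H). exists d. split; auto.
      intros e e' H1 H2 H3. eapply Rle_lt_trans; [apply Hl | auto]. }
  assert (HextC : forall part : pt -> C, (forall e, SE e -> Cmod (part e) <= 200) ->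
            (forall e e', Cmod (part e - part e') <= distp e e') ->
            exists F : (nat -> R) -> C, (forall e, SE e -> F (phi e) = part e) /\
              forall eps, 0 < eps -> exists delta, 0 < delta /\
                forall x y, dist1 n x y < delta -> Cmod (F x - F y) < eps).
  { intros part Hb Hl.
    destruct (Hext (fun e => fst (part e))) as (F1 & H1 & C1).
    { intros e He. eapply Rle_trans; [apply fst_le_Cmod | auto]. }
    { intros e e'. eapply Rle_trans; [apply (fst_le_Cmod (part e - part e')%C) | auto]. }
    destruct (Hext (fun e => snd (part e))) as (F2 & H2 & C2).
    { intros e He. eapply Rle_trans; [apply snd_le_Cmod | auto]. }
    { intros e e'. eapply Rle_trans; [apply (snd_le_Cmod (part e - part e')%C) | auto]. }
    exists (fun x => (F1 x, F2 x)). split.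
    - intros e He. rewrite H1, H2 by auto. symmetry. apply surjective_pairing.
    - intros eps He. destruct (C1 (eps / 2)) as (d1 & Hd1 & D1); [lra|].
      destruct (C2 (eps / 2)) as (d2 & Hd2 & D2); [lra|].
      exists (Rmin d1 d2). split; [apply Rmin_pos; auto|]. intros x y Hxy.
      pose proof (Rmin_l d1 d2). pose proof (Rmin_r d1 d2).
      specialize (D1 x y ltac:(lra)). specialize (D2 x y ltac:(lra)).
      eapply Rle_lt_trans; [apply Cmod_le_abs|]. simpl. unfold Rminus in *. lra. }
  destruct (HextC (fun e => fst (fst e))) as (FA & HFA & CA).
  { intros e He. apply (tc_bounded _ _ _ _ HT e He). }
  { intros e e'. unfold distp, dist3. pose proof (Cmod_ge_0 (snd (fst e) - snd (fst e'))).
    pose proof (Cmod_ge_0 (snd e - snd e')). lra. }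
  destruct (HextC (fun e => snd (fst e))) as (FB & HFB & CB).
  { intros e He. apply (tc_bounded _ _ _ _ HT e He). }
  { intros e e'. unfold distp, dist3. pose proof (Cmod_ge_0 (fst (fst e) - fst (fst e'))).
    pose proof (Cmod_ge_0 (snd e - snd e')). lra. }
  destruct (HextC (fun e => snd e)) as (FW & HFW & CW).
  { intros e He. apply (tc_bounded _ _ _ _ HT e He). }
  { intros e e'. unfold distp, dist3. pose proof (Cmod_ge_0 (fst (fst e) - fst (fst e'))).
    pose proof (Cmod_ge_0 (snd (fst e) - snd (fst e'))). lra. }
  destruct (distance_function SE phi n (tc_nonempty _ _ _ _ HT)) as (t & t_pos & t_lip & t_zero & t_att).
  (* Compactness of [SE] turns distance zero into membership, so on [K] the zero set of [t] is
     exactly the embedded Cantor set. *)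
  assert (t_zero_inv : forall x, K x -> t x = 0 -> exists e, SE e /\ x = phi e).
  { intros x Hx Htx.
    assert (forall k : nat, exists e, SE e /\ dist1 n x (phi e) < / (INR k + 1)) as H.
    { intros k. destruct (t_att x _ (inv_INR_pos k)) as (e & He & Hd). exists e. split; auto. lra. }
    destruct (choice _ H) as [u Hu].
    destruct (tc_compact _ _ _ _ HT u (fun k => proj1 (Hu k))) as (e & f & Hf & He & Hcv).
    exists e. split; auto. apply (phi_lim u f e x); auto; [intros; apply Hu|].
    intros eps J He0. destruct (inv_INR_lt eps He0) as [J' HJ']. exists (J + J')%nat. split; [lia|].
    specialize (Hf (J + J')%nat). specialize (HJ' (f (J + J')%nat) ltac:(lia)).
    pose proof (proj2 (Hu (f (J + J')%nat))). lra. }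
  (* Three coordinates for the tower, one for [t] and [n] for [t x * x] make up [n + 4]. Where [t]
     vanishes the real coordinates collapse to 0, and the extended inverse alone separates points;
     elsewhere the real coordinates do. *)
  set (G := fun (x : nat -> R) (i : nat) => match i with
      | 0%nat => FA x | 1%nat => FB x | 2%nat => FW x | 3%nat => (t x, 0)
      | S (S (S (S j))) => (t x * x j, 0) end : C).
  assert (G_phi : forall e, SE e -> G (phi e) = pt3 (fst (fst e)) (snd (fst e)) (snd e)).
  { intros e He. apply functional_extensionality. intros i. unfold G.
    destruct i as [|[|[|[|i]]]]; cbn [pt3]; auto.
    - rewrite t_zero by auto. reflexivity.
    - rewrite t_zero by auto. rewrite Rmult_0_l. reflexivity. }
  assert (G_in : forall x, K x -> in_Cn N (G x)).
  { intros x Hx i Hi. unfold N in Hi. destruct i as [|[|[|[|i]]]]; try lia. simpl.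
    rewrite (HKsub x Hx i) by lia. rewrite Rmult_0_r. reflexivity. }
  assert (G_fib : forall x y, K x -> K y -> (forall i, (3 <= i < N)%nat -> G x i = G y i) -> t x <> 0 -> x = y).
  { intros x y Hx Hy H Ht. apply functional_extensionality. intros i.
    destruct (le_lt_dec n i) as [Hi|Hi]; [rewrite (HKsub x Hx), (HKsub y Hy); auto|].
    assert (E3 : t x = t y) by (apply (f_equal fst (H 3%nat ltac:(unfold N; lia)))).
    assert (Ei : t x * x i = t y * y i).
    { apply (f_equal fst (H (S (S (S (S i)))) ltac:(unfold N; lia))). }
    rewrite <- E3 in Ei. apply Rmult_eq_reg_l in Ei; auto. }
  assert (G_inj : forall x y, K x -> K y -> (forall i, (i < N)%nat -> G x i = G y i) -> x = y).
  { intros x y Hx Hy H. destruct (Req_dec (t x) 0) as [E|E].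
    - assert (E' : t y = 0).
      { rewrite <- E. symmetry. apply (f_equal fst (H 3%nat ltac:(unfold N; lia))). }
      destruct (t_zero_inv x Hx E) as (e & He & Ee). destruct (t_zero_inv y Hy E') as (e' & He' & Ee').
      rewrite Ee, Ee' in H |- *. rewrite !G_phi in H by auto.
      assert (e = e') as ->; auto.
      pose proof (H 0%nat ltac:(lia)) as E0. pose proof (H 1%nat ltac:(lia)) as E1.
      pose proof (H 2%nat ltac:(lia)) as E2. cbn [pt3] in E0, E1, E2.
      destruct e as [[? ?] ?]. destruct e' as [[? ?] ?]. simpl in *. congruence.
    - apply G_fib; auto. intros; apply H; lia. }
  assert (G_cont : forall x, K x -> forall eps, 0 < eps -> exists delta, 0 < delta /\
     forall y, K y -> dist1 n x y < delta -> forall i, (i < N)%nat -> Cmod (G x i - G y i) < eps).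
  { intros x Hx eps He.
    destruct (CA eps He) as (d1 & Hd1 & D1). destruct (CB eps He) as (d2 & Hd2 & D2).
    destruct (CW eps He) as (d3 & Hd3 & D3).
    set (X0 := dist1 n x (fun _ => 0)). assert (HX0 : 0 <= X0) by apply dist1_nonneg.
    (* For [y] near [x] one has [|y_i| <= X0 + 1], so [t x * x_i] changes by at most
       [(t x + X0 + 1) * dist1 n x y]; [Q] exceeds that factor. *)
    set (Q := t x + X0 + 2). pose proof (t_pos x) as Htx.
    assert (HQ : 0 < eps / Q) by (apply Rdiv_lt_0_compat; unfold Q; lra).
    set (d := Rmin (Rmin d1 d2) (Rmin d3 (Rmin 1 (eps / Q)))).
    assert (Hd : 0 < d) by (unfold d; repeat apply Rmin_pos; lra).
    pose proof (Rmin_l (Rmin d1 d2) (Rmin d3 (Rmin 1 (eps / Q)))) as M1.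
    pose proof (Rmin_r (Rmin d1 d2) (Rmin d3 (Rmin 1 (eps / Q)))) as M2.
    pose proof (Rmin_l d1 d2). pose proof (Rmin_r d1 d2).
    pose proof (Rmin_l d3 (Rmin 1 (eps / Q))). pose proof (Rmin_r d3 (Rmin 1 (eps / Q))).
    pose proof (Rmin_l 1 (eps / Q)). pose proof (Rmin_r 1 (eps / Q)). fold d in M1, M2.
    exists d. split; auto. intros y Hy Hxy i Hi.
    specialize (D1 x y ltac:(lra)). specialize (D2 x y ltac:(lra)). specialize (D3 x y ltac:(lra)).
    pose proof (t_lip x y) as Ht. pose proof (dist1_nonneg n x y) as Hxy0.
    assert (HQd : Q * dist1 n x y < eps).
    { apply Rlt_le_trans with (Q * (eps / Q)); [|right; field; unfold Q; lra].
      apply Rmult_lt_compat_l; [unfold Q|]; lra. }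
    destruct i as [|[|[|[|i]]]]; unfold G; auto.
    - change (Cmod (RtoC (t x) - RtoC (t y)) < eps). rewrite <- RtoC_minus, Cmod_R. unfold Q in HQd. nra.
    - change (Cmod (RtoC (t x * x i) - RtoC (t y * y i)) < eps). rewrite <- RtoC_minus, Cmod_R. unfold N in Hi.
      assert (Hxi : Rabs (x i) <= X0).
      { pose proof (rsum_term n (fun i => Rabs (x i - 0)) i (fun j _ => Rabs_pos _) ltac:(lia)) as Hr.
        cbn beta in Hr. rewrite Rminus_0_r in Hr. exact Hr. }
      assert (Hdi : Rabs (x i - y i) <= dist1 n x y).
      { apply (rsum_term n (fun i => Rabs (x i - y i)) i (fun j _ => Rabs_pos _)). lia. }
      assert (Hyi : Rabs (y i) <= X0 + 1).
      { replace (y i) with (x i - (x i - y i)) by ring. unfold Rminus at 1.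
        eapply Rle_trans; [apply Rabs_triang|]. rewrite Rabs_Ropp. lra. }
      replace (t x * x i - t y * y i) with (t x * (x i - y i) + y i * (t x - t y)) by ring.
      eapply Rle_lt_trans; [apply Rabs_triang|]. rewrite !Rabs_mult, (Rabs_pos_eq (t x)) by auto.
      assert (t x * Rabs (x i - y i) <= t x * dist1 n x y) by (apply Rmult_le_compat_l; auto).
      assert (Rabs (y i) * Rabs (t x - t y) <= (X0 + 1) * dist1 n x y)
        by (apply Rmult_le_compat; auto; apply Rabs_pos).
      unfold Q in HQd. lra. }
  assert (G_real : forall x i, K x -> (3 <= i)%nat -> snd (G x i) = 0).
  { intros x i _ Hi. destruct i as [|[|[|[|i]]]]; try lia; reflexivity. }
  assert (K_bound : exists BK, 0 <= BK /\ forall x, K x -> dist1 n x (fun _ => 0) <= BK).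
  { apply NNPP. intros Hn.
    assert (forall k : nat, exists x, K x /\ INR k < dist1 n x (fun _ => 0)) as H.
    { intros k. apply NNPP. intros Hn'. apply Hn. exists (INR k). split; [apply pos_INR|].
      intros x Hx. apply Rnot_lt_le. intros Hlt. apply Hn'. eauto. }
    destruct (choice _ H) as [u Hu].
    destruct (K_compact n K HKcpt u (fun k => proj1 (Hu k))) as (x & f & Hx & Hf & Hcv).
    destruct (Hcv 1) as [J HJ]; [lra|].
    destruct (INR_unbounded (dist1 n x (fun _ => 0) + 1)) as [M HM].
    specialize (HJ (J + M)%nat ltac:(lia)). specialize (Hf (J + M)%nat).
    pose proof (proj2 (Hu (f (J + M)%nat))).
    assert (INR M <= INR (f (J + M)%nat)) by (apply le_INR; lia).
    pose proof (dist1_tri n (u (f (J + M)%nat)) x (fun _ => 0)). lra. }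
  destruct K_bound as (BK & HBK & HKb).
  set (TB := t (fun _ => 0) + BK). pose proof (t_pos (fun _ => 0)) as Ht00.
  assert (G_bound : forall x i, K x -> (3 <= i)%nat -> Cmod (G x i) <= TB + TB * BK).
  { intros x i Hx Hi. specialize (HKb x Hx). pose proof (t_lip x (fun _ => 0)) as Hl.
    apply abs_le_between in Hl. pose proof (t_pos x) as Htx.
    assert (HtB : t x <= TB) by (unfold TB; lra).
    assert (HTB : 0 <= TB * BK) by (apply Rmult_le_pos; unfold TB; lra).
    destruct i as [|[|[|[|i]]]]; try lia; unfold G.
    - change (t x, 0) with (RtoC (t x)). rewrite Cmod_R, Rabs_pos_eq; lra.
    - change (t x * x i, 0) with (RtoC (t x * x i)). rewrite Cmod_R, Rabs_mult, (Rabs_pos_eq (t x)) by auto.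
      assert (Rabs (x i) <= BK).
      { destruct (le_lt_dec n i) as [Hin|Hin]; [rewrite (HKsub x Hx i Hin), Rabs_R0; auto|].
        pose proof (rsum_term n (fun i => Rabs (x i - 0)) i (fun j _ => Rabs_pos _) Hin) as Hr.
        cbn beta in Hr. rewrite Rminus_0_r in Hr. unfold dist1 in HKb. lra. }
      assert (t x * Rabs (x i) <= TB * BK) by (apply Rmult_le_compat; auto; apply Rabs_pos).
      unfold TB in *. lra. }
  exists (image_of K G). split; [intros z (x & Hx & ->); auto|]. split; [|split].
  - assert (Hg : forall z, exists x, image_of K G z -> K x /\ z = G x).
    { intros z. destruct (classic (image_of K G z)) as [(x & Hx & E)|Hn].
      - exists x. auto.
      - exists (fun _ => 0). intros; contradiction. }
    destruct (choice _ Hg) as [g Hg'].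
    exists G, g. split; [intros x Hx; exists x; auto|].
    split; [intros z Hz; apply Hg'; auto|]. split; [|split; [|split]].
    + intros x Hx. destruct (Hg' (G x)) as [H1 H2]; [exists x; auto|].
      apply G_inj; auto. intros i _. rewrite <- H2. reflexivity.
    + intros z Hz. symmetry. apply Hg'; auto.
    + intros x Hx eps He. pose proof (pos_INR N) as HN0.
      destruct (G_cont x Hx (eps / (INR N + 1))) as (d & Hd & H); [apply Rdiv_lt_0_compat; lra|].
      destruct (distR_small_dist1 n d Hd) as (d' & Hd' & H'). exists d'. split; auto.
      intros y Hy Hxy. specialize (H y Hy (H' _ _ Hxy)).
      assert (0 < eps / (INR N + 1)) by (apply Rdiv_lt_0_compat; lra).
      apply Rle_lt_trans with (INR N * (eps / (INR N + 1))).
      * apply distC_le; [lra|]. intros i Hi. left. auto.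
      * apply Rlt_le_trans with ((INR N + 1) * (eps / (INR N + 1))); [|right; field; lra].
        apply Rmult_lt_compat_r; lra.
    + intros z Hz eps He. destruct (Hg' z Hz) as [Hx Ez]. set (x := g z) in *.
      (* Otherwise points of [K] far from [x] have images tending to [G x]; a limit of them in [K]
         has the image [G x] too, against injectivity. *)
      apply NNPP. intros Hn.
      assert (forall k : nat, exists y, K y /\ distC N (G x) (G y) < / (INR k + 1) /\ eps <= dist1 n x y) as H.
      { intros k. apply NNPP. intros Hn'. apply Hn. exists (/ (INR k + 1)). split; [apply inv_INR_pos|].
        intros z' Hz' Hd. destruct (Hg' z' Hz') as [Hy Ez']. apply Rnot_le_lt. intros Hle. apply Hn'.
        exists (g z'). split; auto. rewrite <- Ez', <- Ez. split; auto.
        eapply Rle_trans; [apply Hle | apply distR_le_dist1]. }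
      destruct (choice _ H) as [u Hu].
      destruct (K_compact n K HKcpt u (fun k => proj1 (Hu k))) as (y & f & Hy & Hf & Hcv).
      assert (Exy : x = y).
      { apply G_inj; auto. intros i Hi. apply Cmod_sub0. apply Rle_antisym; [|apply Cmod_ge_0].
        apply Rnot_lt_le. intros Hlt. set (r := Cmod (G x i - G y i) / 2).
        destruct (G_cont y Hy r) as (d & Hd & H1); [unfold r; lra|].
        destruct (Hcv d Hd) as [J HJ]. destruct (inv_INR_lt r) as [J' HJ']; [unfold r; lra|].
        set (j := (J + J')%nat). specialize (HJ j ltac:(lia)). specialize (Hf j).
        specialize (HJ' (f j) ltac:(lia)). destruct (Hu (f j)) as (U1 & U2 & _).
        rewrite dist1_sym in HJ. specialize (H1 _ U1 HJ i Hi).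
        pose proof (le_distC N (G x) (G (u (f j))) i Hi).
        pose proof (Cmod_sub_tri (G x i) (G (u (f j)) i) (G y i)).
        rewrite (Cmod_sub_sym (G (u (f j)) i) (G y i)) in H2. unfold r in *. lra. }
      destruct (Hcv eps He) as [J HJ]. specialize (HJ J (le_n _)).
      destruct (Hu (f J)) as (_ & _ & U3). rewrite Exy, dist1_sym in U3. lra.
  - destruct (tc_hull _ _ _ _ HT) as (a & b & w & Hh & Hnot). exists (pt3 a b w). split.
    + split.
      * intros i Hi. destruct i as [|[|[|i]]]; try (unfold N in Hi; lia). reflexivity.
      * intros p Hp M HM. apply (Hh p Hp M). intros a' b' w' He.
        change (pt3 a' b' w') with (pt3 (fst (fst (a', b', w'))) (snd (fst (a', b', w'))) (snd (a', b', w'))).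
        rewrite <- (G_phi (a', b', w') He). apply HM. exists (phi (a', b', w')). split; auto. apply psi_K.
    + intros (x & Hx & E).
      (* The fourth coordinate of the new hull point is 0, so a preimage would lie in the embedded
         Cantor set, where [G] returns points of [SE]. *)
      assert (Htx : t x = 0) by (symmetry; apply (f_equal (fun z : nat -> C => fst (z 3%nat)) E)).
      destruct (t_zero_inv x Hx Htx) as (e & He & Ee). rewrite Ee, (G_phi e He) in E.
      apply Hnot. pose proof (f_equal (fun z : nat -> C => z 0%nat) E) as E0.
      pose proof (f_equal (fun z : nat -> C => z 1%nat) E) as E1.
      pose proof (f_equal (fun z : nat -> C => z 2%nat) E) as E2. cbn [pt3] in E0, E1, E2.
      rewrite E0, E1, E2. destruct e as [[? ?] ?]. exact He.
  - intros (sigma & (S1 & S2 & S3) & S4).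
    assert (Hin : forall w : C, in_disc w <-> Cmod w < 1) by (intros; split; auto).
    pose proof (fun v i => hull_real K N G _ G_real G_bound v i) as Hreal.
    assert (D : forall i, (i < N)%nat -> forall w, Cmod w < 1 -> exists l, deriv_at (fun u => sigma u i) w l).
    { intros i Hi w Hw. apply differentiable_deriv. apply S3; auto. }
    assert (H0 : Cmod (RtoC 0) < 1) by (rewrite Cmod_0; lra).
    (* The hull is real in these coordinates and a real-valued holomorphic function is constant, so
       the disc lies over a single real fibre. *)
    assert (Hconst : forall i, (3 <= i < N)%nat -> forall w, Cmod w < 1 -> sigma w i = sigma (RtoC 0) i).
    { intros i Hi. apply (deriv_zero_const (fun u => sigma u i)). intros w Hw.
      destruct (D i ltac:(lia) w Hw) as [l Hl].
      rewrite <- (real_valued_deriv_zero (fun u => sigma u i) w l Hw); auto. }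
    assert (Hfib : forall w p M, Cmod w < 1 -> is_poly N p -> 0 <= M ->
              (forall x, K x -> (forall i, (3 <= i < N)%nat -> G x i = sigma (RtoC 0) i) -> Cmod (p (G x)) <= M) ->
              Cmod (p (sigma w)) <= M).
    { intros w p M Hw Hp HM Hf.
      apply (hull_fibre n K HKcpt N G _ G_cont G_real G_bound (sigma w) p M); auto.
      intros x Hx Hi. apply Hf; auto. intros i Hi'. rewrite Hi by auto. apply Hconst; auto. }
    (* Constancy in all coordinates contradicts injectivity, tested at 0 and 1/2. *)
    assert (Hall : (forall i, (i < N)%nat -> forall w, Cmod w < 1 -> sigma w i = sigma (RtoC 0) i) -> False).
    { intros Hc. set (h := RtoC (1 / 2)).
      assert (Hh : Cmod h < 1) by (unfold h; rewrite Cmod_R, Rabs_pos_eq; lra).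
      assert (E : h = RtoC 0).
      { apply S2; auto. apply functional_extensionality. intros i.
        destruct (le_lt_dec N i) as [Hi|Hi]; [rewrite (S1 h), (S1 (RtoC 0)); auto | apply Hc; auto]. }
      apply RtoC_inj in E. lra. }
    apply Hall. intros i Hi w Hw.
    destruct (le_lt_dec 3 i) as [Hi3|Hi3]; [apply Hconst; auto|].
    (* The coordinate [t] decides: over 0 the points of the image in the fibre all come from [SE],
       and elsewhere there is at most one such point. *)
    destruct (Req_dec (fst (sigma (RtoC 0) 3%nat)) 0) as [Et|Et].
    + assert (HfS : forall x, K x -> (forall i, (3 <= i < N)%nat -> G x i = sigma (RtoC 0) i) ->
                exists e, SE e /\ G x = pt3 (fst (fst e)) (snd (fst e)) (snd e)).
      { intros x Hx Hf. assert (Htx : t x = 0).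
        { rewrite <- Et, <- (Hf 3%nat) by (unfold N; lia). reflexivity. }
        destruct (t_zero_inv x Hx Htx) as (e & He & ->). exists e. auto. }
      assert (HC : forall w, Cmod w < 1 ->
                sigma w 0%nat = sigma (RtoC 0) 0%nat /\ sigma w 1%nat = sigma (RtoC 0) 1%nat /\
                sigma w 2%nat = sigma (RtoC 0) 2%nat).
      { apply (tc_no_disc _ _ _ _ HT (fun w => sigma w 0%nat) (fun w => sigma w 1%nat) (fun w => sigma w 2%nat));
          try (apply D; lia).
        intros u Hu. apply (tc_Y _ _ _ _ HT).
        - apply (Hfib u (fun v => v 0%nat) 200 Hu); [apply poly_coord; lia | lra|].
          intros x Hx Hf. destruct (HfS x Hx Hf) as (e & He & ->). apply (tc_bounded _ _ _ _ HT e He).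
        - apply (Hfib u (fun v => v 1%nat) 200 Hu); [apply poly_coord; lia | lra|].
          intros x Hx Hf. destruct (HfS x Hx Hf) as (e & He & ->). apply (tc_bounded _ _ _ _ HT e He).
        - intros j. apply (Hfib u (Yp j) 100 Hu); [apply (tc_poly _ _ _ _ HT) | lra|].
          intros x Hx Hf. destruct (HfS x Hx Hf) as (e & He & ->). apply (tc_poly_bound _ _ _ _ HT); auto. }
      destruct (HC w Hw) as (C0 & C1 & C2). destruct i as [|[|[|i]]]; auto; lia.
    + destruct (classic (exists x, K x /\ forall i, (3 <= i < N)%nat -> G x i = sigma (RtoC 0) i))
        as [(x & Hx & Hf)|Hn].
      * assert (Hsig : forall u, Cmod u < 1 -> sigma u i = G x i).
        { intros u Hu. apply Cmod_sub0. apply Rle_antisym; [|apply Cmod_ge_0].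
          apply (Hfib u (fun v => v i - G x i)%C 0 Hu); [|lra|].
          - apply poly_minus; [apply poly_coord; auto | apply poly_cst].
          - intros y Hy Hfy. assert (y = x) as ->.
            { symmetry. apply G_fib; auto.
              - intros k Hk. rewrite Hf, Hfy by auto. reflexivity.
              - intros E. apply Et. rewrite <- (Hf 3%nat) by (unfold N; lia). exact E. }
            replace (G x i - G x i)%C with (RtoC 0) by ring. rewrite Cmod_0. lra. }
        rewrite !Hsig; auto.
      (* Over an empty fibre there is no hull point, for there even the constant 1 would be bounded
         by 0. *)
      * exfalso. assert (Cmod (RtoC 1) <= 0).
        { apply (Hfib w (fun _ => RtoC 1) 0 Hw); [apply poly_cst | lra|].
          intros x Hx Hf. exfalso. apply Hn. eauto. }
        rewrite Cmod_1 in H. lra.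
Qed.
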